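(* Let $L\subset L_2(E,\mu)$ be a closed subspace whose orthogonal projection operator $Q$ lies in $\mathscr I_{1,\mathrm{loc}}(E,\mu)$, let $V\subset L_{2,\mathrm{loc}}(E,\mu)$ be a finite-dimensional subspace, and let $E_0\subset E$ be a Borel set, such that $L$, $V$, $E_0$ satisfy Assumption A (see context) and, additionally, $V\cap L_2(E,\mu)=0$. Set $H=L+V$. Let $g_n:E\to(0,1]$, $n\in\mathbb N$, be a sequence of positive measurable functions such that (1) for all $n\in\mathbb N$ we have $\sqrt{1-g_n}\,Q\sqrt{1-g_n}\in\mathscr I_1(E,\mu)$; (2) for all $n\in\mathbb N$ we have $\sqrt{g_n}V\subset L_2(E,\mu)$; (3) there exists $\alpha_0>0$ such that for all $n$ we have $\operatorname{angle}(\sqrt{g_n}L,\sqrt{g_n}V)\ge\alpha_0$; (4) for any bounded $B\subset E$ we have $$\inf_{n\in\mathbb N,\,x\in E_0\cup B}g_n(x)>0,\qquad \lim_{n\to\infty}\sup_{x\in E_0\cup B}|g_n(x)-1|=0 .$$ Let $\Pi^{g_n}$ be the operator of orthogonal projection onto the closed subspace $\sqrt{g_n}H$ of $L_2(E,\mu)$. Then, as $n\to\infty$, $\Pi^{g_n}\to Q$ in $\mathscr I_{1,\mathrm{loc}}(E,\mu)$.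
   Context: $E$ is a locally compact complete separable metric space in which bounded sets have compact closure, and $\mu$ is a sigma-finite Borel measure on $E$. $\mathscr I_1(E,\mu)$ is the space of trace-class operators on $L_2(E,\mu)$ with the trace norm. $\mathscr I_{1,\mathrm{loc}}(E,\mu)$ is the space of bounded operators $K$ on $L_2(E,\mu)$ such that $\chi_BK\chi_B\in\mathscr I_1(E,\mu)$ for every bounded Borel set $B\subset E$; convergence $K_n\to K$ in $\mathscr I_{1,\mathrm{loc}}(E,\mu)$ means $\|\chi_B(K_n-K)\chi_B\|_{\mathscr I_1}\to0$ for every bounded Borel $B$. $L_{2,\mathrm{loc}}(E,\mu)$ is the space of measurable functions (mod $\mu$) square integrable on every bounded Borel set. Functions are identified with multiplication operators. For subspaces $H_1,H_2\subset L_2(E,\mu)$, $\operatorname{angle}(H_1,H_2)$ is the infimum of the angles between nonzero vectors of $H_1$ and nonzero vectors of $H_2$. Assumption A for $(L,V,E_0)$: (A1) $\chi_{E\setminus E_0}Q\chi_{E\setminus E_0}\in\mathscr I_1(E,\mu)$; (A2) $\chi_{E_0}V\subset L_2(E,\mu)$; (A3) if $\varphi\in V$ satisfies $\chi_{E_0}\varphi\in\chi_{E_0}L$, then $\varphi=0$; (A4) if $\varphi\in L$ satisfies $\chi_{E_0}\varphi=0$, then $\varphi=0$. *)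

(* Defs.v *)
From HB Require Import structures.
From mathcomp Require Import all_boot all_order all_algebra.
From mathcomp Require Import complex.
From mathcomp Require Import all_classical all_reals all_analysis.

Set Implicit Arguments.
Unset Strict Implicit.
Unset Printing Implicit Defensive.

Import Order.TTheory GRing.Theory Num.Theory.
Import numFieldTopology.Exports numFieldNormedType.Exports.

Local Open Scope classical_set_scope.
Local Open Scope ring_scope.

#[short(type="completeMetricType")]
HB.structure Definition CompleteMetric (K : numDomainType) :=
  {T of Metric K T & Complete T}.

Section MetricSpaces.
Context {R : realType} (E : completeMetricType R).

Definition metric_bounded (B : set E) := exists x r, B `<=` ball x r.

Definition separable := exists2 D : set E, countable D & dense D.

Definition borel := g_sigma_algebraType (@open E).

End MetricSpaces.

(* A complex function on T is identified with its class modulo mu: "subspaces"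
   below are sets of measurable functions closed under a.e. equality, and
   operators on L_2 are maps on representatives, respecting a.e. equality and
   constrained on square integrable functions only. *)
Section L2.
Context d (T : measurableType d) (R : realType).
Variable mu : {measure set T -> \bar R}.
Local Notation C := R[i].
Implicit Types (f g : T -> C) (h : T -> R) (V W : set (T -> C)).
Implicit Types (K A : (T -> C) -> (T -> C)).

Definition cmeasurable f :=
  measurable_fun setT (fun x => complex.Re (f x)) /\
  measurable_fun setT (fun x => complex.Im (f x)).

Definition cabs2 (z : C) : R := complex.Re z ^+ 2 + complex.Im z ^+ 2.

Definition L2_on (D : set T) f :=
  cmeasurable f /\ (\int[mu]_(x in D) (cabs2 (f x))%:E < +oo)%E.

Definition L2 : set (T -> C) := L2_on setT.

(* Rintegral is junk on non-integrable functions; for f, g in L2 the two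
   integrands are integrable. *)
Definition inner f g : C :=
  Complex (Rintegral mu setT (fun x => complex.Re (f x * conjc (g x))))
          (Rintegral mu setT (fun x => complex.Im (f x * conjc (g x)))).

Definition L2norm f : R := Num.sqrt (complex.Re (inner f f)).

Definition is_subspace V :=
  [/\ V `<=` cmeasurable,
      V (cst 0),
      forall (a : C) f g, V f -> V g -> V (fun x => a * f x + g x) &
      forall f g, V f -> cmeasurable g -> f = g %[ae mu] -> V g].

Definition finite_dimensional V :=
  exists m (v : 'I_m -> T -> C), (forall i, V (v i)) /\
    forall f, V f -> exists c : 'I_m -> C,
      f = (fun x => \sum_(i < m) c i * v i x) %[ae mu].

Definition closed_subspace V :=
  [/\ is_subspace V, V `<=` L2 &
      forall f, L2 f ->
        (forall e : R, 0 < e ->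
           exists2 g, V g & L2norm (fun x => f x - g x) < e) -> V f].

Definition mulf h f : T -> C := fun x => real_complex R (h x) * f x.

Definition mulS h V : set (T -> C) :=
  [set f | cmeasurable f /\ exists2 g, V g & f = mulf h g %[ae mu]].

Definition addS V W : set (T -> C) :=
  [set f | cmeasurable f /\ exists g1 g2,
     [/\ V g1, W g2 & f = (fun x => g1 x + g2 x) %[ae mu]]].

Definition vector_angle f g : R :=
  acos (complex.Re (inner f g) / (L2norm f * L2norm g)).

(* +oo when V or W is zero. For complex subspaces the infimum does not change
   if `|inner f g| is used in vector_angle instead of its real part. *)
Definition angle V W : \bar R :=
  ereal_inf [set t | exists f g,
    [/\ V f /\ ~ (f = cst 0 %[ae mu]), W g /\ ~ (g = cst 0 %[ae mu]) &
        t = (vector_angle f g)%:E]].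

Definition bounded_operator K :=
  [/\ forall f, L2 f -> L2 (K f),
      forall f g, L2 f -> L2 g -> f = g %[ae mu] -> K f = K g %[ae mu],
      forall (a : C) f g, L2 f -> L2 g ->
        K (fun x => a * f x + g x) = (fun x => a * K f x + K g x) %[ae mu] &
      exists M : R, forall f, L2 f -> L2norm (K f) <= M * L2norm f].

Definition orthogonal_projection V K :=
  forall f, L2 f ->
    V (K f) /\ forall g, V g -> inner (fun x => f x - K f x) g = 0.

Definition orthonormal_basis (B : set (T -> C)) :=
  [/\ B `<=` L2,
      forall e, B e -> inner e e = 1,
      forall e e', B e -> B e' -> e <> e' -> inner e e' = 0 &
      forall f, L2 f -> (forall e, B e -> inner f e = 0) ->
        f = cst 0 %[ae mu]].

(* A = |K|, i.e. A is nonnegative and A^2 = K^* K. The order of R[i] makes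
   0 <= z assert that z is real. *)
Definition is_absolute_value K A :=
  [/\ bounded_operator A,
      forall f, L2 f -> 0 <= inner (A f) f &
      forall f g, L2 f -> L2 g -> inner (A (A f)) g = inner (K f) (K g)].

(* The trace norm is the trace of |K| in an orthonormal basis. The operator |K|
   is unique and the trace does not depend on the basis, so for a bounded K the
   supremum is over a singleton. *)
Definition trace_norm K : \bar R :=
  ereal_sup [set t | exists A (B : set (T -> C)),
    [/\ is_absolute_value K A, orthonormal_basis B &
        t = \esum_(e in B) (complex.Re (inner (A e) e))%:E]].

Definition trace_class K := bounded_operator K /\ (trace_norm K < +oo)%E.

Definition sandwich h K : (T -> C) -> (T -> C) :=
  fun f => mulf h (K (mulf h f)).

End L2.

Section Local.
Context {R : realType} (E : completeMetricType R).
Variable mu : {measure set (borel E) -> \bar R}.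
Local Notation C := R[i].
Implicit Types (K : (borel E -> C) -> (borel E -> C)).

Definition L2_loc : set (borel E -> C) :=
  [set f | cmeasurable f /\
     forall B : set (borel E), measurable B -> metric_bounded B ->
       L2_on mu B f].

Definition trace_class_loc K :=
  bounded_operator mu K /\
  forall B : set (borel E), measurable B -> metric_bounded B ->
    trace_class mu (sandwich \1_B K).

Definition cvg_trace_class_loc (Kn : nat -> (borel E -> C) -> (borel E -> C))
    K :=
  [/\ forall n, trace_class_loc (Kn n), trace_class_loc K &
      forall B : set (borel E), measurable B -> metric_bounded B ->
        trace_norm mu (sandwich \1_B (fun f x => Kn n f x - K f x))
          @[n --> \oo] --> 0%E].

(* Q is the orthogonal projection onto L. *)
Definition assumptionA (L V : set (borel E -> C)) Q (E0 : set (borel E)) :=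
  [/\ trace_class mu (sandwich \1_(~` E0) Q),
      mulS mu \1_E0 V `<=` L2 mu,
      forall f, V f -> mulS mu \1_E0 L (mulf \1_E0 f) -> f = cst 0 %[ae mu] &
      forall f, L f -> mulf \1_E0 f = cst 0 %[ae mu] -> f = cst 0 %[ae mu]].

End Local.

(* Main.v *)
(* Regard L2 as a real Hilbert space, let [h = sqrt g_n], and let [P] be the
   multiplication by the indicator of a bounded set.  If [s ^ 2 = 1 - h ^ 2] and
   [s Q s] is trace class, then [s Q] is Hilbert-Schmidt, so the injective
   multiplication by [h] is bounded below on [L]; by A1 and A4 the same holds for
   the indicator of [E0], which makes the bound uniform in [n].  With the angle
   condition, the projection onto [h H] is [Pi_n f = h l + w] with [l] in [L] and
   [w] in [h V] bounded linear functions of [f], and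
     [P (Pi_n - Q) f = (h - 1) P Q l + P Q (1 - h ^ 2) l - P Q (1 - h) f
        - P Q h w + P w]
   tends to 0 in Hilbert-Schmidt norm: [P Q] is Hilbert-Schmidt and [h] tends to 1
   strongly, while [w] ranges over a space of bounded dimension and is small on
   bounded sets, because no nonzero element of [V] is square integrable.
   The trace norm convergence follows from
   [P (Pi_n - Q) P = P (Pi_n - Q) Pi_n P + P Q (Pi_n - Q) P], a sum of products of
   two Hilbert-Schmidt operators. *)
Require Import Defs.
From HB Require Import structures.
From mathcomp Require Import all_boot all_order all_algebra finmap.
From mathcomp Require Import complex.
From mathcomp Require Import all_classical all_reals all_analysis.
From mathcomp Require Import measurable_realfun.
From mathcomp Require Import ring lra.

Set Implicit Arguments.
Unset Strict Implicit.
Unset Printing Implicit Defensive.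

Import Order.TTheory GRing.Theory Num.Theory.
Import numFieldTopology.Exports numFieldNormedType.Exports.

Local Open Scope classical_set_scope.
Local Open Scope ring_scope.

(** * Real Hilbert spaces *)

(** The weights tend to 1 uniformly on bounded sets but only strongly on L2, and strong convergence
    becomes norm convergence only next to a fixed Hilbert-Schmidt operator. The expansion of
    [P (Pi_n - Q)] is arranged so that every [1 - h] is either localized by [P] or stands beside
    [P Q]. The vectors [w] need not converge: a unit vector of [h V] may spread out to infinity. Its
    coefficients in a basis of [V] nevertheless tend to 0 uniformly, because the norms over large
    balls of the normalized elements of [V] grow without bound, and this makes [w] small on any
    fixed ball. The scalars are real because the angle condition and all estimates involve only the
    real part of the inner product; complex linearity is commutation with multiplication by [i]. The
    trace norm is the trace of [|K|], whereas a factorization of [K] bounds the sums of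
    [ip (K e) (U e)] over contractions [U]; the polar decomposition that links the two is
    approximated rather than constructed. *)

Record hilbert (R : realType) := Hilbert {
  hsort :> lmodType R;
  ip : hsort -> hsort -> R;
  ipC : forall x y, ip x y = ip y x;
  ipDl : forall x y z, ip (x + y) z = ip x z + ip y z;
  ipZl : forall a x y, ip (a *: x) y = a * ip x y;
  ip_ge0 : forall x, 0 <= ip x x;
  ip_eq0 : forall x, ip x x = 0 -> x = 0;
  ip_complete : forall u : nat -> hsort,
    (forall e : R, 0 < e -> exists N, forall m n, (N <= m)%N -> (N <= n)%N ->
       ip (u m - u n) (u m - u n) < e) ->
    exists l, forall e : R, 0 < e -> exists N, forall n, (N <= n)%N ->
       ip (u n - l) (u n - l) < e }.

Section InnerProduct.
Context {R : realType} {H : hilbert R}.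
Implicit Types (x y z : H) (a : R) (s : seq H).

Lemma ipDr x y z : ip x (y + z) = ip x y + ip x z.
Proof. by rewrite ipC ipDl !(ipC _ x). Qed.

Lemma ipZr a x y : ip x (a *: y) = a * ip x y.
Proof. by rewrite ipC ipZl ipC. Qed.

Lemma ipNl x y : ip (- x) y = - ip x y.
Proof. by rewrite -scaleN1r ipZl mulN1r. Qed.

Lemma ipNr x y : ip x (- y) = - ip x y.
Proof. by rewrite ipC ipNl ipC. Qed.

Lemma ipBl x y z : ip (x - y) z = ip x z - ip y z.
Proof. by rewrite ipDl ipNl. Qed.

Lemma ipBr x y z : ip x (y - z) = ip x y - ip x z.
Proof. by rewrite ipDr ipNr. Qed.

Lemma ip0l x : ip 0 x = 0.
Proof. by rewrite -(scale0r (0 : H)) ipZl mul0r. Qed.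

Lemma ip0r x : ip x 0 = 0.
Proof. by rewrite ipC ip0l. Qed.

Lemma ip_suml I (r : seq I) (P : pred I) (F : I -> H) y :
  ip (\sum_(i <- r | P i) F i) y = \sum_(i <- r | P i) ip (F i) y.
Proof.
by apply: (big_morph (fun x => ip x y)) => [? ?|]; rewrite ?ipDl ?ip0l.
Qed.

Lemma ip_sumr I (r : seq I) (P : pred I) (F : I -> H) y :
  ip y (\sum_(i <- r | P i) F i) = \sum_(i <- r | P i) ip y (F i).
Proof. by rewrite ipC ip_suml; apply: eq_bigr => i _; rewrite ipC. Qed.

Definition hn x : R := Num.sqrt (ip x x).

Lemma hn_ge0 x : 0 <= hn x.
Proof. exact: sqrtr_ge0. Qed.

Lemma hn2 x : hn x ^+ 2 = ip x x.
Proof. by rewrite sqr_sqrtr// ip_ge0. Qed.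

Lemma hn0 : hn 0 = 0.
Proof. by rewrite /hn ip0l sqrtr0. Qed.

Lemma hn_eq0 x : hn x = 0 -> x = 0.
Proof. by move=> x0; apply: ip_eq0; rewrite -hn2 x0 expr0n. Qed.

Lemma hn_gt0 x : x <> 0 -> 0 < hn x.
Proof.
move=> x0; rewrite lt_neqAle hn_ge0 andbT eq_sym.
by apply/eqP => /hn_eq0.
Qed.

Lemma hnZ a x : hn (a *: x) = `|a| * hn x.
Proof. by rewrite /hn ipZl ipZr mulrA -expr2 sqrtrM ?sqr_ge0// sqrtr_sqr. Qed.

Lemma hnN x : hn (- x) = hn x.
Proof. by rewrite -scaleN1r hnZ normrN1 mul1r. Qed.

Lemma hn_distC x y : hn (x - y) = hn (y - x).
Proof. by rewrite -hnN opprB. Qed.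

Lemma ip_hnD x y : ip (x + y) (x + y) = ip x x + 2 * ip x y + ip y y.
Proof. by rewrite ipDl !ipDr (ipC y x); ring. Qed.

Lemma ip_hnB x y : ip (x - y) (x - y) = ip x x - 2 * ip x y + ip y y.
Proof. by rewrite ip_hnD ipNr ipNl ipNr; ring. Qed.

Lemma ip_sqr_le x y : ip x y ^+ 2 <= ip x x * ip y y.
Proof.
have [y0|y0] := eqVneq (ip y y) 0.
  by rewrite (ip_eq0 y0) !ip0r expr0n /= mulr0.
have yp : 0 < ip y y by rewrite lt_neqAle eq_sym y0 ip_ge0.
have := ip_ge0 (ip y y *: x - ip x y *: y).
rewrite ip_hnB !ipZl !ipZr => h.
have : 0 <= ip y y * (ip x x * ip y y - ip x y ^+ 2).
  by apply: le_trans h _; rewrite le_eqVlt; apply/orP; left; apply/eqP; ring.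
by rewrite pmulr_rge0// subr_ge0.
Qed.

Lemma ip_le x y : `|ip x y| <= hn x * hn y.
Proof.
rewrite -(@ler_pXn2r _ 2)// ?nnegrE ?mulr_ge0 ?hn_ge0//.
by rewrite real_normK ?num_real// exprMn !hn2 ip_sqr_le.
Qed.

Lemma ip_le' x y : ip x y <= hn x * hn y.
Proof. exact: le_trans (ler_norm _) (ip_le x y). Qed.

Lemma hnD x y : hn (x + y) <= hn x + hn y.
Proof.
rewrite -(@ler_pXn2r _ 2)// ?nnegrE ?addr_ge0 ?hn_ge0//.
rewrite hn2 ip_hnD sqrrD !hn2 -mulr_natr.
by have := ip_le' x y; lra.
Qed.

Lemma hnB x y : hn (x - y) <= hn x + hn y.
Proof. by rewrite -(hnN y) hnD. Qed.

Lemma hn_dist_triangle z x y : hn (x - y) <= hn (x - z) + hn (z - y).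
Proof. by have := hnD (x - z) (z - y); rewrite addrA subrK. Qed.

Lemma hn_sum I (r : seq I) (P : pred I) (F : I -> H) :
  hn (\sum_(i <- r | P i) F i) <= \sum_(i <- r | P i) hn (F i).
Proof.
apply: (big_ind2 (fun x b => hn x <= b)) => [|x a y b xa yb|//].
  by rewrite hn0.
by apply: le_trans (hnD _ _) _; exact: lerD.
Qed.

Lemma ip_hnD_le x y : ip (x + y) (x + y) <= 2 * ip x x + 2 * ip y y.
Proof. by rewrite ip_hnD; have := ip_ge0 (x - y); rewrite ip_hnB; lra. Qed.

Lemma parallelogram x y :
  ip (x + y) (x + y) + ip (x - y) (x - y) = 2 * ip x x + 2 * ip y y.
Proof. by rewrite ip_hnD ip_hnB; ring. Qed.

Lemma hn_complete (u : nat -> H) :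
  (forall e : R, 0 < e -> exists N, forall m n, (N <= m)%N -> (N <= n)%N ->
     hn (u m - u n) < e) ->
  exists l, forall e : R, 0 < e -> exists N, forall n, (N <= n)%N ->
     hn (u n - l) < e.
Proof.
move=> uC; have [|l ul] := @ip_complete _ H u.
  move=> e e0; have [|N NP] := uC (Num.sqrt e); first by rewrite sqrtr_gt0.
  by exists N => m n Nm Nn; have := NP m n Nm Nn; rewrite ltr_sqrt.
exists l => e e0; have [|N NP] := ul (e ^+ 2); first by rewrite exprn_gt0.
exists N => n Nn; have := NP n Nn.
by rewrite -hn2 ltr_pXn2r// nnegrE ?hn_ge0// ltW.
Qed.

Lemma ip_bound_eq0 x (c : R) : (forall e, 0 < e -> hn x <= c * e) -> x = 0.
Proof.
move=> xe; apply: hn_eq0; apply/eqP; rewrite eq_le hn_ge0 andbT.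
apply/ler_addgt0Pl => e e0; rewrite addr0.
have := xe (e / (1 + `|c|)); rewrite divr_gt0 ?ltr_wpDr// => /(_ isT) h.
apply: le_trans h _; rewrite mulrCA ger_pMr//.
rewrite ler_pdivrMr ?ltr_wpDr// mul1r.
by apply: le_trans (ler_norm c) _; rewrite lerDr.
Qed.

Definition submod (N : set H) :=
  N 0 /\ forall a x y, N x -> N y -> N (a *: x + y).

Lemma submodD N x y : submod N -> N x -> N y -> N (x + y).
Proof. by case=> _ h Nx Ny; have := h 1 _ _ Nx Ny; rewrite scale1r. Qed.

Lemma submodZ N a x : submod N -> N x -> N (a *: x).
Proof. by case=> h0 h Nx; have := h a _ _ Nx h0; rewrite addr0. Qed.

Lemma submodB N x y : submod N -> N x -> N y -> N (x - y).
Proof.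
by move=> sN Nx Ny; apply: submodD => //; rewrite -scaleN1r; exact: submodZ.
Qed.

Lemma submodT : submod setT.
Proof. by []. Qed.

(* The minimizing sequence of the distance from [y] to [N] is Cauchy by the
   parallelogram identity. *)
Lemma projection (N : set H) y : submod N ->
  exists z, (forall e, 0 < e -> exists2 n, N n & hn (z - n) < e) /\
            (forall n, N n -> ip (y - z) n = 0).
Proof.
move=> sN; pose D := [set hn (y - n) ^+ 2 | n in N].
have D0 : D !=set0 by exists (hn (y - 0) ^+ 2), 0 => //; case: sN.
have Dlb : has_inf D.
  by split => //; exists 0 => _ [n _ <-]; exact: sqr_ge0.
pose d := inf D.
have dle n : N n -> d <= hn (y - n) ^+ 2.
  by move=> Nn; apply: ge_inf; [case: Dlb | exists n].
have dapp (e : R) : 0 < e -> exists2 n, N n & hn (y - n) ^+ 2 < d + e.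
  by move=> e0; have [_ [n Nn <-] ?] := inf_adherent e0 Dlb; exists n.
have dist m n (e : R) : N m -> N n -> hn (y - m) ^+ 2 < d + e ->
    hn (y - n) ^+ 2 < d + e -> hn (m - n) ^+ 2 < 4 * e.
  move=> Nm Nn ym yn; have := parallelogram (y - n) (y - m).
  have -> : y - n - (y - m) = m - n by rewrite opprB addrC addrA subrK.
  have := dle (2^-1 *: (m + n)) (submodZ _ sN (submodD sN Nm Nn)).
  have -> : y - n + (y - m) = 2 *: (y - 2^-1 *: (m + n)).
    rewrite scalerBr scalerA mulfV ?pnatr_eq0// scale1r scaler_nat mulr2n.
    by rewrite addrACA -opprD (addrC n).
  rewrite ipZl ipZr -!hn2; lra.
pose e_ (k : nat) : R := k.+1%:R^-1.
have e_gt0 k : 0 < e_ k by rewrite invr_gt0.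
have e_le k l : (k <= l)%N -> e_ l <= e_ k.
  by move=> kl; rewrite lef_pV2 ?posrE// ler_nat.
have e_small (e : R) : 0 < e -> exists k, e_ k < e.
  move=> e0; exists (Num.truncn e^-1); rewrite -[ltRHS]invrK ltf_pV2 ?posrE ?invr_gt0//.
  by rewrite truncnS_gt.
have [u uP] : {u : nat -> H & forall k,
    N (u k) /\ hn (y - u k) ^+ 2 < d + e_ k}.
  apply: (@choice nat H (fun k n => N n /\ hn (y - n) ^+ 2 < d + e_ k)) => k.
  by have [n ? ?] := dapp _ (e_gt0 k); exists n.
have [|z zu] := @hn_complete u.
  move=> e e0; have [|k ke] := e_small (e ^+ 2 / 4).
    by rewrite divr_gt0// exprn_gt0.
  exists k => m n km kn.
  have lt l : (k <= l)%N -> hn (y - u l) ^+ 2 < d + e_ k.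
    by move=> kl; apply: lt_le_trans (uP l).2 _; rewrite lerD2l e_le.
  have := dist _ _ _ (uP m).1 (uP n).1 (lt m km) (lt n kn) => h.
  rewrite -(@ltr_pXn2r _ 2)// ?nnegrE ?hn_ge0 ?(ltW e0)//.
  by apply: lt_trans h _; rewrite -ltr_pdivlMl// mulrC.
have zN e : 0 < e -> exists2 n, N n & hn (z - n) < e.
  move=> e0; have [k kP] := zu e e0; exists (u k); first exact: (uP k).1.
  by rewrite hn_distC kP.
exists z; split => // n Nn.
have yz : hn (y - z) ^+ 2 <= d.
  rewrite -[leRHS]sqr_sqrtr; last first.
    by apply: lb_le_inf => // _ [? _ <-]; exact: sqr_ge0.
  rewrite ler_pXn2r ?nnegrE ?hn_ge0 ?sqrtr_ge0//.
  apply/ler_addgt0Pl => e e0.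
  have [|k1 k1P] := zu (e / 2); first by rewrite divr_gt0.
  have [|k2 k2P] := e_small ((e / 2) ^+ 2); first by rewrite exprn_gt0 ?divr_gt0.
  pose k := maxn k1 k2.
  apply: le_trans (hn_dist_triangle (u k) _ _) _.
  have h1 : hn (u k - z) <= e / 2 by apply/ltW/k1P; rewrite leq_maxl.
  have h2 : hn (y - u k) <= Num.sqrt d + e / 2.
    have d0 : 0 <= d.
      by apply: lb_le_inf => // _ [? _ <-]; exact: sqr_ge0.
    rewrite -(@ler_pXn2r _ 2)// ?nnegrE ?hn_ge0 ?addr_ge0 ?sqrtr_ge0//; last lra.
    apply: le_trans (ltW (uP k).2) _; rewrite sqrrD sqr_sqrtr//.
    have : e_ k <= (e / 2) ^+ 2.
      by apply/ltW; apply: le_lt_trans (e_le k2 k _) k2P; rewrite leq_maxr.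
    have : 0 <= Num.sqrt d * (e / 2) by rewrite mulr_ge0 ?sqrtr_ge0//; lra.
    rewrite -mulr_natr; lra.
  rewrite (splitr e); lra.
(* [N] is not assumed closed, so [z] lies only in its closure: [z + m] is approximated by [v + m]
   with [v] in [N] near [z]. *)
have lez m : N m -> hn (y - z) ^+ 2 <= hn (y - z - m) ^+ 2.
  move=> Nm; apply: le_trans yz _.
  rewrite -[leLHS]sqr_sqrtr; last first.
    by apply: lb_le_inf => // _ [? _ <-]; exact: sqr_ge0.
  rewrite ler_pXn2r ?nnegrE ?hn_ge0 ?sqrtr_ge0//.
  apply/ler_addgt0Pl => e e0; have [v Nv zv] := zN e e0.
  have h : Num.sqrt d <= hn (y - (v + m)).
    rewrite -[leRHS]ger0_norm ?hn_ge0// -sqrtr_sqr ler_wsqrtr//.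
    by apply: dle; exact: submodD.
  apply: le_trans h _.
  have := hnD (z - v) (y - z - m).
  rewrite opprD (addrA y).
  have -> : z - v + (y - z - m) = y - v - m.
    by rewrite [y - z - m]addrAC [LHS]addrC addrA subrK addrAC.
  move=> h'; apply: le_trans h' _; lra.
have [n0|n0] := eqVneq n 0; first by rewrite n0 ip0r.
have nn : 0 < ip n n by rewrite -hn2 exprn_gt0// hn_gt0//; exact/eqP.
(* The minimizer over [a] of the quadratic polynomial [|y - z - a n|^2]. Its minimum lies
   [ip (y - z) n ^ 2 / ip n n] below the value at 0, so minimality of [z] makes this quantity
   vanish. *)
pose a := ip (y - z) n / ip n n.
have := lez (a *: n) (submodZ _ sN Nn).
rewrite !hn2 (ip_hnB (y - z)) ipZl !ipZr /a => h.
have {}h : ip (y - z) n ^+ 2 / ip n n <= 0.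
  have e1 : ip (y - z) n / ip n n * (ip (y - z) n / ip n n * ip n n) = ip (y - z) n ^+ 2 / ip n n.
    by rewrite divfK ?gt_eqF// expr2; ring.
  rewrite e1 in h; have e2 : ip (y - z) n / ip n n * ip (y - z) n = ip (y - z) n ^+ 2 / ip n n.
    by rewrite expr2; ring.
  rewrite e2 in h; lra.
apply/eqP; rewrite -sqrf_eq0 eq_le sqr_ge0 andbT.
by rewrite -(pmulr_lle0 _ (_ : 0 < (ip n n)^-1)) ?invr_gt0// mulrC.
Qed.

End InnerProduct.

(** * Hilbert-Schmidt operators *)

Section Operators.
Context {R : realType} {H : hilbert R}.
Implicit Types (x y z : H) (a c C : R) (T S W : H -> H) (N : set H).
Implicit Types (s : seq H).

Definition lin T := forall a x y, T (a *: x + y) = a *: T x + T y.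
Definition bnd C T := forall x, hn (T x) <= C * hn x.
Definition adj T S := forall x y, ip (T x) y = ip x (S y).

Lemma lin0 T : lin T -> T 0 = 0.
Proof.
by move=> lT; have := lT (- 1) 0 0; rewrite scaleN1r oppr0 addr0 scaleN1r addNr.
Qed.

Lemma linD T x y : lin T -> T (x + y) = T x + T y.
Proof. by move=> lT; have := lT 1 x y; rewrite !scale1r. Qed.

Lemma linZ T a x : lin T -> T (a *: x) = a *: T x.
Proof. by move=> lT; have := lT a x 0; rewrite (lin0 lT) !addr0. Qed.

Lemma linN T x : lin T -> T (- x) = - T x.
Proof. by move=> lT; rewrite -scaleN1r linZ// scaleN1r. Qed.

Lemma linB T x y : lin T -> T (x - y) = T x - T y.
Proof. by move=> lT; rewrite linD// linN. Qed.

Lemma lin_sum T I (r : seq I) (F : I -> H) : lin T ->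
  T (\sum_(i <- r) F i) = \sum_(i <- r) T (F i).
Proof.
move=> lT; elim: r => [|i r IH]; first by rewrite !big_nil lin0.
by rewrite !big_cons linD// IH.
Qed.

Lemma lin_comp T S : lin T -> lin S -> lin (T \o S).
Proof. by move=> lT lS a x y /=; rewrite lS lT. Qed.

Lemma adj_lin T S : adj T S -> lin T.
Proof.
move=> TS a x y; apply/eqP; rewrite -subr_eq0; apply/eqP/ip_eq0.
set z := _ - _; rewrite {1}/z ipBl ipDl ipZl !TS ipDl ipZl; ring.
Qed.

Lemma adjC T S : adj T S -> adj S T.
Proof. by move=> TS x y; rewrite ipC -TS ipC. Qed.

Lemma adj_comp T S T' S' : adj T S -> adj T' S' -> adj (T \o T') (S' \o S).
Proof. by move=> TS TS' x y /=; rewrite TS TS'. Qed.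

Lemma adj_sub T S T' S' : adj T S -> adj T' S' ->
  adj (fun x => T x - T' x) (fun x => S x - S' x).
Proof. by move=> TS TS' x y /=; rewrite ipBl ipBr TS TS'. Qed.

Lemma bnd_comp C C' T S : 0 <= C -> bnd C T -> bnd C' S -> bnd (C * C') (T \o S).
Proof.
move=> C0 bT bS x /=; apply: le_trans (bT _) _.
by rewrite -mulrA ler_wpM2l.
Qed.

Lemma bnd_ip C T x : bnd C T -> ip (T x) (T x) <= C ^+ 2 * ip x x.
Proof.
move=> bT; have := bT x; have h0 := hn_ge0 (T x).
move=> h; rewrite -!hn2 -exprMn ler_pXn2r// ?nnegrE//.
exact: le_trans h.
Qed.

Definition onf s :=
  uniq s /\ {in s &, forall x y, ip x y = (x == y)%:R}.

Lemma onf_nil : onf [::].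
Proof. by []. Qed.

Lemma onf_cons e s : ip e e = 1 -> (forall x, x \in s -> ip e x = 0) -> onf s ->
  onf (e :: s).
Proof.
move=> e1 es [us os].
have eNs : e \notin s.
  by apply/negP => /es; rewrite e1 => /eqP; rewrite oner_eq0.
split => [|x y]; first by rewrite /= eNs.
rewrite !inE => /predU1P[->|xs] /predU1P[->|ys]; last exact: os.
- by rewrite eqxx e1.
- rewrite es//; case: eqP => // ey; by rewrite ey ys in eNs.
- rewrite ipC es//; case: eqP => // ey; by rewrite -ey xs in eNs.
Qed.

Lemma onf_expand s (f : H -> R) y : onf s -> y \in s ->
  ip (\sum_(e <- s) f e *: e) y = f y.
Proof.
move=> [us os] ys; rewrite ip_suml (bigD1_seq y)//= ipZl os// eqxx mulr1.
rewrite big_seq_cond big1 ?addr0// => e /andP[es ey].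
by rewrite ipZl os// (negbTE ey) mulr0.
Qed.

Lemma onf_proj_orth s x y : onf s -> y \in s ->
  ip (x - \sum_(e <- s) ip x e *: e) y = 0.
Proof. by move=> os ys; rewrite ipBl (onf_expand (ip x))// subrr. Qed.

Lemma onf_proj_sqr s x : onf s ->
  ip x x - \sum_(e <- s) ip x e ^+ 2 =
  ip (x - \sum_(e <- s) ip x e *: e) (x - \sum_(e <- s) ip x e *: e).
Proof.
move=> os; rewrite [RHS]ipBr ip_sumr.
rewrite [X in _ = _ - X]big_seq [X in _ = _ - X]big1 ?subr0; last first.
  by move=> e es; rewrite ipZr onf_proj_orth// mulr0.
by rewrite ipBl ip_suml; under [in RHS]eq_bigr do rewrite ipZl (ipC _ x).
Qed.

Lemma bessel s x : onf s -> \sum_(e <- s) ip x e ^+ 2 <= ip x x.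
Proof. by move=> os; rewrite -subr_ge0 onf_proj_sqr// ip_ge0. Qed.

Lemma parseval s x : onf s -> x = \sum_(e <- s) ip x e *: e ->
  ip x x = \sum_(e <- s) ip x e ^+ 2.
Proof.
move=> os xs; apply/eqP; rewrite -subr_eq0 onf_proj_sqr//.
by rewrite -xs subrr ip0l.
Qed.

Lemma onf_best s x (f : H -> R) : onf s ->
  hn (x - \sum_(e <- s) ip x e *: e) <= hn (x - \sum_(e <- s) f e *: e).
Proof.
move=> os; set p := \sum_(e <- s) ip x e *: e; set q := \sum_(e <- s) f e *: e.
have o : ip (x - p) (p - q) = 0.
  rewrite /p /q ipBr !ip_sumr.
  rewrite big_seq big1 ?sub0r; last first.
    by move=> e es; rewrite ipZr onf_proj_orth// mulr0.
  rewrite big_seq big1 ?oppr0// => e es.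
  by rewrite ipZr onf_proj_orth// mulr0.
have -> : x - q = (x - p) + (p - q) by rewrite addrA subrK.
by apply: ler_wsqrtr; rewrite (ip_hnD (x - p)) o mulr0 addr0 lerDl ip_ge0.
Qed.

Lemma gram_schmidt N (r : seq H) : submod N -> (forall x, x \in r -> N x) ->
  exists s, [/\ onf s, (size s <= size r)%N, forall e, e \in s -> N e &
    forall x, x \in r -> x = \sum_(e <- s) ip x e *: e].
Proof.
move=> sN; elim: r => [|x r IH] Nr; first by exists [::].
have [y yr|s [os ss Ns rs]] := IH; first by apply: Nr; rewrite inE yr orbT.
pose y := x - \sum_(e <- s) ip x e *: e.
have [y0|y0] := eqVneq y 0.
  exists s; split => //; first exact: leq_trans ss _.
  move=> z; rewrite inE => /predU1P[->|/rs//].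
  by apply/eqP; rewrite -subr_eq0; exact/eqP.
have ny : 0 < hn y by apply: hn_gt0; exact/eqP.
pose e := (hn y)^-1 *: y.
have ey z : ip z e = (hn y)^-1 * ip z y by rewrite ipZr.
have oe z : z \in s -> ip e z = 0.
  by move=> zs; rewrite ipZl onf_proj_orth// mulr0.
have Ny : N y.
  apply: submodB => //; first by apply: Nr; rewrite inE eqxx.
  rewrite big_seq; elim/big_ind : _ => [|a b|z /Ns]; first by case: sN.
    exact: submodD.
  exact: submodZ.
have o' : onf (e :: s).
  apply: onf_cons => //.
  by rewrite ipZl ey -hn2 expr2 mulKf ?gt_eqF// mulVf ?gt_eqF.
exists (e :: s); split => //.
  move=> z; rewrite inE => /predU1P[->|/Ns//]; exact: submodZ.
move=> z; rewrite inE big_cons => /predU1P[->|zr]; last first.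
  rewrite [in X in X *: _](rs z zr) ip_suml big_seq big1 ?scale0r ?add0r.
    exact: rs.
  by move=> w ws; rewrite ipZl (ipC _ e) oe// mulr0.
have -> : ip x e *: e = y.
  have {1}-> : x = y + \sum_(e0 <- s) ip x e0 *: e0 by rewrite subrK.
  rewrite ipDl [X in _ + X]ip_suml [X in _ + X]big_seq big1 ?addr0; last first.
    by move=> w ws; rewrite ipZl (ipC _ e) oe// mulr0.
  by rewrite ey -hn2 expr2 mulKf ?gt_eqF// scalerA mulfV ?gt_eqF// scale1r.
by rewrite subrK.
Qed.

(* Test [W] on [x = \sum_e ip (W e) y *: e] and compare [ip (W x) y] with
   [ip x x]: both are the sum on the left. *)
Lemma bessel_bnd C W s y : lin W -> bnd C W -> onf s ->
  \sum_(e <- s) ip (W e) y ^+ 2 <= C ^+ 2 * ip y y.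
Proof.
move=> lW bW os; set q := \sum_(e <- s) _.
pose x := \sum_(e <- s) ip (W e) y *: e.
have xx : ip x x = q.
  rewrite {1}/x ip_suml /q big_seq [RHS]big_seq; apply: eq_bigr => e es.
  rewrite ipZl [ip e _]ipC expr2; congr (_ * _).
  exact: (onf_expand (fun e => ip (W e) y) os es).
have Wx : ip (W x) y = q.
  by rewrite /x lin_sum// ip_suml; apply: eq_bigr => e es; rewrite linZ// ipZl.
have q0 : 0 <= q by rewrite -xx ip_ge0.
have h : q ^+ 2 <= C ^+ 2 * q * ip y y.
  rewrite -{1}Wx; apply: le_trans (ip_sqr_le _ _) _.
  by rewrite ler_wpM2r ?ip_ge0// -xx bnd_ip.
have [->|q'] := eqVneq q 0; first by rewrite mulr_ge0 ?sqr_ge0 ?ip_ge0.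
have qp : 0 < q by rewrite lt_neqAle eq_sym q'.
by rewrite -(ler_pM2l qp) -expr2 (le_trans h)// mulrA (mulrC q).
Qed.

(* [HSon N T c]: the squared Hilbert-Schmidt norm of the restriction of [T] to
   the subspace [N] is at most [c]. *)
Definition HSon N T c := forall s, onf s -> (forall e, e \in s -> N e) ->
  \sum_(e <- s) ip (T e) (T e) <= c.
Definition HS T c := HSon setT T c.

Lemma HSon_le N T c c' : c <= c' -> HSon N T c -> HSon N T c'.
Proof. by move=> cc' Tc s os Ns; apply: le_trans cc'; exact: Tc. Qed.

Lemma HSon_ge0 N T c : HSon N T c -> 0 <= c.
Proof. by move=> /(_ [::] onf_nil); rewrite big_nil; apply. Qed.

Lemma HSonD N T S c d : HSon N T c -> HSon N S d ->
  HSon N (fun x => T x + S x) (2 * c + 2 * d).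
Proof.
move=> Tc Sd s os Ns.
apply: (@le_trans _ _ (\sum_(e <- s) (2 * ip (T e) (T e) + 2 * ip (S e) (S e)))).
  by apply: ler_sum => e _; exact: ip_hnD_le.
rewrite big_split /= -!mulr_sumr.
by apply: lerD; rewrite ler_pM2l//; [exact: Tc|exact: Sd].
Qed.

Lemma HSon_dom N T S c C : 0 <= C -> HSon N T c ->
  (forall x, N x -> hn (S x) <= C * hn (T x)) -> HSon N S (C ^+ 2 * c).
Proof.
move=> C0 Tc ST s os Ns.
apply: (@le_trans _ _ (\sum_(e <- s) C ^+ 2 * ip (T e) (T e))).
  rewrite big_seq [leRHS]big_seq; apply: ler_sum => e /Ns/ST.
  by rewrite -!hn2 -exprMn ler_pXn2r// nnegrE ?mulr_ge0 ?hn_ge0.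
by rewrite -mulr_sumr ler_wpM2l ?sqr_ge0//; exact: Tc.
Qed.

Lemma eq_HSon N T S c : (forall x, T x = S x) -> HSon N T c -> HSon N S c.
Proof. by move=> TS Tc s os Ns; under eq_bigr do rewrite -TS; exact: Tc. Qed.

(** Gram-Schmidt gives an orthonormal family [b] of [N] in which every [T (W e)] expands. After
    exchanging the two sums, the sum over [e] for a fixed [f] in [b] is at most [C ^ 2 * |S f| ^ 2]
    by [bessel_bnd]. Since [b] stays in [N], the adjointness of [T] and [S] is needed only there. *)
Lemma HS_comp_on N T S W c C : submod N -> lin W -> bnd C W ->
  (forall x, N (T (W x))) -> (forall x y, N y -> ip (T x) y = ip x (S y)) ->
  HSon N S c -> HS (T \o W) (C ^+ 2 * c).
Proof.
move=> sN lW bW NTW TS Sc s os _.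
have [|b [ob _ Nb bP]] := @gram_schmidt N [seq T (W e) | e <- s] sN.
  by move=> _ /mapP[e _ ->].
rewrite big_seq; under eq_bigr => e es.
  rewrite /= (parseval ob (bP _ (map_f (fun e => T (W e)) es))); over.
rewrite -big_seq exchange_big /=.
apply: (@le_trans _ _ (\sum_(f <- b) C ^+ 2 * ip (S f) (S f))).
  rewrite big_seq [leRHS]big_seq; apply: ler_sum => f fb.
  under eq_bigr do rewrite (TS _ _ (Nb _ fb)).
  exact: bessel_bnd.
by rewrite -mulr_sumr ler_wpM2l ?sqr_ge0//; exact: Sc.
Qed.

Lemma HS_comp T S W c C : lin W -> bnd C W -> adj T S -> HS S c ->
  HS (T \o W) (C ^+ 2 * c).
Proof. by move=> lW bW TS; apply: HS_comp_on. Qed.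

Lemma lin_id : lin id.
Proof. by []. Qed.

Lemma bnd_id : bnd 1 id.
Proof. by move=> x; rewrite mul1r. Qed.

Lemma HS_adj_on N T S c : submod N -> (forall x, N (T x)) ->
  (forall x y, N y -> ip (T x) y = ip x (S y)) -> HSon N S c -> HS T c.
Proof.
move=> sN NT TS Sc; have := HS_comp_on sN lin_id bnd_id NT TS Sc.
by rewrite expr1n mul1r.
Qed.

Lemma HS_adj T S c : adj T S -> HS S c -> HS T c.
Proof. by move=> TS; apply: HS_adj_on. Qed.

(** An orthonormal family spanning the range has at most [k] elements, and by [bessel_bnd] each of
    them contributes at most [C ^ 2]. *)
Lemma HS_finite_rank W C k (w : nat -> H) : lin W -> bnd C W ->
  (forall x, exists f : nat -> R, W x = \sum_(i < k) f i *: w i) ->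
  HS W (k%:R * C ^+ 2).
Proof.
move=> lW bW Wr s os _.
have [//|b [ob sb _ bP]] := @gram_schmidt setT [seq w i | i <- iota 0 k] submodT.
rewrite size_map size_iota in sb.
have Wb x : W x = \sum_(e <- b) ip (W x) e *: e.
  have [f ->] := Wr x.
  rewrite [LHS](eq_bigr (fun i : 'I_k => \sum_(e <- b) (f i * ip (w i) e) *: e)).
    rewrite exchange_big /=; apply: eq_bigr => e _.
    rewrite -scaler_suml ip_suml; congr (_ *: _).
    by apply: eq_bigr => i _; rewrite ipZl.
  move=> i _; have wi : w i \in [seq w i | i <- iota 0 k].
    by rewrite map_f// mem_iota /=.
  rewrite [X in _ *: X](bP _ wi) scaler_sumr.
  by apply: eq_bigr => e _; rewrite scalerA.
under eq_bigr do rewrite (parseval ob (Wb _)).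
rewrite exchange_big /=.
apply: (@le_trans _ _ (\sum_(f <- b) C ^+ 2)).
  rewrite big_seq [leRHS]big_seq; apply: ler_sum => f fb.
  apply: le_trans (bessel_bnd f lW bW os) _.
  by case: ob => _ /(_ _ _ fb fb) ->; rewrite eqxx mulr1.
rewrite big_const_seq count_predT iter_addr_0 -[leLHS]mulr_natl.
by rewrite ler_wpM2r ?sqr_ge0// ler_nat.
Qed.

(* An orthonormal family that almost realizes the Hilbert-Schmidt norm leaves
   little to its orthogonal complement. *)
Lemma HS_tail T c (e : R) : HS T c -> 0 < e ->
  exists2 s, onf s & HSon [set x | forall y, y \in s -> ip x y = 0] T e.
Proof.
move=> Tc e0; pose D := [set \sum_(e <- s) ip (T e) (T e) | s in onf].
have Dsup : has_sup D.
  split; first by exists (\sum_(e <- [::]) ip (T e) (T e)), [::] => //; exact: onf_nil.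
  by exists c => _ [s os <-]; exact: Tc.
have [_ [s os <-] sD] := sup_adherent e0 Dsup.
exists s => // r [ur or] ro.
have : onf (r ++ s).
  have disj x y : x \in r -> y \in s -> ip x y = 0 by move=> /ro; apply.
  case: os => us os; split.
    rewrite cat_uniq ur us andbT; apply/hasPn => y ys; apply/negP => yr.
    have := disj _ _ yr ys; rewrite os// eqxx => /eqP; by rewrite oner_eq0.
  have neq x y : x \in r -> y \in s -> (x == y) = false.
    move=> xr ys; apply/eqP => xy; have := disj _ _ xr ys.
    by rewrite -xy or// eqxx => /eqP; rewrite oner_eq0.
  move=> x y; rewrite !mem_cat => /orP[xr|xs] /orP[yr|ys].
  - exact: or.
  - by rewrite disj// neq.
  - by rewrite ipC disj// eq_sym neq.
  - exact: os.
move=> ors.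
have : \sum_(e <- r ++ s) ip (T e) (T e) <= sup D.
  by apply: ub_le_sup; [case: Dsup|exists (r ++ s)].
rewrite big_cat /=; lra.
Qed.

Lemma HSon_bnd N T c x : submod N -> lin T -> HSon N T c -> N x ->
  ip (T x) (T x) <= c * ip x x.
Proof.
move=> sN lT Tc Nx; have [->|x0] := eqVneq x 0.
  by rewrite lin0// !ip0l mulr0.
have nx : 0 < hn x by apply: hn_gt0; exact/eqP.
have := Tc [:: (hn x)^-1 *: x]; rewrite big_seq1 linZ// ipZl ipZr => h.
have /h{}h : onf [:: (hn x)^-1 *: x].
  apply: onf_cons => //.
  by rewrite ipZl ipZr -hn2 expr2 mulKf ?gt_eqF// mulVf ?gt_eqF.
rewrite -ler_pdivrMr; last by rewrite -hn2 exprn_gt0.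
rewrite -(hn2 x) expr2 invfM mulrC -mulrA; apply: h => e.
by rewrite inE => /eqP ->; exact: submodZ.
Qed.

Lemma submod_orth s : submod [set x : H | forall y, y \in s -> ip x y = 0].
Proof.
split => [y _|a x y xs ys z zs]; first exact: ip0l.
by rewrite ipDl ipZl xs// ys// mulr0 addr0.
Qed.

(** A finite orthonormal family [s] carries almost all of the Hilbert-Schmidt norm of [T]. On its
    span strong convergence is enough; on the complement [M n o T] is small uniformly in [n],
    because the [M n] are uniformly bounded. *)
Lemma HS_cvg0 T S (M : nat -> H -> H) c D : 0 <= D -> adj T S -> HS T c ->
  (forall n, lin (M n)) -> (forall n, bnd D (M n)) ->
  (forall x (e : R), 0 < e -> exists n0, forall n, (n0 <= n)%N ->
    hn (M n (T x)) < e) ->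
  forall e : R, 0 < e -> exists n0, forall n, (n0 <= n)%N -> HS (M n \o T) e.
Proof.
move=> D0 TS Tc lM bM M0 e e0.
have lT := adj_lin TS.
have D1 : 0 < 4 * (D ^+ 2 + 1) by rewrite mulr_gt0// ltr_wpDl// sqr_ge0.
have [|s os sT] := HS_tail Tc (_ : 0 < e / (4 * (D ^+ 2 + 1))).
  by rewrite divr_gt0.
set N := [set x | _] in sT.
pose p x := \sum_(f <- s) ip x f *: f.
have Np x : N (x - p x) by move=> y ys; exact: onf_proj_orth.
have psym : adj p p.
  move=> x y; rewrite /p ip_suml ip_sumr; apply: eq_bigr => f _.
  by rewrite ipZl ipZr (ipC f) mulrC.
(* [sT] speaks only of families inside [N]. The adjoint [(1 - p) S] takes its values in [N], so
   passing to it and back reaches all orthonormal families. *)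
have tail : HS (fun x => T (x - p x)) (e / (4 * (D ^+ 2 + 1))).
  apply: (@HS_adj _ (fun x => S x - p (S x))).
    by move=> x y; rewrite TS ipBl ipBr psym.
  apply: (@HS_adj_on N _ T) => //; first exact: submod_orth.
  move=> x y Ny; rewrite ipBl psym.
  rewrite [p y]big_seq big1; last by move=> f fs; rewrite Ny// scale0r.
  by rewrite ip0r subr0 (adjC TS).
pose m := (size s)%:R : R.
(* The estimate of [head] loses a factor [m] by Cauchy-Schwarz and another one by the number of
   terms, hence the square; the [+ 1] covers the empty family. *)
have [n0 n0P] : exists n0, forall n, (n0 <= n)%N -> forall f, f \in s ->
    hn (M n (T f)) ^+ 2 <= e / (4 * (m + 1) ^+ 2).
  have d0 : 0 < e / (4 * (m + 1) ^+ 2).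
    by rewrite divr_gt0// mulr_gt0// exprn_gt0// ltr_wpDl.
  have main (r : seq H) : exists n0, forall n, (n0 <= n)%N -> forall f, f \in r ->
      hn (M n (T f)) ^+ 2 <= e / (4 * (m + 1) ^+ 2).
    elim: r => [|f r [n1 IH]]; first by exists 0%N.
    have [|n2 n2P] := M0 f (Num.sqrt (e / (4 * (m + 1) ^+ 2))).
      by rewrite sqrtr_gt0.
    exists (maxn n1 n2) => n; rewrite geq_max => /andP[n1n n2n] g.
    rewrite inE => /predU1P[->|]; last exact: IH.
    rewrite -[leRHS]sqr_sqrtr ?(ltW d0)// ler_pXn2r ?nnegrE ?hn_ge0 ?sqrtr_ge0//.
    exact/ltW/n2P.
  exact: main.
exists n0 => n n0n.
have head : HS (fun x => M n (T (p x))) (e / 4).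
  move=> r or _.
  apply: (@le_trans _ _ (\sum_(g <- r) m * \sum_(f <- s)
      ip g f ^+ 2 * hn (M n (T f)) ^+ 2)).
    apply: ler_sum => g _; rewrite -hn2 /p lin_sum// lin_sum//.
    under eq_bigr do rewrite linZ// linZ//.
    apply: (@le_trans _ _ ((\sum_(f <- s) `|ip g f| * hn (M n (T f))) ^+ 2)).
      rewrite ler_pXn2r ?nnegrE ?hn_ge0//.
        apply: le_trans (hn_sum _ _ _) _.
        by apply: ler_sum => f _; rewrite hnZ.
      by apply: sumr_ge0 => f _; rewrite mulr_ge0 ?hn_ge0.
    rewrite /m; under [in leRHS]eq_bigr do
      rewrite -[ip g _ ^+ 2]real_normK ?num_real// -exprMn.
    (* Cauchy-Schwarz: the square of a sum of [size s] numbers is at most [size s] times the sum of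
       their squares. *)
    elim: (s) => [|f t IH]; first by rewrite !big_nil expr0n mulr0.
    rewrite !big_cons /= -natr1; move: IH.
    set u := \sum_(_ <- _) _; set v := \sum_(_ <- _) _ ^+ 2.
    set a := `|_| * _ => IH.
    rewrite sqrrD mulrDr -mulr_natr.
    have : a * u * 2 <= (size t)%:R * a ^+ 2 + v.
      case: (posnP (size t)) => [t0|tp].
        move: t0 => /eqP; rewrite size_eq0 => /eqP t0.
        by rewrite /u /v t0 !big_nil /= mulr0 !mul0r addr0.
      have k0 : 0 < (size t)%:R :> R by rewrite ltr0n.
      rewrite -(ler_pM2l k0).
      move: IH k0; set k := (size t)%:R => IH k0.
      have := sqr_ge0 (k * a - u).
      have -> : (k * a - u) ^+ 2 = k * (k * a ^+ 2) - k * (a * u * 2) + u ^+ 2.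
        by ring.
      rewrite mulrDr; lra.
    nra.
  rewrite -mulr_sumr exchange_big /=.
  apply: (@le_trans _ _ (m * \sum_(f <- s) e / (4 * (m + 1) ^+ 2))).
    rewrite ler_wpM2l//; rewrite big_seq [leRHS]big_seq; apply: ler_sum => f fs.
    rewrite -mulr_suml -[leRHS]mul1r; apply: ler_pM => //.
    - by apply: sumr_ge0 => ? _; exact: sqr_ge0.
    - exact: sqr_ge0.
    - under eq_bigr do rewrite ipC; apply: le_trans (bessel f or) _.
      by case: os => _ /(_ f f fs fs) ->; rewrite eqxx.
    - exact: n0P.
  rewrite big_const_seq count_predT iter_addr_0 -(mulr_natl (e / _)) -/m.
  have m0 : 0 <= m by [].
  have -> : m * (m * (e / (4 * (m + 1) ^+ 2))) = (m / (m + 1)) ^+ 2 * (e / 4).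
    by field; rewrite gt_eqF// ltr_wpDl.
  rewrite ler_piMl//; first lra.
  rewrite expr_le1// ?divr_ge0 ?addr_ge0// ler_pdivrMr ?ltr_wpDl//; lra.
apply: (@eq_HSon _ (fun x => M n (T (p x)) + M n (T (x - p x)))).
  by move=> x /=; rewrite -linD// -linD// addrC subrK.
apply: HSon_le (HSonD head (HSon_dom D0 tail _)) => //; last first.
  by move=> x _; exact: bM.
have -> : D ^+ 2 * (e / (4 * (D ^+ 2 + 1))) = D ^+ 2 / (D ^+ 2 + 1) * (e / 4).
  by field; rewrite gt_eqF// ltr_wpDl// sqr_ge0.
suff : D ^+ 2 / (D ^+ 2 + 1) * (e / 4) <= e / 4 by lra.
rewrite ler_piMl//; first lra.
by rewrite ler_pdivrMr ?ltr_wpDl ?sqr_ge0// mul1r lerDl.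
Qed.

End Operators.

(** * Limits, closed subspaces and operators bounded below *)

Section Convergence.
Context {R : realType} {H : hilbert R}.
Implicit Types (x y z l : H) (a c C : R) (T S W : H -> H) (N : set H).
Implicit Types (u v : nat -> H).

Definition conv u l := forall e : R, 0 < e ->
  exists n0, forall n, (n0 <= n)%N -> hn (u n - l) < e.

Lemma conv_dist_le u l y B : conv u l -> (forall n, hn (u n - y) <= B) ->
  hn (l - y) <= B.
Proof.
move=> ul uB; apply/ler_addgt0Pl => e /ul[n0 /(_ n0 (leqnn _)) h].
by apply: le_trans (hn_dist_triangle (u n0) _ _) _; rewrite hn_distC lerD// ltW.
Qed.

Lemma conv_unique u l m : conv u l -> conv u m -> l = m.
Proof.
move=> ul um; apply/eqP; rewrite -subr_eq0; apply/eqP.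
apply: (@ip_bound_eq0 _ _ _ 2) => e e0.
have [n1 h1] := ul e e0; have [n2 h2] := um e e0.
pose n := maxn n1 n2.
have {}h1 := h1 n (leq_maxl _ _); have {}h2 := h2 n (leq_maxr _ _).
apply: le_trans (hn_dist_triangle (u n) _ _) _.
rewrite (hn_distC l); lra.
Qed.

Lemma conv_ip u v l m x y : conv u l -> conv v m ->
  (forall n, ip (u n) y = ip x (v n)) -> ip l y = ip x m.
Proof.
move=> ul vm uv; apply/eqP; rewrite -subr_eq0 -normr_le0.
apply/ler_addgt0Pl => e e0; rewrite addr0.
pose B := hn x + hn y + 1.
have B0 : 0 < B by rewrite ltr_wpDl// addr_ge0// hn_ge0.
have [|n1 h1] := ul (e / B); first by rewrite divr_gt0.
have [|n2 h2] := vm (e / B); first by rewrite divr_gt0.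
pose n := maxn n1 n2.
have {}h1 := h1 n (leq_maxl _ _); have {}h2 := h2 n (leq_maxr _ _).
have -> : ip l y - ip x m = ip x (v n - m) - ip (u n - l) y.
  by rewrite ipBl ipBr uv; ring.
apply: le_trans (ler_normB _ _) _.
have := ip_le x (v n - m); have := ip_le (u n - l) y.
have : hn x * hn (v n - m) <= hn x * (e / B) by rewrite ler_wpM2l ?hn_ge0// ltW.
have : hn (u n - l) * hn y <= (e / B) * hn y by rewrite ler_wpM2r ?hn_ge0// ltW.
have : (hn x + hn y) * (e / B) <= e.
  rewrite mulrCA ler_piMr// ?(ltW e0)// ler_pdivrMr// mul1r /B; lra.
rewrite mulrDl; lra.
Qed.

Lemma conv_comp C T u l : lin T -> bnd C T -> conv u l ->
  conv (fun n => T (u n)) (T l).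
Proof.
move=> lT bT ul e e0.
have B0 : 0 < `|C| + 1 by rewrite ltr_wpDl.
have [|n0 h] := ul (e / (`|C| + 1)); first by rewrite divr_gt0.
exists n0 => n /h{}h; rewrite -linB//.
apply: le_lt_trans (bT _) _.
apply: (@le_lt_trans _ _ ((`|C| + 1) * hn (u n - l))).
  by rewrite ler_wpM2r ?hn_ge0// (le_trans (ler_norm C))// lerDl.
by rewrite mulrC -ltr_pdivlMr.
Qed.

Lemma convD u v l m : conv u l -> conv v m -> conv (fun n => u n + v n) (l + m).
Proof.
move=> ul vm e e0; have [|n1 h1] := ul (e / 2); first by rewrite divr_gt0.
have [|n2 h2] := vm (e / 2); first by rewrite divr_gt0.
exists (maxn n1 n2) => n; rewrite geq_max => /andP[/h1{}h1 /h2{}h2].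
rewrite opprD addrACA; apply: le_lt_trans (hnD _ _) _; lra.
Qed.

Lemma convZ a u l : conv u l -> conv (fun n => a *: u n) (a *: l).
Proof.
move=> ul; apply: (@conv_comp `|a| (fun x => a *: x)) ul.
  by move=> b x y; rewrite scalerDr !scalerA mulrC.
by move=> x; rewrite hnZ.
Qed.

Lemma conv_cst l : conv (fun=> l) l.
Proof. by move=> e e0; exists 0%N => n _; rewrite subrr hn0. Qed.

Lemma conv_shift u l : conv u l -> conv (fun n => u n.+1) l.
Proof.
by move=> ul e /ul[n0 h]; exists n0 => n n0n; apply: h; exact: leqW.
Qed.

Definition hclosed N := submod N /\
  forall x, (forall e : R, 0 < e -> exists2 y, N y & hn (x - y) < e) -> N x.

Definition bounded_below N T :=
  exists2 c, 0 < c & forall x, N x -> c * hn x <= hn (T x).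

Lemma image_submod N T : submod N -> lin T -> submod (T @` N).
Proof.
move=> sN lT; split; first by exists 0; [case: sN|rewrite lin0].
move=> a _ _ [x Nx <-] [y Ny <-]; exists (a *: x + y); last exact: lT.
by case: sN => _; apply.
Qed.

(** The projection [z] of [y] lies a priori in the closure of [T N]. If [T (u k)] tends to [z], the
    lower bound on [T] makes [u] a Cauchy sequence, and its limit is a preimage of [z] in [N]. *)
Lemma image_projection N T C y : hclosed N -> lin T -> bnd C T ->
  bounded_below N T ->
  exists2 x, N x & forall n, N n -> ip (y - T x) (T n) = 0.
Proof.
move=> [sN cN] lT bT [c c0 cT].
have [z [zN zo]] := projection y (image_submod sN lT).
pose e_ (k : nat) : R := k.+1%:R^-1.
have e_gt0 k : 0 < e_ k by rewrite invr_gt0.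
have e_le (k l : nat) : (k <= l)%N -> e_ l <= e_ k.
  by move=> kl; rewrite lef_pV2 ?posrE// ler_nat.
have e_small (e : R) : 0 < e -> exists k, e_ k < e.
  move=> e0; exists (Num.truncn e^-1).
  by rewrite -[ltRHS]invrK ltf_pV2 ?posrE ?invr_gt0// truncnS_gt.
have [u uP] : {u : nat -> H & forall k, N (u k) /\ hn (z - T (u k)) < e_ k}.
  apply: (@choice nat H (fun k n => N n /\ hn (z - T n) < e_ k)) => k.
  by have [_ [n Nn <-] ?] := zN _ (e_gt0 k); exists n.
have Tu : conv (fun k => T (u k)) z.
  move=> e /e_small[k ke]; exists k => n kn; rewrite hn_distC.
  by apply: lt_trans (uP n).2 _; apply: le_lt_trans (e_le _ _ kn) ke.
have [|x ux] := @hn_complete _ _ u.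
  move=> e e0; have [|k kP] := Tu (c * e / 2).
    by rewrite divr_gt0// mulr_gt0.
  exists k => m n /kP hm /kP hn'.
  rewrite -(ltr_pM2l c0); apply: le_lt_trans (cT _ _) _.
    by apply: submodB => //; exact: (uP _).1.
  rewrite linB//; apply: le_lt_trans (hn_dist_triangle z _ _) _.
  rewrite (hn_distC z); lra.
have Tx : T x = z by apply: conv_unique (conv_comp lT bT ux) Tu.
exists x; last by move=> n Nn; rewrite Tx; apply: zo; exists n.
apply: cN => e /ux[n0 /(_ n0 (leqnn _)) h]; exists (u n0); first exact: (uP _).1.
by rewrite hn_distC.
Qed.

(** Let [T n0] be the projection of [T x] onto [T N]. A vector of [N'] is [m + a (x - n0)] with [m]
    in [N], and the images of the two terms are orthogonal, so each of them is controlled by the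
    image of the sum. *)
Lemma bounded_below_extend N N' T C x : hclosed N -> submod N' -> N `<=` N' ->
  lin T -> bnd C T -> N' x ->
  (forall y, N' y -> exists n a, N n /\ y = n + a *: x) ->
  (forall y, N' y -> T y = 0 -> y = 0) ->
  bounded_below N T -> bounded_below N' T.
Proof.
move=> cN sN' NN' lT bT N'x N'P inj bN.
have [n0 Nn0 n0P] := image_projection (T x) cN lT bT bN.
have [c c0 cT] := bN; case: cN => sN _.
have [u0|u0] := eqVneq (T x - T n0) 0.
  exists c => // y /N'P[n [a [Nn ->]]]; apply: cT.
  have : x - n0 = 0.
    by apply: inj; [apply: submodB => //; exact: NN'|rewrite linB].
  move=> /eqP; rewrite subr_eq0 => /eqP ->.
  by apply: submodD => //; exact: submodZ.
have d0 : 0 < hn (T x - T n0) by apply: hn_gt0; exact/eqP.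
set d := hn (T x - T n0) in d0.
(* [c^-1] is the cost of recovering [m] from [T m]. The other term is the cost of recovering
   [a (x - n0)] from [a (T x - T n0)], where [d] is the distance from [T x] to [T N]. *)
pose B := c^-1 + hn (x - n0) / d.
have B0 : 0 < B by rewrite ltr_pwDl ?invr_gt0// divr_ge0 ?hn_ge0 ?(ltW d0).
exists B^-1; first by rewrite invr_gt0.
move=> y /N'P[n [a [Nn ->]]].
rewrite mulrC ler_pdivrMr//.
pose m := n + a *: n0.
have Nm : N m by apply: submodD => //; exact: submodZ.
have -> : n + a *: x = m + a *: (x - n0).
  by rewrite /m scalerBr -addrA [a *: n0 + _]addrC subrK.
rewrite (linD _ _ lT) (linZ _ _ lT) (linB _ _ lT).
have sq : ip (T m + a *: (T x - T n0)) (T m + a *: (T x - T n0)) =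
    hn (T m) ^+ 2 + (`|a| * d) ^+ 2.
  by rewrite ip_hnD ipZr (ipC (T m)) n0P// !mulr0 addr0 -!hn2 hnZ.
have h1 : hn (T m) <= hn (T m + a *: (T x - T n0)).
  rewrite -(@ler_pXn2r _ 2)// ?nnegrE ?hn_ge0// (hn2 (_ + _)) sq lerDl.
  exact: sqr_ge0.
have h2 : `|a| * d <= hn (T m + a *: (T x - T n0)).
  rewrite -(@ler_pXn2r _ 2)// ?nnegrE ?mulr_ge0 ?hn_ge0// (hn2 (_ + _)) sq lerDr.
  exact: sqr_ge0.
apply: le_trans (hnD _ _) _; rewrite /B mulrDr lerD//.
  by rewrite ler_pdivlMr// mulrC; apply: le_trans h1; exact: cT.
rewrite hnZ mulrC mulrA ler_pdivlMr// mulrAC -mulrA mulrC ler_wpM2r ?hn_ge0//.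
by rewrite mulrC.
Qed.

Lemma hclosed_orth N f : hclosed N -> hclosed (N `&` [set x | ip x f = 0]).
Proof.
move=> [sN cN]; split.
  split; first by split; [case: sN|exact: ip0l].
  move=> a x y [Nx xf] [Ny yf]; split; first by case: sN => _; apply.
  by rewrite /= ipDl ipZl xf yf mulr0 addr0.
move=> x xP; split; first by apply: cN => e /xP[y [Ny _] ?]; exists y.
apply/eqP; rewrite -normr_le0; apply/ler_addgt0Pl => e e0; rewrite addr0.
have [|y [_ yf] xy] := xP (e / (hn f + 1)).
  by rewrite divr_gt0// ltr_wpDl// hn_ge0.
rewrite -[ip x f]subr0 -yf -ipBl; apply: le_trans (ip_le _ _) _.
apply: (@le_trans _ _ (e / (hn f + 1) * hn f)).
  by rewrite ler_wpM2r ?hn_ge0// ltW.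
have f1 : 0 < hn f + 1 by rewrite ltr_wpDl// hn_ge0.
by rewrite -mulrA ler_piMr ?(ltW e0)// mulrC ler_pdivrMr// mul1r lerDl.
Qed.

(** Each constraint [ip x f = 0] cuts out a subspace of codimension at most 1, so the constraints
    are removed one at a time by [bounded_below_extend]; injectivity of [T] excludes a degenerate
    extension. *)
Lemma bounded_below_orth N T C (s : seq H) : hclosed N -> lin T -> bnd C T ->
  (forall x, N x -> T x = 0 -> x = 0) ->
  bounded_below (N `&` [set x | forall y, y \in s -> ip x y = 0]) T ->
  bounded_below N T.
Proof.
elim: s N => [|f s IH] N cN lT bT inj bN.
  by have [c c0 cT] := bN; exists c => // x Nx; apply: cT.
have {}IH : bounded_below (N `&` [set x | ip x f = 0]) T.
  apply: (IH _ (hclosed_orth f cN)) => //; first by move=> x [Nx _]; exact: inj.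
  have [c c0 cT] := bN; exists c => // x [[Nx xf] xs]; apply: cT; split => //= y.
  by rewrite inE => /predU1P[->|/xs].
have [[x [Nx xf]]|no] := pselect (exists x, N x /\ ip x f <> 0); last first.
  have [c c0 cT] := IH; exists c => // x Nx; apply: cT; split => //=.
  by apply: contrapT => xf; apply: no; exists x.
have sN := cN.1.
apply: (bounded_below_extend (hclosed_orth f cN) sN _ lT bT Nx _ inj IH).
  by move=> y [].
move=> y Ny; exists (y - (ip y f / ip x f) *: x), (ip y f / ip x f).
split; last by rewrite subrK.
split; first by apply: submodB => //; exact: submodZ.
by rewrite /= ipBl ipZl divfK ?subrr//; exact/eqP.
Qed.

(* A Hilbert-Schmidt [M] is small on a subspace of finite codimension, where
   [T] is therefore bounded below. *)
Lemma bounded_below_HS N T M C c : hclosed N -> lin T -> bnd C T -> lin M ->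
  HS M c ->
  (forall x, N x -> ip x x = ip (M x) (M x) + ip (T x) (T x)) ->
  (forall x, N x -> T x = 0 -> x = 0) ->
  bounded_below N T.
Proof.
move=> cN lT bT lM Mc NMT inj.
have [|s os sM] := HS_tail Mc (_ : 0 < 2^-1); first by rewrite invr_gt0.
apply: (bounded_below_orth (s := s) cN lT bT inj).
exists 2^-1; first by rewrite invr_gt0.
move=> x [Nx xs].
have := HSon_bnd (submod_orth s) lM sM xs.
rewrite -(@ler_pXn2r _ 2)// ?nnegrE ?mulr_ge0 ?hn_ge0 ?invr_ge0//.
rewrite exprMn !hn2; have := NMT x Nx; have := ip_ge0 x; lra.
Qed.

(** Existence of projections implies closedness, and unlike closedness it passes at once to the sum
    with the span of one more vector. It serves to show that [h L + h V] is closed. *)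
Definition projable N := submod N /\
  forall y, exists2 z, N z & forall n, N n -> ip (y - z) n = 0.

Lemma projable_closed N : projable N -> hclosed N.
Proof.
move=> [sN pN]; split => // x xN; have [z Nz zP] := pN x.
suff -> : x = z by [].
apply/eqP; rewrite -subr_eq0; apply/eqP.
apply: (@ip_bound_eq0 _ _ _ 1) => e /xN[y Ny xy]; rewrite mul1r.
apply: le_trans (ltW xy); apply: ler_wsqrtr.
have -> : x - y = (x - z) + (z - y) by rewrite addrA subrK.
by rewrite (ip_hnD (x - z)) (zP (z - y)) ?mulr0 ?addr0 ?lerDl ?ip_ge0//; exact: submodB.
Qed.

Lemma projable_image N T C : hclosed N -> lin T -> bnd C T ->
  bounded_below N T -> projable (T @` N).
Proof.
move=> cN lT bT bN; split; first by apply: image_submod lT; case: cN.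
move=> y; have [x Nx xP] := image_projection y cN lT bT bN.
by exists (T x); [exists x|move=> _ [n Nn <-]; exact: xP].
Qed.

Lemma projable_extend N w : projable N ->
  projable [set x | exists n a, N n /\ x = n + a *: w].
Proof.
move=> [sN pN]; split.
  split; first by exists 0, 0; split; [case: sN|rewrite scale0r addr0].
  move=> a _ _ [n [b [Nn ->]]] [m [c [Nm ->]]]; exists (a *: n + m), (a * b + c).
  split; first by case: sN => _; apply.
  by rewrite scalerDr scalerDl addrACA scalerA.
have [z Nz zP] := pN w; set u := w - z in zP.
have [u0|u0] := eqVneq u 0.
  move=> y; have [t Nt tP] := pN y; exists t.
    by exists t, 0; rewrite scale0r addr0.
  move=> _ [n [a [Nn ->]]]; apply: tP; apply: submodD => //; apply: submodZ => //.
  suff -> : w = z by [].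
  by apply/eqP; rewrite -subr_eq0; exact/eqP.
move=> y; have [t Nt tP] := pN y; pose b := ip y u / ip u u.
have uu : ip u u != 0 by apply: contra_neq u0; exact: ip_eq0.
exists (t + b *: u).
  exists (t - b *: z), b; split; first by apply: submodB => //; exact: submodZ.
  by rewrite /u scalerBr addrCA addrC.
have to n : N n -> ip (y - (t + b *: u)) n = 0.
  by move=> Nn; rewrite opprD addrA ipBl tP// ipZl zP// mulr0 subrr.
move=> _ [n [a [Nn ->]]].
have -> : n + a *: w = (n + a *: z) + a *: u.
  by rewrite /u scalerBr addrA addrAC addrK.
rewrite ipDr to ?add0r; last by apply: submodD => //; exact: submodZ.
rewrite ipZr opprD addrA ipBl ipBl ipZl /b divfK//.
by rewrite [ip t u]ipC zP// subr0 subrr mulr0.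
Qed.

Lemma projable_extends N (w : nat -> H) k : projable N ->
  projable [set x | exists n (f : nat -> R), N n /\ x = n + \sum_(i < k) f i *: w i].
Proof.
move=> pN; elim: k => [|k IH].
  move: (pN); congr projable; apply/seteqP.
  split => [x Nx|x [n [f [Nn ->]]]]; last by rewrite big_ord0 addr0.
  by exists x, (fun=> 0); rewrite big_ord0 addr0.
have := projable_extend (w k) IH; congr projable; apply/seteqP; split.
  move=> _ [_ [a [[n [f [Nn ->]]] ->]]].
  exists n, (fun i => if i == k then a else f i); split => //.
  rewrite big_ord_recr /= eqxx addrA; congr (_ + _ + _).
  by apply: eq_bigr => i _; rewrite ltn_eqF.
move=> _ [n [f [Nn ->]]]; exists (n + \sum_(i < k) f i *: w i), (f k).
by split; [exists n, f|rewrite big_ord_recr /= addrA].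
Qed.

End Convergence.

(** * Absolute values and traces *)

Section AbsoluteValue.
Context {R : realType} {H : hilbert R}.
Implicit Types (x y z l : H) (a c C : R) (T S W K A : H -> H) (N : set H).

(** The last clause, applied to multiplication by [i], makes the absolute value of a complex linear
    operator complex linear. *)
Definition square_root S A := [/\ adj A A, exists C, bnd C A,
  forall x, 0 <= ip (A x) x, forall x, A (A x) = S x &
  forall (J : H -> H) D, lin J -> bnd D J -> (forall x, S (J x) = J (S x)) ->
    forall x, A (J x) = J (A x)].

(* The iteration [Y_{k+1} = (S + Y_k ^ 2) / 2] converges in norm when [|S| <= 1],
   being dominated by the same iteration for numbers with [S = 1]; its limit
   [Y] satisfies [(1 - Y) ^ 2 = 1 - S]. *)
Lemma square_root_contraction S : adj S S -> bnd 1 S ->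
  exists A, square_root (fun x => x - S x) A.
Proof.
move=> SS bS; have lS := adj_lin SS.
pose Y := fix Y (n : nat) (x : H) {struct n} : H := if n is n'.+1 then
  2^-1 *: (S x + Y n' (Y n' x)) else 0.
pose fix a (n : nat) : R := if n is n'.+1 then (1 + a n' ^+ 2) / 2 else 0.
have a01 n : 0 <= a n <= 1.
  elim: n => [|n /andP[a0 a1]] /=; first lra.
  have := sqr_ge0 (a n); have : a n ^+ 2 <= 1 by rewrite expr_le1.
  lra.
have aS n : a n <= a n.+1.
  have := sqr_ge0 (a n - 1).
  by have -> : (a n - 1) ^+ 2 = a n ^+ 2 - 2 * a n + 1; [ring|move=> /=; lra].
have YY n : adj (Y n) (Y n).
  elim: n => [|n IH] x y /=; first by rewrite ip0l ip0r.
  by rewrite ipZl ipZr ipDl ipDr SS !IH.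
have lY n : lin (Y n) := adj_lin (YY n).
have bY n : bnd (a n) (Y n).
  elim: n => [|n IH] x /=; first by rewrite hn0 mul0r.
  rewrite hnZ ger0_norm ?invr_ge0// mulrC mulrAC ler_pM2r ?invr_gt0//.
  apply: le_trans (hnD _ _) _; rewrite mulrDl lerD//.
  apply: le_trans (IH _) _; rewrite expr2 -mulrA ler_wpM2l//.
  by case/andP: (a01 n).
(* The factorization [Y_{n+1}^2 - Y_n^2 = Y_{n+1} (Y_{n+1} - Y_n) + (Y_{n+1} - Y_n) Y_n] requires no
   commutation. The same identity for the numbers [a n] turns the bounds of its factors into the
   bound claimed. *)
have dY n x : hn (Y n.+1 x - Y n x) <= (a n.+1 - a n) * hn x.
  elim: n x => [|n IH] x.
    rewrite !subr0; exact: bY.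
  rewrite [Y n.+2]lock /= -lock.
  have -> : Y n.+2 x - 2^-1 *: (S x + Y n (Y n x)) =
      2^-1 *: (Y n.+1 (Y n.+1 x - Y n x) + (Y n.+1 (Y n x) - Y n (Y n x))).
    rewrite (linB _ _ (lY n.+1)) addrA subrK.
    rewrite [LHS](_ : _ = 2^-1 *: (S x + Y n.+1 (Y n.+1 x)) -
      2^-1 *: (S x + Y n (Y n x)))// -scalerBr.
    by rewrite opprD addrACA subrr add0r.
  rewrite hnZ ger0_norm ?invr_ge0//.
  have h1 := bY n.+1 (Y n.+1 x - Y n x).
  have h2 := IH x; have h3 := IH (Y n x); have h4 := bY n x.
  have [a0 a1] := andP (a01 n); have [b0 b1] := andP (a01 n.+1).
  have ab := aS n.
  have h5 := hnD (Y n.+1 (Y n.+1 x - Y n x)) (Y n.+1 (Y n x) - Y n (Y n x)).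
  have -> : a n.+2 - a n.+1 = 2^-1 * (a n.+1 * (a n.+1 - a n) + (a n.+1 - a n) * a n).
    have := erefl (a n.+1); have := erefl (a n.+2).
    rewrite {2}[a n.+2]/= -/(a n.+1) {2}[a n.+1]/=.
    by move: (a n) (a n.+1) (a n.+2) => u v w; rewrite expr2 => wv vu; lra.
  rewrite -mulrA ler_pM2l ?invr_gt0//; apply: le_trans h5 _.
  rewrite mulrDl lerD//.
    apply: le_trans h1 _; rewrite -mulrA; exact: ler_wpM2l.
  apply: le_trans h3 _; rewrite -mulrA; apply: ler_wpM2l h4.
  by rewrite subr_ge0.
have dYm n m x : hn (Y (n + m)%N x - Y n x) <= (a (n + m)%N - a n) * hn x.
  elim: m => [|m IH]; first by rewrite addn0 !subrr hn0 mul0r.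
  rewrite addnS; apply: le_trans (hn_dist_triangle (Y (n + m)%N x) _ _) _.
  apply: le_trans (lerD (dY _ x) IH) _; rewrite -mulrDl; apply: ler_wpM2r.
    exact: hn_ge0.
  by rewrite addrA subrK.
have amono n m : (n <= m)%N -> a n <= a m.
  move=> nm; rewrite -(subnKC nm); elim: (m - n)%N => [|k IH]; first by rewrite addn0.
  by rewrite addnS; exact: le_trans IH (aS _).
have supa : has_sup (range a).
  split; first by exists (a 0%N), 0%N.
  by exists 1 => _ [n _ <-]; case/andP: (a01 n).
have acauchy (e : R) : 0 < e -> exists n0, forall n m,
    (n0 <= n)%N -> a (n + m)%N - a n < e.
  move=> e0; have [_ [n0 _ <-] h] := sup_adherent e0 supa.
  exists n0 => n m n0n; have := amono _ _ n0n.
  have : a (n + m)%N <= sup (range a) by apply: ub_le_sup; [case: supa|exists (n + m)%N].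
  move: h; lra.
have [Z ZP] : {Z : H -> H & forall x, conv (fun n => Y n x) (Z x)}.
  apply: (@choice H H (fun x z => conv (fun n => Y n x) z)) => x.
  apply: hn_complete => e e0.
  have x0 : 0 < hn x + 1 by rewrite ltr_wpDl// hn_ge0.
  have [|n0 n0P] := acauchy (e / (hn x + 1)); first by rewrite divr_gt0.
  have main n m : (n0 <= n)%N -> (n <= m)%N -> hn (Y m x - Y n x) < e.
    move=> n0n nm; rewrite -(subnKC nm); apply: le_lt_trans (dYm _ _ _) _.
    apply: (@le_lt_trans _ _ ((a (n + (m - n))%N - a n) * (hn x + 1))).
      by rewrite ler_wpM2l ?lerDl// subr_ge0 amono// leq_addr.
    by rewrite -ltr_pdivlMr// n0P.
  exists n0 => m n n0m n0n; case: (leqP n m) => nm; first exact: main.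
  by rewrite hn_distC; apply: main => //; exact: ltnW.
have bY1 n : bnd 1 (Y n).
  move=> x; apply: le_trans (bY n x) _; rewrite ler_wpM2r ?hn_ge0//.
  by case/andP: (a01 n).
have ZZ : adj Z Z.
  by move=> x y; apply: conv_ip (ZP x) (ZP y) _ => n; exact: YY.
have lZ := adj_lin ZZ.
have bZ : bnd 1 Z.
  move=> x; rewrite -[Z x]subr0; apply: conv_dist_le (ZP x) _ => n.
  rewrite subr0; exact: bY1.
have ZE x : Z x = 2^-1 *: (S x + Z (Z x)).
  apply: conv_unique (conv_shift (ZP x)) _ => /=.
  apply: convZ; apply: convD; first exact: conv_cst.
  move=> e e0; have [|n1 h1] := ZP x (e / 2); first by rewrite divr_gt0.
  have [|n2 h2] := ZP (Z x) (e / 2); first by rewrite divr_gt0.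
  exists (maxn n1 n2) => n; rewrite geq_max => /andP[/h1{}h1 /h2{}h2].
  apply: le_lt_trans (hn_dist_triangle (Y n (Z x)) _ _) _.
  rewrite -linB//; have := bY1 n (Y n x - Z x); lra.
exists (fun x => x - Z x); split.
- by move=> x y; rewrite ipBl ipBr ZZ.
- exists 2 => x; apply: le_trans (hnB _ _) _; have := bZ x; lra.
- move=> x; rewrite ipBl subr_ge0; apply: le_trans (ip_le' _ _) _.
  rewrite -hn2 expr2; rewrite ler_wpM2r ?hn_ge0//.
  by have := bZ x; rewrite mul1r.
- move=> x; rewrite linB// opprB.
  have -> : Z (Z x) = 2 *: Z x - S x.
    by rewrite [in RHS]ZE scalerA mulfV ?pnatr_eq0// scale1r [in RHS]addrC addKr.
  by rewrite scaler_nat mulr2n [_ - S x - _]addrAC addrK addrA subrK.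
- move=> J D lJ bJ SJ x.
  have {}SJ y : S (J y) = J (S y).
    by have := SJ y; rewrite (linB _ _ lJ) => /addrI/oppr_inj.
  rewrite linB//; congr (_ - _).
  apply: conv_unique (ZP (J x)) _.
  have YJ n y : Y n (J y) = J (Y n y).
    elim: n y => [|n IH] y /=; first by rewrite (lin0 lJ).
    by rewrite SJ !IH (linZ _ _ lJ) (linD _ _ lJ).
  have := conv_comp lJ bJ (ZP x).
  by congr conv; apply/funext => n; rewrite YJ.
Qed.

(** Scaled to a contraction [k], the operator satisfies [k^2 = 1 - (1 - k^2)] with [1 - k^2] again a
    contraction, which is the form treated by [square_root_contraction]. *)
Lemma absolute_value K C : adj K K -> bnd C K ->
  exists A, square_root (fun x => K (K x)) A.
Proof.
move=> KK bK; have lK := adj_lin KK.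
pose M := `|C| + 1; have M0 : 0 < M by rewrite ltr_wpDl.
have bK' : bnd M K.
  move=> x; apply: le_trans (bK x) _; rewrite ler_wpM2r ?hn_ge0//.
  by apply: le_trans (ler_norm C) _; rewrite lerDl.
pose k x := M^-1 *: K x.
have kk : adj k k by move=> x y; rewrite ipZl ipZr KK.
have bk : bnd 1 k.
  by move=> x; rewrite hnZ gtr0_norm ?invr_gt0// mul1r mulrC ler_pdivrMr// mulrC.
have Sadj : adj (fun x => x - k (k x)) (fun x => x - k (k x)).
  by move=> x y; rewrite ipBl ipBr !kk.
have bS : bnd 1 (fun x => x - k (k x)).
  move=> x; rewrite mul1r; apply: ler_wsqrtr; rewrite ip_hnB -kk.
  have := bnd_ip (k x) bk; rewrite expr1n mul1r; have := ip_ge0 (k x); lra.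
have [A [AA [D bA] A0 A2 AJ]] := square_root_contraction Sadj bS.
exists (fun x => M *: A x); split.
- by move=> x y; rewrite ipZl ipZr AA.
- exists (M * D) => x; rewrite hnZ gtr0_norm// -mulrA ler_pM2l//; exact: bA.
- by move=> x; rewrite ipZl mulr_ge0// ltW.
- move=> x; rewrite (linZ _ _ (adj_lin AA)) A2 subKr /k (linZ _ _ lK) !scalerA.
  set b := (X in X *: _); have -> : b = 1 by rewrite /b; field; rewrite gt_eqF.
  by rewrite scale1r.
- move=> J E lJ bJ KJ x; rewrite (AJ J E)//; first by rewrite linZ.
  by move=> y; rewrite !subKr /k !(linZ _ _ lK) KJ !(linZ _ _ lJ).
Qed.

(* With [B = 1 - A / M], the contractions [U_m = K (1 + B + ... + B ^ (m-1)) / M]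
   satisfy [ip (K x) (U_m x) = ip (A x) (x - B ^ m x)], and the positive numbers
   [ip (A B ^ m x) x] are [O (1 / m)]: they replace the polar decomposition. *)
Lemma trace_le K A M (s : seq H) (t : R) : lin K -> adj A A ->
  bnd M A -> (forall x, 0 <= ip (A x) x) ->
  (forall x y, ip (A (A x)) y = ip (K x) (K y)) -> onf s ->
  (forall U, lin U -> bnd 1 U -> \sum_(e <- s) ip (K e) (U e) <= t) ->
  \sum_(e <- s) ip (A e) e <= t.
Proof.
move=> lK AA bA A0 A2 os Ut; have lA := adj_lin AA.
wlog M0 : M bA / 0 < M.
  move=> h; apply: (h (`|M| + 1)); last by rewrite ltr_wpDl.
  move=> x; apply: le_trans (bA x) _; rewrite ler_wpM2r ?hn_ge0//.
  by apply: le_trans (ler_norm M) _; rewrite lerDl.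
pose B x := x - M^-1 *: A x.
have BB : adj B B by move=> x y; rewrite ipBl ipBr ipZl ipZr AA.
have lB := adj_lin BB.
have AB x : A (B x) = B (A x) by rewrite /B linB// linZ.
have B0 x : 0 <= ip (B x) x.
  rewrite ipBl ipZl subr_ge0 mulrC ler_pdivrMr//.
  apply: le_trans (ip_le' _ _) _; rewrite -hn2 expr2 mulrAC.
  by rewrite ler_wpM2r ?hn_ge0// [leRHS]mulrC; exact: bA.
have AB0 x : 0 <= ip (A (B x)) x.
  (* As [A / M + B = 1] and [A] commutes with [B], the product [A B] is the sum of [A B A / M] and
     [B A B], both visibly positive. *)
  have -> : A (B x) = M^-1 *: A (B (A x)) + B (A (B x)).
    by rewrite -AB; rewrite {3}/B addrC subrK.
  rewrite ipDl addr_ge0// ?ipZl.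
    by rewrite mulr_ge0 ?invr_ge0 ?(ltW M0)// AA B0.
  by rewrite BB A0.
pose Bn m x := iter m B x.
have BnS m x : Bn m.+1 x = B (Bn m x) by [].
have lBn m : lin (Bn m).
  by elim: m => // m IH a x y; rewrite !BnS IH lB.
have BnD m n x : Bn m (Bn n x) = Bn (m + n)%N x by rewrite /Bn iterD.
have ABn m x : A (Bn m x) = Bn m (A x).
  by elim: m => // m IH; rewrite !BnS AB IH.
have BBnC m x : B (Bn m x) = Bn m (B x).
  by rewrite -[B x]/(Bn 1%N x) BnD addn1.
have BBn m : adj (Bn m) (Bn m).
  by elim: m => // m IH x y; rewrite BnS BB IH -BBnC.
(* [B ^ m] is [B^j B^j] or [B^j B B^j] according to the parity of [m]; both are positive. *)
have Bn0 m x : 0 <= ip (Bn m x) x.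
  rewrite -(odd_double_half m) -addnn; set j := m./2.
  case: odd; last by rewrite add0n -BnD BBn ip_ge0.
  by rewrite add1n BnS -BnD BBnC BBn B0.
have ABn0 m x : 0 <= ip (A (Bn m x)) x.
  rewrite -(odd_double_half m) -addnn; set j := m./2.
  case: odd; last by rewrite add0n -BnD ABn BBn A0.
  by rewrite add1n BnS -BnD BBnC ABn BBn AB0.
have step m x : ip (Bn m x) x - ip (Bn m.+1 x) x = M^-1 * ip (A (Bn m x)) x.
  by rewrite BnS /B -ipBl opprB addrC subrK ipZl.
have ABn_decr m x : ip (A (Bn m.+1 x)) x <= ip (A (Bn m x)) x.
  rewrite -subr_ge0 -ipBl -linB// BnS /B opprB addrC subrK linZ// ipZl.
  by rewrite mulr_ge0 ?invr_ge0 ?(ltW M0)// AA ABn Bn0.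
(* The numbers [ip (A (B^j x)) x] decrease with [j], and by [step] their sum over [j <= m]
   telescopes to at most [M * ip x x]. *)
have ABn_le m x : m.+1%:R * ip (A (Bn m x)) x <= M * ip x x.
  have tel : M^-1 * (m.+1%:R * ip (A (Bn m x)) x) <= ip x x - ip (Bn m.+1 x) x.
    elim: m => [|m IH].
      by rewrite mul1r -[X in X - _]/(ip (Bn 0%N x) x) step.
    have := step m.+1 x; have := ABn_decr m x => d st.
    have : M^-1 * (m.+1%:R * ip (A (Bn m.+1 x)) x) <=
           M^-1 * (m.+1%:R * ip (A (Bn m x)) x).
      by rewrite ler_pM2l ?invr_gt0// ler_pM2l.
    rewrite -[in X in _ -> X]natr1 mulrDl mul1r mulrDr; move: IH; lra.
  rewrite -ler_pdivrMl//; have := Bn0 m.+1 x; lra.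
pose p m x := M^-1 *: \sum_(j < m) Bn j x.
have lp m : lin (p m).
  move=> a x y; rewrite /p; under eq_bigr do rewrite lBn.
  by rewrite big_split /= scalerDr -scaler_sumr !scalerA mulrC.
have Ap m x : A (p m x) = x - Bn m x.
  rewrite /p linZ// lin_sum// scaler_sumr; elim: m => [|m IH].
    by rewrite big_ord0 subrr.
  by rewrite big_ord_recr /= IH [in RHS]/B opprB addrA [RHS]addrAC.
(* The norm of [K (p m x)] is that of [A (p m x) = x - B^m x], and [0 <= B^m <= 1]. *)
have bU m : bnd 1 (fun x => K (p m x)).
  move=> x; rewrite mul1r; apply: ler_wsqrtr; rewrite -A2 AA Ap ip_hnB.
  have -> : ip (Bn m x) (Bn m x) = ip (Bn m (Bn m x)) x by rewrite [RHS]BBn.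
  have h : ip (Bn m (Bn m x)) x <= ip (Bn m x) x.
    have dec j : ip (Bn j.+1 x) x <= ip (Bn j x) x.
      by rewrite -subr_ge0 step mulr_ge0 ?invr_ge0 ?(ltW M0).
    rewrite BnD; elim: {1}m => // j IH; rewrite addSn; exact: le_trans (dec _) IH.
  rewrite ipC; have := Bn0 m x; lra.
have key m : \sum_(e <- s) ip (A e) e <= t + (size s)%:R * M / m.+1%:R.
  have := Ut _ (lin_comp lK (lp m)) (bU m).
  under eq_bigr do rewrite /= -A2 AA Ap ipBr [ip (A _) (Bn _ _)]ipC.
  rewrite sumrB => h.
  suff : \sum_(e <- s) ip (Bn m e) (A e) <= (size s)%:R * M / m.+1%:R.
    by set d := _ / _ => ?; lra.
  apply: (@le_trans _ _ (\sum_(e <- s) M / m.+1%:R)).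
    rewrite big_seq [leRHS]big_seq; apply: ler_sum => e es.
    rewrite -AA ler_pdivlMr// mulrC; apply: le_trans (ABn_le m e) _.
    by case: os => _ /(_ _ _ es es) ->; rewrite eqxx mulr1.
  by rewrite big_const_seq count_predT iter_addr_0 -(mulr_natl (M / _)) mulrA.
apply/ler_addgt0Pl => e e0; rewrite addrC.
pose D := (size s)%:R * M.
have D0 : 0 <= D by rewrite mulr_ge0 ?(ltW M0).
apply: le_trans (key (Num.truncn (D / e))) _; rewrite lerD2l -/D.
by rewrite ler_pdivrMr// mulrC -ler_pdivrMr// ltW// truncnS_gt.
Qed.

(** Cauchy-Schwarz in arithmetic-geometric form. The weight [t] balances a small bound against a
    large one, with no square roots of the squared norms [a] and [b]. *)
Lemma HS_pairing_le A B a b (t : R) (s : seq H) : 0 < t -> onf s -> HS A a ->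
  HS B b -> \sum_(e <- s) ip (A e) (B e) <= (t * a + t^-1 * b) / 2.
Proof.
move=> t0 os Aa Bb.
apply: (@le_trans _ _
  (\sum_(e <- s) (t * ip (A e) (A e) + t^-1 * ip (B e) (B e)) / 2)).
  apply: ler_sum => e _; rewrite ler_pdivlMr//.
  have := ip_ge0 (t *: A e - B e); rewrite ip_hnB !ipZl !ipZr => h.
  rewrite -(ler_pM2l t0) [leRHS]mulrDr [in leRHS](mulrA t t^-1) mulfV ?gt_eqF// mul1r; lra.
rewrite -mulr_suml ler_pM2r ?invr_gt0// big_split /= -!mulr_sumr.
rewrite lerD// ler_pM2l ?invr_gt0//; first exact: Aa.
exact: Bb.
Qed.

Lemma HS_pairing_contraction A B U S a b (t : R) (s : seq H) : 0 < t -> onf s ->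
  HS A a -> adj B S -> HS S b -> lin U -> bnd 1 U ->
  \sum_(e <- s) ip (A e) (B (U e)) <= (t * a + t^-1 * b) / 2.
Proof.
move=> t0 os Aa BS Sb lU bU.
have := HS_comp lU bU BS Sb; rewrite expr1n mul1r => BUb.
exact: (HS_pairing_le t0 os Aa BUb).
Qed.

(* [P Pi P - P Q P = (P D) (Pi P) + (P Q) (D P)] with [D = Pi - Q]. *)
Lemma trace_diff_le P Q Pi c (t : R) (s : seq H) U : adj P P -> adj Q Q ->
  adj Pi Pi ->
  (forall x, Pi (Pi x) = Pi x) -> (forall x, Q (Q x) = Q x) ->
  HS (fun x => Q (P x)) c -> 0 < t ->
  HS (fun x => P (Pi x - Q x)) (t ^+ 2) -> onf s -> lin U -> bnd 1 U ->
  \sum_(e <- s) ip (P (Pi (P e) - Q (P e))) (U e) <= t * (t ^+ 2 + 3 * c / 2 + 1).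
Proof.
move=> PP QQ PiPi Pi2 Q2 QPc t0 Dt os lU bU.
have lPi := adj_lin PiPi; have lQ := adj_lin QQ; have lP := adj_lin PP.
pose D x := P (Pi x - Q x); pose D' x := Pi (P x) - Q (P x).
have DD' : adj D D' by move=> x y; rewrite /D /D' PP ipBl ipBr PiPi QQ.
have D't : HS D' (t ^+ 2) := HS_adj (adjC DD') Dt.
have PiP : HS (fun x => Pi (P x)) (2 * t ^+ 2 + 2 * c).
  apply: eq_HSon (HSonD D't QPc) => x; by rewrite /D' subrK.
have QPa : adj (fun x => Q (P x)) (fun x => P (Q x)).
  by move=> x y; rewrite QQ PP.
have PQc : HS (fun x => P (Q x)) c := HS_adj (adjC QPa) QPc.
(* In each of the two products one factor has squared norm at most [t ^ 2] and the other a bounded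
   one. The weights [t] and [t^-1] make both estimates of order [t]. *)
have h1 := HS_pairing_contraction t0 os PiP (adjC DD') Dt lU bU.
have ti : 0 < t^-1 by rewrite invr_gt0.
have h2 := HS_pairing_contraction ti os D't QPa PQc lU bU.
have -> : \sum_(e <- s) ip (P (Pi (P e) - Q (P e))) (U e) =
    \sum_(e <- s) ip (Pi (P e)) (D' (U e)) + \sum_(e <- s) ip (D' e) (Q (P (U e))).
  rewrite -big_split /=; apply: eq_bigr => e _.
  rewrite -DD' -(adjC QPa) -ipDl /D /D' -linD//; congr (ip (P _) _).
  by rewrite Pi2 (linB _ _ lQ) Q2 addrA subrK.
apply: le_trans (lerD h1 h2) _.
rewrite invrK le_eqVlt; apply/orP; left; apply/eqP.
by field; rewrite gt_eqF.
Qed.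

End AbsoluteValue.

(** * Convergence of projections in Hilbert-Schmidt norm *)

Section Asymptotics.
Context {R : realType} {H : hilbert R}.
Implicit Types (x y z l : H) (a c C : R).

Definition HS0 (T : nat -> H -> H) := forall e : R, 0 < e ->
  exists n0, forall n, (n0 <= n)%N -> HS (T n) e.

Lemma HS0D (T S : nat -> H -> H) : HS0 T -> HS0 S ->
  HS0 (fun n x => T n x + S n x).
Proof.
move=> T0 S0 e e0; have [|n1 h1] := T0 (e / 4); first by rewrite divr_gt0.
have [|n2 h2] := S0 (e / 4); first by rewrite divr_gt0.
exists (maxn n1 n2) => n; rewrite geq_max => /andP[/h1{}h1 /h2{}h2].
apply: HSon_le (HSonD h1 h2); lra.
Qed.

Lemma HS0_dom (T S : nat -> H -> H) (c C : R) : 0 <= C ->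
  (exists n0, forall n, (n0 <= n)%N -> HS (T n) c) ->
  (forall e : R, 0 < e -> exists n0, forall n, (n0 <= n)%N ->
    forall x, hn (S n x) <= e * hn (T n x)) -> HS0 S.
Proof.
move=> C0 [n1 Tc] ST e e0.
have c0 : 0 <= c by exact: HSon_ge0 (Tc _ (leqnn _)).
have d0 : 0 < e / (c + 1) by rewrite divr_gt0// ltr_wpDl.
have [|n2 h] := ST (Num.sqrt (e / (c + 1))); first by rewrite sqrtr_gt0.
exists (maxn n1 n2) => n; rewrite geq_max => /andP[/Tc{}Tc /h{}h].
apply: HSon_le (HSon_dom (sqrtr_ge0 _) Tc (fun x _ => h x)).
rewrite sqr_sqrtr ?(ltW d0)// mulrAC ler_pdivrMr ?ltr_wpDl//.
by rewrite ler_pM2l// lerDl.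
Qed.

Lemma HS0_comp (T S W : nat -> H -> H) C n0 : (forall n, adj (T n) (S n)) ->
  HS0 S -> (forall n, (n0 <= n)%N -> lin (W n) /\ bnd C (W n)) ->
  HS0 (fun n x => T n (W n x)).
Proof.
move=> TS S0 WC e e0.
have C1 : 0 < C ^+ 2 + 1 by rewrite ltr_wpDl// sqr_ge0.
have [|n1 h] := S0 (e / (C ^+ 2 + 1)); first by rewrite divr_gt0.
exists (maxn n0 n1) => n; rewrite geq_max => /andP[/WC[lW bW] /h{}h].
apply: HSon_le (HS_comp lW bW (TS n) h).
by rewrite mulrCA ler_piMr ?(ltW e0)// ler_pdivrMr// mul1r lerDl.
Qed.

Lemma ip_ext x y : (forall z, ip x z = ip y z) -> x = y.
Proof.
move=> xy; apply/eqP; rewrite -subr_eq0; apply/eqP/ip_eq0.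
by rewrite ipBl xy subrr.
Qed.

Lemma bnd_subid M : bnd 1 M -> bnd 2 (fun x : H => x - M x).
Proof. by move=> bM x; apply: le_trans (hnB _ _) _; have := bM x; lra. Qed.

Lemma adj_subid (M : H -> H) : adj M M ->
  adj (fun x => x - M x) (fun x => x - M x).
Proof. by move=> MM; apply: adj_sub. Qed.

(* Writing [Pi n x = h l + w], the orthogonality of [x - h l - w] to [h L] gives
   [l = Q (l - h h l) + Q h x - Q h w], whence
   [P (Pi n - Q) x = (h - 1) P Q l + P Q (1 - h h) l - P Q (1 - h) x
      - P Q h w + P w]. *)
Lemma HS_projection_cvg (Q P : H -> H) (h X Pi l w : nat -> H -> H)
  (v : nat -> nat -> H) (c C : R) (k n1 j0 : nat) :
  adj Q Q -> bnd 1 Q -> adj P P -> bnd 1 P -> HS (fun x => Q (P x)) c ->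
  (forall n, adj (h n) (h n)) -> (forall n, bnd 1 (h n)) ->
  (forall n, adj (X n) (X n)) -> (forall n, bnd 1 (X n)) ->
  (forall n x, P (h n x) = h n (P x)) ->
  (forall n j x, X j (h n x) = h n (X j x)) ->
  (forall x, hn (P x) <= hn (X j0 x)) ->
  (forall x, conv (h ^~ x) x) -> (forall x, conv (X ^~ x) x) ->
  (forall e : R, 0 < e -> exists n0, forall n, (n0 <= n)%N ->
    forall x, hn (P x - h n (P x)) <= e * hn (P x)) ->
  0 <= C ->
  (forall n, (n1 <= n)%N ->
    [/\ lin (l n) /\ bnd C (l n), lin (w n) /\ bnd C (w n),
        forall x, Pi n x = h n (l n x) + w n x,
        forall x, Q (l n x) = l n x &
        forall x y, ip (x - Pi n x) (h n (Q y)) = 0]) ->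
  (forall n x, exists f : nat -> R, w n x = \sum_(i < k) f i *: v n i) ->
  (forall j (e : R), 0 < e -> exists n0, forall n, (n0 <= n)%N ->
    forall x, hn (X j (w n x)) <= e * hn (w n x)) ->
  HS0 (fun n x => P (Pi n x - Q x)).
Proof.
move=> QQ bQ PP bP QPc hh bh XX bX Ph Xh PX h1 X1 hP C0 Pin vw Xw.
have lQ := adj_lin QQ; have lP := adj_lin PP.
have lh n := adj_lin (hh n); have lX n := adj_lin (XX n).
have QPa : adj (fun x => Q (P x)) (fun x => P (Q x)).
  by move=> x y; rewrite QQ PP.
have PQc : HS (fun x => P (Q x)) c := HS_adj (adjC QPa) QPc.
have lbl n : (n1 <= n)%N -> lin (l n) /\ bnd C (l n) by case/Pin.
have lbw n : (n1 <= n)%N -> lin (w n) /\ bnd C (w n) by case/Pin.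
have wHS n : (n1 <= n)%N -> HS (w n) (k%:R * C ^+ 2).
  by move=> /lbw[lw bw]; exact: HS_finite_rank lw bw (vw n).
have cvg_sub (M : nat -> H -> H) : (forall n, adj (M n) (M n)) ->
    (forall n, bnd 1 (M n)) -> (forall x, conv (M ^~ x) x) ->
    HS0 (fun n x => Q (P x) - M n (Q (P x))).
  move=> MM bM M1 e e0.
  have := @HS_cvg0 _ _ _ _ (fun n x => x - M n x) c 2 _ QPa QPc _ _ _ e e0.
  apply => //.
  - by move=> n; exact/adj_lin/adj_subid.
  - by move=> n; exact: bnd_subid.
  - move=> x d /(M1 (Q (P x)))[n0 n0P]; exists n0 => n /n0P.
    by rewrite hn_distC.
(* (h - 1) P Q l *)
have T1 : HS0 (fun n x => h n (P (l n x)) - P (l n x)).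
  apply: (@HS0_dom (fun n x => P (Q (l n x))) _ (C ^+ 2 * c) 1) => //.
    by exists n1 => n /lbl[ll bl]; exact: (HS_comp ll bl (adjC QPa) QPc).
  move=> e /hP[n0 n0P]; exists (maxn n0 n1) => n; rewrite geq_max.
  move=> /andP[/n0P{}n0P /Pin[_ _ _ Ql _]] x.
  by rewrite Ql hn_distC.
(* P Q (1 - h) x *)
have T3 : HS0 (fun n x => P (Q (x - h n x))).
  apply: (@HS0_comp (fun n x => P (Q (x - h n x)))
    (fun n x => Q (P x) - h n (Q (P x))) (fun=> id) 1 0).
  - by move=> n x y; rewrite (adjC QPa) (adj_subid (hh n)).
  - exact: cvg_sub.
  - by move=> n _; split; [exact: lin_id|exact: bnd_id].
(* P Q (1 - h h) l *)
have T2 : HS0 (fun n x => P (Q (l n x - h n (h n (l n x))))).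
  apply: (@HS0_comp (fun n x => P (Q (x - h n (h n x))))
    (fun n x => Q (P x) - h n (h n (Q (P x)))) l C n1) => //.
    by move=> n x y; rewrite (adjC QPa) ipBl ipBr !hh.
  apply: (cvg_sub (fun n x => h n (h n x))).
  - by move=> n x y; rewrite !hh.
  - move=> n x; apply: le_trans (bh n _) _; rewrite mul1r; exact: bh.
  - move=> x e e0; have [|n0 n0P] := h1 x (e / 2); first by rewrite divr_gt0.
    exists n0 => n /n0P n0n; apply: le_lt_trans (hn_dist_triangle (h n x) _ _) _.
    by rewrite -linB//; have := bh n (h n x - x); lra.
have T5 : HS0 (fun n x => P (w n x)).
  apply: (@HS0_dom w _ (k%:R * C ^+ 2) 1) => //; first by exists n1.
  move=> e /(Xw j0)[n0 n0P]; exists n0 => n /n0P{}n0P x.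
  exact: le_trans (PX _) (n0P x).
(* P Q h w, split by [X j] for a large [j] *)
have T4 : HS0 (fun n x => P (Q (h n (w n x)))).
  move=> e e0; pose d := e / (4 * (C ^+ 2 + 1)).
  have C1 : 0 < C ^+ 2 + 1 by rewrite ltr_wpDl// sqr_ge0.
  have d0 : 0 < d by rewrite divr_gt0// mulr_gt0.
  have [j jP] := cvg_sub X XX bX X1 d d0.
  have {}jP := jP j (leqnn j).
  have far n : (n1 <= n)%N ->
      HS (fun x => P (Q (h n (w n x) - X j (h n (w n x))))) (C ^+ 2 * d).
    move=> /lbw[lw bw].
    apply: (@HS_comp _ _ (fun x => P (Q (x - X j x))) _ (fun x => h n (w n x))
      _ _ _ _ _ jP).
    - exact: (lin_comp (lh n) lw).
    - by move=> x; apply: le_trans (bh n _) _; rewrite mul1r; exact: bw.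
    - by move=> x y; rewrite (adjC QPa) (adj_subid (XX j)).
  have near : HS0 (fun n x => P (Q (X j (h n (w n x))))).
    apply: (@HS0_dom w _ (k%:R * C ^+ 2) 1) => //; first by exists n1.
    move=> e' /(Xw j)[n0 n0P]; exists n0 => n /n0P{}n0P x.
    apply: le_trans (bP _) _; rewrite mul1r; apply: le_trans (bQ _) _.
    by rewrite mul1r Xh; apply: le_trans (bh _ _) _; rewrite mul1r.
  have [|n2 n2P] := near (e / 4); first by rewrite divr_gt0.
  exists (maxn n1 n2) => n; rewrite geq_max => /andP[n1n /n2P nearn].
  apply: (@eq_HSon _ _ _ (fun x => P (Q (h n (w n x) - X j (h n (w n x)))) +
                                   P (Q (X j (h n (w n x)))))).
    by move=> x; rewrite -linD// -linD// subrK.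
  apply: HSon_le (HSonD (far _ n1n) nearn).
  suff : C ^+ 2 * d <= e / 4 by lra.
  have -> : C ^+ 2 * d = C ^+ 2 / (C ^+ 2 + 1) * (e / 4).
    by rewrite /d; field; rewrite gt_eqF.
  by rewrite ler_piMl ?divr_ge0 ?(ltW e0)// ler_pdivrMr// mul1r lerDl.
have neg (T : nat -> H -> H) : HS0 T -> HS0 (fun n x => - T n x).
  move=> T0 e /T0[n0 n0P]; exists n0 => n /n0P h0.
  have := HSon_dom (C := 1) (S := fun x => - T n x) ler01 h0.
  by rewrite expr1n mul1r; apply => x _; rewrite hnN mul1r.
have all := HS0D (HS0D (HS0D T1 T2) (HS0D (neg _ T3) (neg _ T4))) T5.
move=> e /all[n0 n0P]; exists (maxn n0 n1) => n; rewrite geq_max.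
move=> /andP[/n0P all_n /Pin[_ _ Pil Ql o]].
apply: eq_HSon all_n => x.
(* The orthogonality of [x - Pi n x] to [h L] means that [Q h] annihilates it; the test vector is
   the resulting element of the range of [Q] itself. *)
have QE : Q (h n x) = Q (h n (h n (l n x))) + Q (h n (w n x)).
  apply/eqP; rewrite -linD// -linD// -Pil -subr_eq0 -linB// -linB//; apply/eqP.
  apply: ip_eq0; set y := Q _; rewrite /y QQ hh.
  by have := o x y; rewrite /y.
have lE : l n x = Q (l n x - h n (h n (l n x))) + Q (h n x) - Q (h n (w n x)).
  by rewrite QE linB// Ql addrA subrK addrK.
rewrite (linB _ _ lP) Pil (linD _ _ lP) Ph.
have PlE : P (l n x) = P (Q (l n x - h n (h n (l n x)))) + P (Q (h n x)) - P (Q (h n (w n x))).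
  by rewrite {1}lE linB// linD.
have PQE : P (Q x) = P (Q (x - h n x)) + P (Q (h n x)).
  by rewrite -linD// -linD// subrK.
rewrite PQE; move: PlE; set Pl := P (l n x); set hPl := h n Pl => PlE.
apply: ip_ext => z; rewrite !ipDl !ipNl (ipDl (P (Q _)) (P (Q _))).
have := congr1 (fun y => ip y z) PlE; rewrite !ipDl ipNl; lra.
Qed.

End Asymptotics.

(** * Growth of norms on a finite-dimensional space of coefficients *)

Section FiniteDimension.
Context {R : realType} {H : hilbert R}.

(** Otherwise every level [j] has a coefficient vector [c j] of maximum norm 1 and of norm at most
    [M] at that level. These cluster at some nonzero [d], whose norm exceeds [M + 1] at some level
    [j]. By monotonicity the later [c j'] still have norm at most [M] at level [j], which is
    impossible when they are close to [d]. *)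
Lemma unbounded_finite_dim (z : nat -> nat -> H) (k : nat) (M : R) :
  (forall (f : nat -> R) j j', (j <= j')%N ->
     hn (\sum_(i < k) f i *: z j i) <= hn (\sum_(i < k) f i *: z j' i)) ->
  (forall f : nat -> R, (exists i : 'I_k, f i != 0) ->
     forall B, exists j, B < hn (\sum_(i < k) f i *: z j i)) ->
  exists j, forall (f : nat -> R) (i : 'I_k),
    M * `|f i| <= hn (\sum_(i < k) f i *: z j i).
Proof.
move=> mono unb; apply: contrapT => no.
have bad j : exists c : 'rV[R]_k, (forall i, `|c 0 i| <= 1) /\
    (exists i, `|c 0 i| = 1) /\ hn (\sum_(i < k) c 0 i *: z j i) <= M.
  have [f [i fi]] : exists (f : nat -> R) (i : 'I_k),
      hn (\sum_(i < k) f i *: z j i) < M * `|f i|.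
    apply: contrapT => all_j; apply: no; exists j => f i.
    by rewrite leNgt; apply/negP => ?; apply: all_j; exists f, i.
  pose i0 := [arg max_(i0 > i) `|f (nat_of_ord i0)|]%O.
  have f0 (i' : 'I_k) : `|f i'| <= `|f i0|.
    by rewrite /i0; case: arg_maxP => // m _; exact.
  have fi0 : 0 < `|f i0|.
    rewrite lt_neqAle normr_ge0 andbT eq_sym; apply: contraTneq fi => h.
    have := f0 i; rewrite h => /(conj (normr_ge0 (f i)))/andP/le_anti <-.
    by rewrite mulr0 -leNgt hn_ge0.
  have M0 : 0 <= M.
    rewrite -(pmulr_lge0 _ (_ : 0 < `|f i|)).
      by rewrite (le_trans (hn_ge0 _) (ltW fi)).
    rewrite lt_neqAle normr_ge0 andbT eq_sym; apply: contraTneq fi => ->.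
    by rewrite mulr0 -leNgt hn_ge0.
  exists (\row_i (`|f i0|^-1 * f i)); split; [|split].
  - by move=> i'; rewrite mxE normrM normfV normr_id mulrC ler_pdivrMr// mul1r.
  - by exists i0; rewrite mxE normrM normfV normr_id mulVf ?gt_eqF.
  - under eq_bigr do rewrite mxE -scalerA.
    rewrite -scaler_sumr hnZ normfV normr_id mulrC ler_pdivrMr//.
    by apply: le_trans (ltW fi) _; rewrite ler_wpM2l.
have [c cP] := choice bad.
have Ac : compact
    [set v : 'rV[R]_k | forall i, v ord0 i \in `[(-1 : R), 1]].
  apply: (@rV_compact _ _ (fun=> `[(-1 : R), 1]%classic)) => _.
  exact: segment_compact.
have [|d [_ dcl]] := Ac (c @ \oo) _.
  exists 0%N => // j _ i /=; rewrite in_itv /= -ler_norml.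
  by have [] := cP j.
have near J (e : R) : 0 < e -> exists2 j, (J <= j)%N & forall i, `|c j 0 i - d 0 i| < e.
  move=> e0.
  have [|_ [/= [j Jj <-] dj]] :=
    dcl [set c j | j in [set j | (J <= j)%N]] (ball d e) _ (nbhsx_ballx _ _ e0).
    by exists J => // j Jj; exists j.
  exists j => // i; rewrite distrC.
  by case: dj => _ /(_ 0 i).
pose f (i : nat) := if insub i is Some i' then d 0 i' else 0 : R.
have fE (i : 'I_k) : f i = d 0 i by rewrite /f valK.
have [|j jM] := unb f _ (M + 1).
  have [|j _ jd] := near 0%N 2^-1 _; first by rewrite invr_gt0.
  have [_ [[i ci] _]] := cP j; exists i; rewrite fE.
  by apply/eqP => di; have := jd i; rewrite di subr0 ci; lra.
pose D := \sum_(i < k) hn (z j i).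
have D0 : 0 < D + 1 by rewrite ltr_wpDl// sumr_ge0// => i _; exact: hn_ge0.
(* Within this distance of [d], the norm at level [j] varies by at most 1. *)
have [|j' jj' jd] := near j (D + 1)^-1 _; first by rewrite invr_gt0.
have [_ [_ cM]] := cP j'.
have := mono (fun i => if insub i is Some i' then c j' 0 i' else 0) _ _ jj'.
under eq_bigr do rewrite valK; under [in leRHS]eq_bigr do rewrite valK.
move=> cj; have {cj}cM := le_trans cj cM.
have diff : hn (\sum_(i < k) f i *: z j i - \sum_(i < k) c j' 0 i *: z j i) <= 1.
  rewrite -sumrB; apply: le_trans (hn_sum _ _ _) _.
  apply: (@le_trans _ _ (\sum_(i < k) (D + 1)^-1 * hn (z j i))).
    apply: ler_sum => i _; rewrite fE -scalerBl hnZ distrC.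
    by rewrite ler_wpM2r ?hn_ge0// ltW.
  by rewrite -mulr_sumr mulrC ler_pdivrMr// mul1r lerDl.
have := hnD (\sum_(i < k) f i *: z j i - \sum_(i < k) c j' 0 i *: z j i)
            (\sum_(i < k) c j' 0 i *: z j i).
rewrite subrK => h; suff : M + 1 < M + 1 by rewrite ltxx.
by apply: lt_le_trans jM _; apply: le_trans h _; rewrite addrC lerD.
Qed.

End FiniteDimension.

(** * Orthonormal bases and orthogonal projectors *)

Section Basis.
Context {R : realType} {H : hilbert R}.
Implicit Types (x y z : H) (B N : set H) (s : seq H) (T S k : H -> H).

Definition onb B := [/\ forall x, B x -> ip x x = 1,
  forall x y, B x -> B y -> x <> y -> ip x y = 0 &
  forall y, (forall x, B x -> ip y x = 0) -> y = 0].

Definition within B s := uniq s /\ forall x, x \in s -> B x.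

Lemma onb_onf B s : onb B -> within B s -> onf s.
Proof.
move=> [B1 B0 _] [us sB]; split => // x y /sB Bx /sB By.
by case: eqP => [->|xy]; [rewrite B1|rewrite B0].
Qed.

(** The finite combinations of [B] form a subspace with trivial orthogonal complement, hence a dense
    one. The bound is claimed for every larger family [s'] so that several vectors can share one
    family. *)
Lemma parseval_approx B y (e : R) : onb B -> 0 < e -> exists2 s, within B s &
  forall s', within B s' -> {subset s <= s'} ->
  ip y y <= \sum_(b <- s') ip y b ^+ 2 + e.
Proof.
move=> oB e0; pose N := [set x : H | exists2 s, within B s &
  forall s', within B s' -> {subset s <= s'} -> x = \sum_(b <- s') ip x b *: b].
have sN : submod N.
  split.
    exists [::]; first by [].
    by move=> s' _ _; rewrite big1// => b _; rewrite ip0l scale0r.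
  move=> a x z [s [us sB] sx] [t [ut tB] tz]; exists (undup (s ++ t)).
    split; first exact: undup_uniq.
    by move=> w; rewrite mem_undup mem_cat => /orP[/sB|/tB].
  move=> s' Bs' sub.
  have ss : {subset s <= s'} by move=> w ws; apply: sub; rewrite mem_undup mem_cat ws.
  have ts : {subset t <= s'}.
    by move=> w wt; apply: sub; rewrite mem_undup mem_cat wt orbT.
  under eq_bigr do rewrite ipDl ipZl scalerDl -scalerA.
  by rewrite big_split /= -scaler_sumr -(sx s')// -(tz s').
have [z [zN zo]] := projection y sN.
have BN b : B b -> N b.
  move=> Bb; exists [:: b]; first by split => // x; rewrite inE => /eqP ->.
  move=> s' Bs' sub; have bs : b \in s' by apply: sub; rewrite inE.
  have [us os] := onb_onf oB Bs'.
  rewrite (bigD1_seq b)//= os// eqxx scale1r big_seq_cond big1 ?addr0//.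
  by move=> c /andP[cs cb]; rewrite os// eq_sym (negbTE cb) scale0r.
have yz : y = z.
  apply/eqP; rewrite -subr_eq0; apply/eqP; case: oB => _ _; apply => x /BN.
  exact: zo.
have [|n [s Bs ns] yn] := zN (Num.sqrt e); first by rewrite sqrtr_gt0.
exists s => // s' Bs' sub; have os := onb_onf oB Bs'.
rewrite -lerBlDl onf_proj_sqr// -hn2.
have := onf_best y (ip n) os; rewrite -(ns s')// => best.
rewrite -[leRHS]sqr_sqrtr ?(ltW e0)// ler_pXn2r ?nnegrE ?hn_ge0 ?sqrtr_ge0//.
by apply: le_trans best _; rewrite yz ltW.
Qed.

(** A Hilbert-Schmidt bound has to be checked on a single basis only: the vectors [T y], for [y] in
    [r], are expanded up to a small error over a common finite part [s] of [B], the sums are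
    exchanged, and Bessel's inequality is applied to each [S b]. *)
Lemma HS_of_basis B T S (t : R) : onb B -> adj T S ->
  (forall s, within B s -> \sum_(b <- s) ip (S b) (S b) <= t) -> HS T t.
Proof.
move=> oB TS St r or _; apply/ler_addgt0Pl => e e0.
pose m : R := (size r)%:R.
have m1 : 0 < m + 1 by rewrite ltr_wpDl.
have [s Bs sP] : exists2 s, within B s & forall y, y \in r ->
    ip (T y) (T y) <= \sum_(b <- s) ip (T y) b ^+ 2 + e / (m + 1).
  have main (q : seq H) : exists2 s, within B s &
      forall s', within B s' -> {subset s <= s'} -> forall y, y \in q ->
      ip (T y) (T y) <= \sum_(b <- s') ip (T y) b ^+ 2 + e / (m + 1).
    elim: q => [|y q [s [us sB] IH]]; first by exists [::].
    have [|t' [ut tB] tP] := @parseval_approx B (T y) (e / (m + 1)) oB.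
      by rewrite divr_gt0.
    exists (undup (s ++ t')).
      split; first exact: undup_uniq.
      by move=> w; rewrite mem_undup mem_cat => /orP[/sB|/tB].
    move=> s' Bs' sub w; rewrite inE => /predU1P[->|wq].
      by apply: tP => // v vt; apply: sub; rewrite mem_undup mem_cat vt orbT.
    by apply: IH wq => // v vs; apply: sub; rewrite mem_undup mem_cat vs.
  by have [s Bs sP] := main r; exists s => // y; apply: sP.
apply: (@le_trans _ _ (\sum_(y <- r) (\sum_(b <- s) ip (T y) b ^+ 2 + e / (m + 1)))).
  by rewrite big_seq [leRHS]big_seq; apply: ler_sum => y /sP.
rewrite big_split /= addrC; apply: lerD.
  rewrite big_const_seq count_predT iter_addr_0 -(mulr_natl (e / _)) -/m.
  by rewrite mulrCA ler_piMr ?(ltW e0)// ler_pdivrMr// mul1r lerDl.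
rewrite exchange_big /=; apply: le_trans (St s Bs).
apply: ler_sum => b _; under eq_bigr do rewrite TS ipC.
exact: bessel.
Qed.

Definition projector N k := (forall x, N (k x)) /\
  forall x y, N y -> ip (x - k x) y = 0.

Section Projector.
Variables (N : set H) (k : H -> H).
Hypotheses (sN : submod N) (kN : projector N k).

Lemma projector_unique x z : N z -> (forall y, N y -> ip (x - z) y = 0) ->
  k x = z.
Proof.
move=> Nz zo; apply/eqP; rewrite -subr_eq0; apply/eqP/ip_eq0.
have Nkz : N (k x - z) by apply: submodB => //; exact: kN.1.
have E : k x - z = (x - z) - (x - k x) by rewrite opprB [RHS]addrC addrA subrK.
by rewrite {1}E ipBl zo// kN.2// subrr.
Qed.

Lemma projector_id x : N x -> k x = x.
Proof. by move=> Nx; apply: projector_unique => // y _; rewrite subrr ip0l. Qed.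

Lemma projector_idem x : k (k x) = k x.
Proof. by apply: projector_id; exact: kN.1. Qed.

Lemma projector_adj : adj k k.
Proof.
move=> x y; have h z w : ip (k z) w = ip (k z) (k w).
  apply/eqP; rewrite -subr_eq0 -ipBr; apply/eqP.
  by rewrite ipC kN.2//; exact: kN.1.
by rewrite (h x y) [RHS]ipC (h y x) ipC.
Qed.

Lemma projector_bnd : bnd 1 k.
Proof.
move=> x; rewrite mul1r; apply: ler_wsqrtr.
have -> : ip x x = ip ((x - k x) + k x) ((x - k x) + k x) by rewrite subrK.
rewrite (ip_hnD (x - k x)) (kN.2 x (k x)); last exact: kN.1.
by rewrite mulr0 addr0 lerDr ip_ge0.
Qed.

Lemma projector_commute J J' : adj J J' ->
  (forall x, N x -> N (J x)) -> (forall x, N x -> N (J' x)) ->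
  forall x, k (J x) = J (k x).
Proof.
move=> JJ' NJ NJ' x; apply: projector_unique; first exact/NJ/kN.1.
move=> y Ny; rewrite -(linB _ _ (adj_lin JJ')) JJ'; apply: kN.2; exact: NJ'.
Qed.

End Projector.

End Basis.

(** * The Hilbert space of square integrable functions *)

Section ComplexParts.
Context {R : realType}.
Implicit Types z w : R[i].

Lemma ReD z w : complex.Re (z + w) = complex.Re z + complex.Re w.
Proof. by case: z w => [? ?] []. Qed.

Lemma ImD z w : complex.Im (z + w) = complex.Im z + complex.Im w.
Proof. by case: z w => [? ?] []. Qed.

Lemma ReM z w : complex.Re (z * w) =
  complex.Re z * complex.Re w - complex.Im z * complex.Im w.
Proof. by case: z w => [? ?] []. Qed.

Lemma ImM z w : complex.Im (z * w) =
  complex.Re z * complex.Im w + complex.Im z * complex.Re w.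
Proof. by case: z w => [? ?] []. Qed.

Lemma ReN z : complex.Re (- z) = - complex.Re z.
Proof. by case: z. Qed.

Lemma ImN z : complex.Im (- z) = - complex.Im z.
Proof. by case: z. Qed.

Lemma ReJ z : complex.Re (conjc z) = complex.Re z.
Proof. by case: z. Qed.

Lemma ImJ z : complex.Im (conjc z) = - complex.Im z.
Proof. by case: z. Qed.

Lemma ReC (a : R) : complex.Re (real_complex R a) = a.
Proof. by []. Qed.

Lemma ImC (a : R) : complex.Im (real_complex R a) = 0.
Proof. by []. Qed.

Lemma Re_i : complex.Re ('i%C : R[i]) = 0.
Proof. by []. Qed.

Lemma Im_i : complex.Im ('i%C : R[i]) = 1.
Proof. by []. Qed.

Definition partsE := (Re_i, Im_i, ReD, ImD, ReM, ImM, ReN, ImN, ReJ, ImJ, ReC, ImC).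

Lemma complex_ext z w : complex.Re z = complex.Re w ->
  complex.Im z = complex.Im w -> z = w.
Proof. by case: z w => [a b] [c e] /= -> ->. Qed.

Lemma cabs2_ge0 z : 0 <= cabs2 z.
Proof. by rewrite addr_ge0 ?sqr_ge0. Qed.

Lemma cabs2M z w : cabs2 (z * w) = cabs2 z * cabs2 w.
Proof. by rewrite /cabs2 !partsE; ring. Qed.

Lemma cabs2C (a : R) : cabs2 (real_complex R a) = a ^+ 2.
Proof. by rewrite /cabs2 !partsE expr0n addr0. Qed.

Lemma cabs2D z w : cabs2 (z + w) <= 2 * cabs2 z + 2 * cabs2 w.
Proof.
rewrite /cabs2 !partsE.
have := sqr_ge0 (complex.Re z - complex.Re w).
have := sqr_ge0 (complex.Im z - complex.Im w).
rewrite !sqrrB !sqrrD; lra.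
Qed.

Lemma cabs2_eq0 z : cabs2 z = 0 -> z = 0.
Proof.
move/eqP; rewrite paddr_eq0 ?sqr_ge0// !sqrf_eq0 => /andP[/eqP ? /eqP ?].
exact: complex_ext.
Qed.

End ComplexParts.

Section SquareIntegrable.
Context d (T : measurableType d) (R : realType).
Variable mu : {measure set T -> \bar R}.
Local Notation C := R[i].
Local Notation F := (T -> C).
Local Notation L2 := (L2 mu).
Local Notation mulf := Defs.mulf.
Implicit Types (f g k : F) (h : T -> R) (a b : C).

Lemma ae_refl U (f : T -> U) : f = f %[ae mu].
Proof. exact: ae_eq_refl. Qed.

Lemma ae_sym U (f g : T -> U) : f = g %[ae mu] -> g = f %[ae mu].
Proof. exact: ae_eq_sym. Qed.

Lemma ae_trans U (f g k : T -> U) :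
  f = g %[ae mu] -> g = k %[ae mu] -> f = k %[ae mu].
Proof. exact: ae_eq_trans. Qed.

Lemma ae_map U V (op : T -> U -> V) (f g : T -> U) : f = g %[ae mu] ->
  (fun x => op x (f x)) = (fun x => op x (g x)) %[ae mu].
Proof. by apply: filterS => x /[apply] /= ->. Qed.

Lemma ae_map2 U U' V (op : T -> U -> U' -> V) (f f' : T -> U) (g g' : T -> U') :
  f = f' %[ae mu] -> g = g' %[ae mu] ->
  (fun x => op x (f x) (g x)) = (fun x => op x (f' x) (g' x)) %[ae mu].
Proof. by apply: filterS2 => x /= fx gx Tx; rewrite fx// gx. Qed.

Lemma cmeasurable_cst a : cmeasurable (cst a : F).
Proof. by split; exact: measurable_cst. Qed.

Lemma cmeasurableD f g : cmeasurable f -> cmeasurable g ->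
  cmeasurable (fun x => f x + g x).
Proof.
move=> [mf mf'] [mg mg']; split.
- by under eq_fun do rewrite ReD; exact: measurable_funD.
- by under eq_fun do rewrite ImD; exact: measurable_funD.
Qed.

Lemma cmeasurableM f g : cmeasurable f -> cmeasurable g ->
  cmeasurable (fun x => f x * g x).
Proof.
move=> [mf mf'] [mg mg']; split.
- under eq_fun do rewrite ReM.
  by apply: measurable_funB; exact: measurable_funM.
- under eq_fun do rewrite ImM.
  by apply: measurable_funD; exact: measurable_funM.
Qed.

Lemma cmeasurableZ a f : cmeasurable f -> cmeasurable (fun x => a * f x).
Proof. by move=> mf; apply: cmeasurableM => //; exact: cmeasurable_cst. Qed.

Lemma cmeasurable_mulf h f : measurable_fun setT h -> cmeasurable f ->
  cmeasurable (mulf h f).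
Proof.
move=> mh mf; suff mh' : cmeasurable (fun x => real_complex R (h x)).
  exact: cmeasurableM.
by split; [exact: mh|exact: measurable_cst].
Qed.

Lemma cmeasurable_cabs2 f : cmeasurable f ->
  measurable_fun setT (fun x => cabs2 (f x)).
Proof.
by move=> [mf mf']; apply: measurable_funD; exact: measurable_funX.
Qed.

Lemma L2_cm f : L2 f -> cmeasurable f.
Proof. by case. Qed.

Lemma L2_integrable f : L2 f ->
  mu.-integrable setT (EFin \o (fun x => cabs2 (f x))).
Proof.
move=> [mf fi]; apply/integrableP; split.
  by apply/measurable_EFinP; exact: cmeasurable_cabs2.
apply: le_lt_trans fi; rewrite le_eqVlt; apply/orP; left; apply/eqP.
by apply: eq_integral => x _ /=; rewrite ger0_norm ?cabs2_ge0.
Qed.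

Lemma L2_dom f (g : T -> R) : cmeasurable f ->
  mu.-integrable setT (EFin \o g) -> (forall x, cabs2 (f x) <= g x) -> L2 f.
Proof.
move=> mf /integrableP[mg gi] fg; split => //; apply: le_lt_trans gi.
apply: ge0_le_integral => //.
- by move=> x _; rewrite lee_fin cabs2_ge0.
- by apply/measurable_EFinP; exact: cmeasurable_cabs2.
- exact: measurableT_comp.
- by move=> x _ /=; rewrite lee_fin (le_trans (fg x))// ler_norm.
Qed.

Lemma L2_0 : L2 (cst 0).
Proof.
apply: (@L2_dom _ (cst 0)); first exact: cmeasurable_cst.
  exact: integrable0.
by move=> x; rewrite /cabs2 expr0n addr0.
Qed.

Lemma L2D f g : L2 f -> L2 g -> L2 (fun x => f x + g x).
Proof.
move=> Lf Lg; apply: (@L2_dom _ (fun x => 2 * cabs2 (f x) + 2 * cabs2 (g x))).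
- by apply: cmeasurableD; exact: L2_cm.
- apply: (integrableD measurableT (f := fun x => (2%:E * (cabs2 (f x))%:E)%E)
    (g := fun x => (2%:E * (cabs2 (g x))%:E)%E)).
    by apply: integrableZl => //; exact: L2_integrable.
  by apply: integrableZl => //; exact: L2_integrable.
- by move=> x; exact: cabs2D.
Qed.

Lemma L2_mul f (h : F) (M : R) : L2 f -> cmeasurable h ->
  (forall x, cabs2 (h x) <= M) -> L2 (fun x => h x * f x).
Proof.
move=> Lf mh hM; apply: (@L2_dom _ (fun x => M * cabs2 (f x))).
- by apply: cmeasurableM => //; exact: L2_cm.
- exact: (integrableZl measurableT M (L2_integrable Lf)).
- by move=> x; rewrite cabs2M ler_wpM2r// cabs2_ge0.
Qed.

Lemma L2Z a f : L2 f -> L2 (fun x => a * f x).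
Proof. by move=> Lf; apply: (L2_mul Lf (cmeasurable_cst a) (M := cabs2 a)). Qed.

Lemma L2N f : L2 f -> L2 (fun x => - f x).
Proof. by move=> /(L2Z (-1)); congr L2; apply/funext => x; rewrite mulN1r. Qed.

Lemma L2B f g : L2 f -> L2 g -> L2 (fun x => f x - g x).
Proof. by move=> Lf /L2N; exact: L2D. Qed.

Lemma L2_sum I (r : seq I) (f : I -> F) : (forall i, L2 (f i)) ->
  L2 (fun x => \sum_(i <- r) f i x).
Proof.
move=> Lf; elim: r => [|i r IH].
  by under eq_fun do rewrite big_nil; exact: L2_0.
by under eq_fun do rewrite big_cons; exact: L2D.
Qed.

Definition contractive h := measurable_fun setT h /\ forall x, `|h x| <= 1.

Lemma L2_mulf h f : contractive h -> L2 f -> L2 (mulf h f).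
Proof.
move=> [mh h1] Lf; apply: (L2_mul Lf (M := 1)).
  by split; [exact: mh|exact: measurable_cst].
by move=> x; rewrite cabs2C -real_normK ?num_real// expr_le1.
Qed.

Lemma L2_ae f g : cmeasurable g -> L2 f -> f = g %[ae mu] -> L2 g.
Proof.
move=> mg [mf fi] fg; split => //; apply: le_lt_trans fi.
rewrite le_eqVlt; apply/orP; left; apply/eqP; apply: ge0_ae_eq_integral => //.
- by apply/measurable_EFinP; exact: cmeasurable_cabs2.
- by apply/measurable_EFinP; exact: cmeasurable_cabs2.
- by move=> x _; rewrite lee_fin cabs2_ge0.
- by move=> x _; rewrite lee_fin cabs2_ge0.
- exact: (ae_map (fun=> fun z => (cabs2 z)%:E) (ae_sym fg)).
Qed.

(** The real part of [inner], which makes L2 a real Hilbert space. Its imaginary part is recovered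
    by replacing [g] by [i g]. *)
Definition rin f g : R := \int[mu]_x
  (complex.Re (f x) * complex.Re (g x) + complex.Im (f x) * complex.Im (g x)).

Lemma inner_rin f g : inner mu f g = Complex (rin f g) (rin f (fun x => 'i%C * g x)).
Proof.
rewrite /inner /rin; congr Complex; apply: eq_Rintegral => x _.
  by rewrite !partsE; ring.
by rewrite !partsE; ring.
Qed.

Lemma integrable_rin f g : L2 f -> L2 g -> mu.-integrable setT
  (EFin \o (fun x => complex.Re (f x) * complex.Re (g x) +
                     complex.Im (f x) * complex.Im (g x))).
Proof.
move=> Lf Lg; have [[mf mf'] _] := Lf; have [[mg mg'] _] := Lg.
apply: (@le_integrable _ _ _ _ _ _ _
  (EFin \o (fun x => cabs2 (f x) + cabs2 (g x)))) => //.
- apply/measurable_EFinP.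
  by apply: measurable_funD; exact: measurable_funM.
- move=> x _ /=; rewrite lee_fin [leRHS]ger0_norm; last first.
    by rewrite addr_ge0 ?cabs2_ge0.
  rewrite /cabs2; move: (complex.Re (f x)) (complex.Re (g x)) => a b.
  move: (complex.Im (f x)) (complex.Im (g x)) => a' b'.
  have ab (u v : R) : `|u * v| <= u ^+ 2 + v ^+ 2.
    have p : 0 <= (u + v) ^+ 2 := sqr_ge0 _.
    have m : 0 <= (u - v) ^+ 2 := sqr_ge0 _.
    have u2 := sqr_ge0 u; have v2 := sqr_ge0 v.
    have {}p : 0 <= u ^+ 2 + 2 * (u * v) + v ^+ 2.
      by apply: le_trans p _; rewrite le_eqVlt; apply/orP; left; apply/eqP; ring.
    have {}m : 0 <= u ^+ 2 - 2 * (u * v) + v ^+ 2.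
      by apply: le_trans m _; rewrite le_eqVlt; apply/orP; left; apply/eqP; ring.
    move: (u * v) (u ^+ 2) (v ^+ 2) p m u2 v2 => w p q *.
    by rewrite ler_norml; apply/andP; split; lra.
  apply: le_trans (ler_normD _ _) _; apply: le_trans (lerD (ab _ _) (ab _ _)) _.
  by rewrite addrACA.
- exact: (integrableD measurableT (L2_integrable Lf) (L2_integrable Lg)).
Qed.

Lemma rinC f g : rin f g = rin g f.
Proof. by apply: eq_Rintegral => x _; ring. Qed.

Lemma rinDl f g k : L2 f -> L2 g -> L2 k ->
  rin (fun x => f x + g x) k = rin f k + rin g k.
Proof.
move=> Lf Lg Lk; rewrite /rin -RintegralD//; try exact: integrable_rin.
by apply: eq_Rintegral => x _; rewrite !partsE; ring.
Qed.

Lemma rinZl (a : R) f g : L2 f -> L2 g ->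
  rin (fun x => real_complex R a * f x) g = a * rin f g.
Proof.
move=> Lf Lg; rewrite /rin -RintegralZl//; last exact: integrable_rin.
by apply: eq_Rintegral => x _; rewrite !partsE; ring.
Qed.

Lemma rin_ge0 f : 0 <= rin f f.
Proof. by apply: Rintegral_ge0 => x _; rewrite -!expr2 cabs2_ge0. Qed.

Lemma rin_self f : L2 f -> ((rin f f)%:E = \int[mu]_x (cabs2 (f x))%:E)%E.
Proof.
move=> Lf; rewrite /rin /Rintegral fineK; last first.
  exact: (integrable_fin_num measurableT (integrable_rin Lf Lf)).
by apply: eq_integral => x _; rewrite -!expr2.
Qed.

Lemma rin_eq0 f : L2 f -> rin f f = 0 -> f = cst 0 %[ae mu].
Proof.
move=> Lf f0; have := rin_self Lf; rewrite f0 => /esym h.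
have mf : measurable_fun setT (fun x => (cabs2 (f x))%:E).
  by apply/measurable_EFinP; exact/cmeasurable_cabs2/L2_cm.
have := (ae_eq_integral_abs mu measurableT mf).1.
have -> : (\int[mu]_x `|(cabs2 (f x))%:E| = 0)%E.
  by rewrite -[RHS]h; apply: eq_integral => x _ /=; rewrite ger0_norm ?cabs2_ge0.
move=> /(_ erefl); apply: filterS => x /= /(_ I) [] /cabs2_eq0 fx _; exact: fx.
Qed.

Lemma rin_ae f f' g g' : cmeasurable f -> cmeasurable f' -> cmeasurable g ->
  cmeasurable g' -> f = f' %[ae mu] -> g = g' %[ae mu] -> rin f g = rin f' g'.
Proof.
move=> [mf mif] [mf' mif'] [mg mig] [mg' mig'] ff' gg'.
rewrite /rin /Rintegral; congr fine; apply: ae_eq_integral => //.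
- by apply/measurable_EFinP; apply: measurable_funD; exact: measurable_funM.
- by apply/measurable_EFinP; apply: measurable_funD; exact: measurable_funM.
- exact: (ae_map2 (fun=> fun z w => (complex.Re z * complex.Re w +
    complex.Im z * complex.Im w)%:E) ff' gg').
Qed.

End SquareIntegrable.

(** * Completeness of L2 *)

Section RieszFischer.
Context d (T : measurableType d) (R : realType).
Variable mu : {measure set T -> \bar R}.
Local Notation C := R[i].
Local Notation F := (T -> C).
Local Notation L2 := (L2 mu).
Local Notation rin := (rin mu).
Implicit Types (f g : F).

Lemma geometric_increments_cvg (a : nat -> R) (c : R) :
  (forall n, `|a n.+1 - a n| <= c * 2^-1 ^+ n) -> cvgn a.
Proof.
move=> ac.
have -> : a = (fun n => a 0%N + series (telescope a) n).
  by apply/funext => n; rewrite seriesEnat /= telescope_sumr// addrC subrK.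
apply: is_cvgD; first exact: is_cvg_cst.
apply: normed_cvg; apply: (series_le_cvg _ _ ac).
- by move=> n; exact: normr_ge0.
- by move=> n; apply: le_trans (ac n); exact: normr_ge0.
have -> : (fun n => c * 2^-1 ^+ n) = geometric c 2^-1 by [].
by apply: is_cvg_geometric_series; rewrite ger0_norm ?invr_ge0// invf_lt1// ltr1n.
Qed.

(** Fatou's lemma for [|u n - g|^2]. The conclusion is an integral and not a value of [rin], because
    [f] is not yet known to be square integrable. *)
Lemma rin_fatou (u : nat -> F) (f g : F) (e : R) (n0 : nat) :
  (forall n, L2 (u n)) -> cmeasurable f -> L2 g ->
  {ae mu, forall x, (complex.Re (u n x) @[n --> \oo] --> complex.Re (f x)) /\
                    (complex.Im (u n x) @[n --> \oo] --> complex.Im (f x))} ->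
  (forall n, (n0 <= n)%N ->
     rin (fun x => u n x - g x) (fun x => u n x - g x) <= e) ->
  (\int[mu]_x (cabs2 (f x - g x))%:E <= e%:E)%E.
Proof.
move=> Lu mf Lg uf ue.
pose G n x := (cabs2 (u n x - g x))%:E : \bar R.
have mG n : measurable_fun setT (G n).
  by apply/measurable_EFinP/cmeasurable_cabs2/L2_cm; exact: L2B.
have mfg : measurable_fun setT (fun x => (cabs2 (f x - g x))%:E).
  apply/measurable_EFinP/cmeasurable_cabs2.
  apply: cmeasurableD => //.
  have := cmeasurableZ (-1) (L2_cm Lg).
  by congr cmeasurable; apply/funext => x; rewrite mulN1r.
have G0 n x : setT x -> (0 <= G n x)%E by rewrite lee_fin cabs2_ge0.
have := fatou mu measurableT mG G0.
have -> : (\int[mu]_x limn_einf (G ^~ x) = \int[mu]_x (cabs2 (f x - g x))%:E)%E.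
  apply: ae_eq_integral => //.
    under eq_fun do rewrite limn_einf_lim.
    apply: emeasurable_fun_cvg (measurable_fun_einfs mG) _ => x _.
    exact: is_cvg_einfs.
  apply: filterS uf => x [ur ui] _.
  have cG : (G n x @[n --> \oo] --> (cabs2 (f x - g x))%:E)%E.
    apply: cvg_EFin; first by apply: nearW.
    rewrite /G /=; apply: cvgD.
      apply: (cvg_comp _ (fun y => y ^+ 2)); last exact: exprn_continuous.
      under eq_fun do rewrite !partsE; rewrite !partsE.
      exact: (cvgB ur (cvg_cst _)).
    apply: (cvg_comp _ (fun y => y ^+ 2)); last exact: exprn_continuous.
    under eq_fun do rewrite !partsE; rewrite !partsE.
    exact: (cvgB ui (cvg_cst _)).
  by rewrite is_cvg_limn_einfE ?(cvg_lim _ cG)//; apply/cvg_ex; eexists; exact: cG.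
move=> h; apply: le_trans h _.
have I n : (n0 <= n)%N -> (\int[mu]_x G n x <= e%:E)%E.
  by move=> n0n; rewrite -rin_self ?lee_fin ?ue//; exact: L2B.
rewrite limn_einf_lim.
apply: lime_le; first exact: is_cvg_einfs.
near=> n; apply: le_trans (I n _); last by near: n; exists n0.
by apply: ereal_inf_lbound; exists n => /=.
Unshelve. all: by end_near. Qed.

(** Along a fast subsequence [v], the sum of [4^k |v (k+1) - v k|^2] has finite integral, so it is
    finite almost everywhere. At such points the increments are of order [2^-k] and [v] converges.
    Fatou's lemma then bounds the distance from the limit to the whole sequence. *)
Lemma L2_complete (u : nat -> F) : (forall n, L2 (u n)) ->
  (forall e : R, 0 < e -> exists N, forall m n, (N <= m)%N -> (N <= n)%N ->
     rin (fun x => u m x - u n x) (fun x => u m x - u n x) < e) ->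
  exists2 f, L2 f & forall e : R, 0 < e -> exists N, forall n, (N <= n)%N ->
     rin (fun x => u n x - f x) (fun x => u n x - f x) < e.
Proof.
move=> Lu uC.
(* The factor [4 ^- k] cancels the weight in [G], and [1 / 2^(k+1)] makes the integrals of the [G k]
   summable. *)
pose e_ (k : nat) : R := 1 / (2 ^ (k + 1))%:R / 4 ^+ k.
have e_gt0 k : 0 < e_ k by rewrite !divr_gt0// ?ltr0n ?expn_gt0// exprn_gt0.
have [N NP] := choice (fun k => uC _ (e_gt0 k)).
pose phi := fix phi (k : nat) := if k is k'.+1 then maxn (phi k') (N k) else N 0%N.
have phiN k : (N k <= phi k)%N by case: k => //= k; exact: leq_maxr.
have phiS k : (phi k <= phi k.+1)%N by exact: leq_maxl.
pose v k := u (phi k).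
have Lv k : L2 (v k) by exact: Lu.
have dv k : rin (fun x => v k.+1 x - v k x) (fun x => v k.+1 x - v k x) < e_ k.
  by apply: NP; [exact: leq_trans (phiN k) (phiS k)|exact: phiN].
pose G k x : \bar R := (4 ^+ k * cabs2 (v k.+1 x - v k x))%:E.
have G0 k x : (0 <= G k x)%E by rewrite lee_fin mulr_ge0// cabs2_ge0.
have mG k : measurable_fun setT (G k).
  apply/measurable_EFinP; apply: measurable_funM => //.
  by apply/cmeasurable_cabs2/L2_cm; exact: L2B.
pose h x := (\sum_(k <oo) G k x)%E.
have mh : measurable_fun setT h by exact: ge0_emeasurable_sum.
have h_lty : (\int[mu]_x h x < +oo)%E.
  rewrite integral_nneseries//.
  apply: (@le_lt_trans _ _ (1 / 2 ^+ 0)%:E); last exact: ltry.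
  rewrite -(cvg_lim _ (@cvg_geometric_eseries_half R 1 0))//.
  apply: lee_nneseries => k _; first by move=> _; exact: integral_ge0.
  have Lk : L2 (fun x => v k.+1 x - v k x) by exact: L2B.
  rewrite /G; under eq_integral do rewrite EFinM.
  rewrite ge0_integralZl_EFin//.
  - rewrite -rin_self// -EFinM lee_fin mulrC -ler_pdivlMr ?exprn_gt0//.
    by rewrite ltW// (lt_le_trans (dv k)).
  - by move=> x _; rewrite lee_fin cabs2_ge0.
  - by apply/measurable_EFinP/cmeasurable_cabs2; exact: L2_cm Lk.
pose D := [set x | (h x < +oo)%E].
have mD : measurable D.
  by have := emeasurable_fun_infty_o measurableT mh +oo%E; rewrite setTI.
have h0 x : (0 <= h x)%E by apply: nneseries_ge0.
have aeD : {ae mu, forall x, D x}.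
  have ih : mu.-integrable setT h.
    by apply/integrableP; split => //; under eq_integral do rewrite gee0_abs//.
  have := integrable_ae measurableT ih; apply: filterS => x /(_ I) /=.
  by rewrite ge0_fin_numE.
have vD x : D x -> cvgn (fun k => complex.Re (v k x)) /\
    cvgn (fun k => complex.Im (v k x)).
  move=> Dx; pose M := fine (h x).
  have hM : h x = M%:E by rewrite fineK// ge0_fin_numE.
  have M0 : 0 <= M by rewrite -lee_fin -hM.
  have GM k : 4 ^+ k * cabs2 (v k.+1 x - v k x) <= M.
    rewrite -lee_fin -hM; apply: le_trans (nneseries_lim_ge k.+1 _) => //.
    rewrite big_nat_recr//= leeDr//; exact: sume_ge0.
  have sq k (r : R) : r ^+ 2 <= cabs2 (v k.+1 x - v k x) ->
      `|r| <= Num.sqrt M * 2^-1 ^+ k.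
    move=> rk; rewrite -sqrtr_sqr exprVn.
    have -> : 2 ^+ k = Num.sqrt (4 ^+ k) :> R.
      rewrite (_ : 4 = 2 ^+ 2) ?sqrtr_sqr; last by rewrite -natrX.
      by rewrite exprAC sqrtr_sqr ger0_norm.
    rewrite -sqrtrV ?exprn_ge0// -sqrtrM// ler_wsqrtr// ler_pdivlMr ?exprn_gt0//.
    rewrite mulrC; apply: le_trans (GM k); exact: ler_wpM2l.
  split; apply: (@geometric_increments_cvg _ (Num.sqrt M)) => k; apply: sq.
    by rewrite -ReN -ReD /cabs2 lerDl sqr_ge0.
  by rewrite -ImN -ImD /cabs2 lerDr sqr_ge0.
(* Cutting [v] off outside [D] makes it converge everywhere, so that the pointwise limit is
   measurable. *)
pose w k : F := fun x => real_complex R (\1_D x) * v k x.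
pose f : F := fun x => Complex (limn (fun k => complex.Re (w k x)))
                               (limn (fun k => complex.Im (w k x))).
have wE x k : w k x = if x \in D then v k x else 0.
  by rewrite /w indicE; case: (x \in D); rewrite ?mul1r ?mul0r.
have wD x : cvgn (fun k => complex.Re (w k x)) /\ cvgn (fun k => complex.Im (w k x)).
  have [xD|xD] := boolP (x \in D).
    have -> : (fun k => complex.Re (w k x)) = (fun k => complex.Re (v k x)).
      by apply/funext => k; rewrite wE xD.
    have -> : (fun k => complex.Im (w k x)) = (fun k => complex.Im (v k x)).
      by apply/funext => k; rewrite wE xD.
    by apply: vD; rewrite inE in xD.
  have -> : (fun k => complex.Re (w k x)) = cst 0.
    by apply/funext => k; rewrite wE (negbTE xD).
  have -> : (fun k => complex.Im (w k x)) = cst 0.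
    by apply/funext => k; rewrite wE (negbTE xD).
  by split; exact: is_cvg_cst.
have cw k : cmeasurable (w k).
  by apply: cmeasurable_mulf; [exact: measurable_indic|exact: L2_cm].
have cf : cmeasurable f.
  split.
  - apply: (@measurable_fun_cvg _ _ _ _ (fun k x => complex.Re (w k x))).
      by move=> k; case: (cw k).
    by move=> x _; exact: (wD x).1.
  - apply: (@measurable_fun_cvg _ _ _ _ (fun k x => complex.Im (w k x))).
      by move=> k; case: (cw k).
    by move=> x _; exact: (wD x).2.
have vf : {ae mu, forall x, (complex.Re (v n x) @[n --> \oo] --> complex.Re (f x)) /\
                    (complex.Im (v n x) @[n --> \oo] --> complex.Im (f x))}.
  apply: filterS aeD => x Dx.
  have E : v ^~ x = w ^~ x by apply/funext => k; rewrite wE mem_set.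
  have /= -> : (fun n => complex.Re (v n x)) = (fun n => complex.Re (w n x)).
    by apply/funext => n; rewrite wE mem_set.
  have /= -> : (fun n => complex.Im (v n x)) = (fun n => complex.Im (w n x)).
    by apply/funext => n; rewrite wE mem_set.
  exact: wD.
have close k m : (N k <= m)%N ->
    (\int[mu]_x (cabs2 (f x - u m x))%:E <= (e_ k)%:E)%E.
  move=> Nm; apply: (@rin_fatou v f (u m) (e_ k) k) => // n kn.
  apply/ltW/NP => //; apply: leq_trans (phiN k) _.
  rewrite -(subnKC kn); elim: (n - k)%N => [|j IH]; first by rewrite addn0.
  by rewrite addnS; exact: leq_trans IH (phiS _).
have Lfu m : (N 0%N <= m)%N -> L2 (fun x => f x - u m x).
  move=> Nm; split; last exact: le_lt_trans (close _ _ Nm) (ltry _).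
  apply: cmeasurableD => //; exact: (L2_cm (L2N (Lu m))).
have Lf : L2 f.
  have := L2D (Lfu _ (leqnn _)) (Lu (N 0%N)).
  by congr L2; apply/funext => x; rewrite subrK.
exists f => // e e0.
have [k ke] : exists k, e_ k < e.
  exists (Num.truncn e^-1); rewrite -[ltRHS]invrK -[ltLHS]invrK.
  rewrite ltf_pV2 ?posrE ?invr_gt0//.
  apply: lt_le_trans (truncnS_gt _) _; rewrite /e_ mul1r invfM !invrK -natrX.
  rewrite -natrM ler_nat; set j := Num.truncn _.
  apply: leq_trans (ltnW (ltn_expl j.+1 (ltnSn 1))) _.
  by rewrite addn1 leq_pmulr// expn_gt0.
exists (N k) => m Nm; apply: le_lt_trans ke; rewrite -lee_fin.
have Lfm : L2 (fun x => u m x - f x) by exact: L2B.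
rewrite rin_self//; apply: le_trans (close _ _ Nm).
rewrite le_eqVlt; apply/orP; left; apply/eqP; apply: eq_integral => x _.
by rewrite -opprB /cabs2 !partsE !sqrrN.
Qed.

End RieszFischer.

(** * L2 modulo almost everywhere equality *)

Section L2Quotient.
Context d (T : measurableType d) (R : realType).
Variable mu : {measure set T -> \bar R}.
Local Notation C := R[i].
Local Notation F := (T -> C).
Local Notation L2 := (L2 mu).

Definition ae_class (f : F) : set F := [set g | L2 g /\ f = g %[ae mu]].

(** A representative that depends only on the class of [f]. The quotient is then encoded as the set
    of the functions in L2 that are their own representative. *)
Definition canon (f : F) : F := xget (cst 0) (ae_class f).

Lemma canonP (f : F) : L2 f -> ae_class f (canon f).
Proof. by move=> Lf; apply: xgetPex; exists f; split=> //; exact: ae_refl. Qed.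

Lemma ae_class_eq (f g : F) : f = g %[ae mu] -> ae_class f = ae_class g.
Proof.
move=> fg; apply/seteqP; split => k [Lk fk]; split => //.
  exact: ae_trans (ae_sym fg) fk.
exact: ae_trans fg fk.
Qed.

Lemma canon_eq (f g : F) : f = g %[ae mu] -> canon f = canon g.
Proof. by rewrite /canon => /ae_class_eq ->. Qed.

Record l2 := L2class { l2rep :> F; l2rep_proof : L2 l2rep /\ canon l2rep = l2rep }.

HB.instance Definition _ := gen_eqMixin l2.
HB.instance Definition _ := gen_choiceMixin l2.

Implicit Types (u v w : l2) (f g : F).

Lemma l2repP u : L2 (l2rep u).
Proof. by case: (l2rep_proof u). Qed.

Lemma rep_inj u v : l2rep u = l2rep v -> u = v.
Proof.
by case: u v => [f fP] [g gP] /= fg; subst g; congr L2class; exact: Prop_irrelevance.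
Qed.

Lemma canonK f : L2 f -> L2 (canon f) /\ canon (canon f) = canon f.
Proof.
by move=> Lf; have [Lc fc] := canonP Lf; split => //; rewrite -(canon_eq fc).
Qed.

(* Junk value: the class of a function that is not square integrable is 0. *)
Definition l2cls f : l2 :=
  if pselect (L2 f) is left Lf then L2class (canonK Lf)
  else L2class (canonK (L2_0 mu)).

Lemma l2rep_cls f : L2 f -> l2rep (l2cls f) = f %[ae mu].
Proof.
move=> Lf; rewrite /l2cls; case: pselect => // Lf' /=.
exact: ae_sym (canonP Lf).2.
Qed.

Lemma l2cls_eqP f g : L2 f -> L2 g -> l2cls f = l2cls g <-> f = g %[ae mu].
Proof.
move=> Lf Lg; split => [fg|fg].
  by apply: ae_trans (ae_sym (l2rep_cls Lf)) _; rewrite fg; exact: l2rep_cls.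
apply: rep_inj; rewrite /l2cls; case: pselect => // ?; case: pselect => // ? /=.
exact: canon_eq.
Qed.

Lemma l2clsK u : l2cls (l2rep u) = u.
Proof.
apply: rep_inj; rewrite /l2cls; case: pselect => [? /=|/(_ (l2repP u))//].
by case: (l2rep_proof u).
Qed.

Lemma l2_reprP u : exists2 f, L2 f & u = l2cls f.
Proof. by exists (l2rep u); [exact: l2repP|rewrite l2clsK]. Qed.

Definition l2add u v := l2cls (fun x => l2rep u x + l2rep v x).
Definition l2opp u := l2cls (fun x => - l2rep u x).
Definition l2scale (a : R) u := l2cls (fun x => real_complex R a * l2rep u x).

Lemma l2addE f g : L2 f -> L2 g -> l2add (l2cls f) (l2cls g) = l2cls (fun x => f x + g x).
Proof.
move=> Lf Lg; apply/l2cls_eqP; [by apply: L2D; exact: l2repP|exact: L2D|].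
exact: (ae_map2 (fun=> +%R) (l2rep_cls Lf) (l2rep_cls Lg)).
Qed.

Lemma l2oppE f : L2 f -> l2opp (l2cls f) = l2cls (fun x => - f x).
Proof.
move=> Lf; apply/l2cls_eqP; [by apply: L2N; exact: l2repP|exact: L2N|].
exact: (ae_map (fun=> -%R) (l2rep_cls Lf)).
Qed.

Lemma l2scaleE a f : L2 f ->
  l2scale a (l2cls f) = l2cls (fun x => real_complex R a * f x).
Proof.
move=> Lf; apply/l2cls_eqP; [by apply: L2Z; exact: l2repP|exact: L2Z|].
exact: (ae_map (fun=> *%R (real_complex R a)) (l2rep_cls Lf)).
Qed.

Lemma l2addA : associative l2add.
Proof.
move=> u v w; have [f Lf ->] := l2_reprP u; have [g Lg ->] := l2_reprP v.
have [k Lk ->] := l2_reprP w; rewrite !l2addE//; try exact: L2D.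
by congr l2cls; apply/funext => x; rewrite addrA.
Qed.

Lemma l2addC : commutative l2add.
Proof. by move=> u v; congr l2cls; apply/funext => x; rewrite addrC. Qed.

Lemma l2add0 : left_id (l2cls (cst 0)) l2add.
Proof.
move=> u; have [f Lf ->] := l2_reprP u; rewrite l2addE//; last exact: L2_0.
by congr l2cls; apply/funext => x; rewrite add0r.
Qed.

Lemma l2addN : left_inverse (l2cls (cst 0)) l2opp l2add.
Proof.
move=> u; have [f Lf ->] := l2_reprP u; rewrite l2oppE// l2addE//; last exact: L2N.
by congr l2cls; apply/funext => x; rewrite addNr.
Qed.

HB.instance Definition _ :=
  GRing.isZmodule.Build l2 l2addA l2addC l2add0 l2addN.

Lemma l2scaleA a b u : l2scale a (l2scale b u) = l2scale (a * b) u.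
Proof.
have [f Lf ->] := l2_reprP u; rewrite !l2scaleE//; last exact: L2Z.
by congr l2cls; apply/funext => x; rewrite mulrA rmorphM.
Qed.

Lemma l2scale1 : left_id 1 l2scale.
Proof.
move=> u; have [f Lf ->] := l2_reprP u; rewrite !l2scaleE//.
by congr l2cls; apply/funext => x; rewrite rmorph1 mul1r.
Qed.

Lemma l2scaleDr : right_distributive l2scale +%R.
Proof.
move=> a u v; have [f Lf ->] := l2_reprP u; have [g Lg ->] := l2_reprP v.
rewrite [LHS](_ : _ = l2scale a (l2add (l2cls f) (l2cls g)))//.
rewrite [RHS](_ : _ = l2add (l2scale a (l2cls f)) (l2scale a (l2cls g)))//.
rewrite (l2addE Lf Lg) (l2scaleE a (L2D Lf Lg)) (l2scaleE a Lf) (l2scaleE a Lg).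
rewrite (l2addE (L2Z _ Lf) (L2Z _ Lg)).
by congr l2cls; apply/funext => x; rewrite mulrDr.
Qed.

Lemma l2scaleDl u : {morph l2scale^~ u : a b / a + b >-> a + b}.
Proof.
move=> a b; have [f Lf ->] := l2_reprP u.
rewrite [RHS](_ : _ = l2add (l2scale a (l2cls f)) (l2scale b (l2cls f)))//.
rewrite !(l2scaleE _ Lf) (l2addE (L2Z _ Lf) (L2Z _ Lf)).
by congr l2cls; apply/funext => x; rewrite rmorphD mulrDl.
Qed.

HB.instance Definition _ :=
  GRing.Zmodule_isLmodule.Build R l2 l2scaleA l2scale1 l2scaleDr l2scaleDl.

Lemma l2clsB f g : L2 f -> L2 g -> l2cls f - l2cls g = l2cls (fun x => f x - g x).
Proof.
move=> Lf Lg; rewrite [LHS](_ : _ = l2add (l2cls f) (l2opp (l2cls g)))//.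
by rewrite (l2oppE Lg) (l2addE Lf (L2N Lg)).
Qed.

Definition l2ip u v := rin mu (l2rep u) (l2rep v).

Lemma l2ipE f g : L2 f -> L2 g -> l2ip (l2cls f) (l2cls g) = rin mu f g.
Proof.
move=> Lf Lg; exact: (rin_ae (L2_cm (l2repP _)) (L2_cm Lf) (L2_cm (l2repP _))
  (L2_cm Lg) (l2rep_cls Lf) (l2rep_cls Lg)).
Qed.

Lemma l2ipC u v : l2ip u v = l2ip v u.
Proof. exact: rinC. Qed.

Lemma l2ipDl u v w : l2ip (u + v) w = l2ip u w + l2ip v w.
Proof.
have [f Lf ->] := l2_reprP u; have [g Lg ->] := l2_reprP v; have [k Lk ->] := l2_reprP w.
have -> : l2cls f + l2cls g = l2cls (fun x => f x + g x) by exact: l2addE.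
by rewrite !l2ipE// ?rinDl//; exact: L2D.
Qed.

Lemma l2ipZl a u v : l2ip (a *: u) v = a * l2ip u v.
Proof.
have [f Lf ->] := l2_reprP u; have [g Lg ->] := l2_reprP v.
have -> : a *: l2cls f = l2cls (fun x => real_complex R a * f x) by exact: l2scaleE.
by rewrite !l2ipE// ?rinZl//; exact: L2Z.
Qed.

Lemma l2ip_ge0 u : 0 <= l2ip u u.
Proof. exact: rin_ge0. Qed.

Lemma l2ip_eq0 u : l2ip u u = 0 -> u = 0.
Proof.
have [f Lf ->] := l2_reprP u; rewrite l2ipE// => /(rin_eq0 Lf) f0.
have -> : 0 = l2cls (cst 0) by [].
by apply/l2cls_eqP => //; exact: L2_0.
Qed.

Lemma l2_complete (u : nat -> l2) :
  (forall e : R, 0 < e -> exists N, forall m n, (N <= m)%N -> (N <= n)%N ->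
     l2ip (u m - u n) (u m - u n) < e) ->
  exists l, forall e : R, 0 < e -> exists N, forall n, (N <= n)%N ->
     l2ip (u n - l) (u n - l) < e.
Proof.
move=> uC; have [|f Lf uf] := L2_complete (fun n => l2repP (u n)) (mu := mu).
  move=> e /uC[N NP]; exists N => m n Nm Nn; have := NP m n Nm Nn.
  rewrite -{1 2}(l2clsK (u m)) -{1 2}(l2clsK (u n)) l2clsB; try exact: l2repP.
  by rewrite l2ipE//; apply: L2B; exact: l2repP.
exists (l2cls f) => e /uf[N NP]; exists N => n Nn; have := NP n Nn.
rewrite -{3 4}(l2clsK (u n)) l2clsB//; last exact: l2repP.
by rewrite l2ipE//; apply: L2B => //; exact: l2repP.
Qed.

(** The interface through which all later arguments see the quotient, whatever its construction. *)
Record l2_space := L2Space {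
  l2_hilbert :> hilbert R;
  cls : F -> l2_hilbert;
  rep : l2_hilbert -> F;
  L2_rep : forall u : l2_hilbert, L2 (rep u);
  clsK : forall u : l2_hilbert, cls (rep u) = u;
  rep_cls : forall f, L2 f -> rep (cls f) = f %[ae mu];
  cls_ae : forall f g, L2 f -> L2 g -> f = g %[ae mu] -> cls f = cls g;
  clsD : forall f g, L2 f -> L2 g -> cls f + cls g = cls (fun x => f x + g x);
  clsZ : forall a f, L2 f -> a *: cls f = cls (fun x => real_complex R a * f x);
  ip_cls : forall f g, L2 f -> L2 g -> ip (cls f) (cls g) = rin mu f g }.

(* Opaque, so that unification does not unfold the construction. *)
Lemma l2_model : l2_space.
Proof.
apply: (@L2Space (@Hilbert R l2 l2ip l2ipC l2ipDl l2ipZl l2ip_ge0 l2ip_eq0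
  l2_complete) l2cls l2rep).
- exact: l2repP.
- exact: l2clsK.
- exact: l2rep_cls.
- by move=> f g Lf Lg fg; apply/l2cls_eqP.
- exact: l2addE.
- exact: l2scaleE.
- exact: l2ipE.
Qed.

End L2Quotient.

Section L2Space.
Context d (T : measurableType d) (R : realType).
Context {mu : {measure set T -> \bar R}} {H : l2_space mu}.
Local Notation C := R[i].
Local Notation F := (T -> C).
Local Notation L2 := (L2 mu).
Local Notation cls := (@cls d T R mu H).
Implicit Types (u v w : H) (f g : F) (a : R).

Lemma cls_eqP f g : L2 f -> L2 g -> cls f = cls g <-> f = g %[ae mu].
Proof.
move=> Lf Lg; split => [fg|]; last exact: cls_ae.
by apply: ae_trans (ae_sym (rep_cls H Lf)) _; rewrite fg; exact: rep_cls.
Qed.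

Lemma l2P u : exists2 f, L2 f & u = cls f.
Proof. by exists (rep u); [exact: L2_rep|rewrite clsK]. Qed.

Lemma cls0 : cls (cst 0) = 0.
Proof.
rewrite -(scale0r (cls (cst 0))) clsZ; last exact: L2_0.
by congr cls; apply/funext => x; rewrite mulr0.
Qed.

Lemma clsN f : L2 f -> - cls f = cls (fun x => - f x).
Proof.
move=> Lf; rewrite -scaleN1r clsZ//.
by congr cls; apply/funext => x; rewrite rmorphN1 mulN1r.
Qed.

Lemma clsB f g : L2 f -> L2 g -> cls f - cls g = cls (fun x => f x - g x).
Proof. by move=> Lf Lg; rewrite clsN// clsD//; exact: L2N. Qed.

Lemma cls_sum I (r : seq I) (f : I -> F) : (forall i, L2 (f i)) ->
  \sum_(i <- r) cls (f i) = cls (fun x => \sum_(i <- r) f i x).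
Proof.
move=> Lf; elim: r => [|i r IH].
  rewrite big_nil; under [in RHS]eq_fun do rewrite big_nil.
  by rewrite -[RHS]/(cls (cst 0)) cls0.
rewrite big_cons IH clsD//; last exact: L2_sum.
by congr cls; apply/funext => x; rewrite big_cons.
Qed.

End L2Space.

(** * Multiplication operators and the complex structure on L2 *)

Section L2Operators.
Context d (T : measurableType d) (R : realType).
Context {mu : {measure set T -> \bar R}} {H : l2_space mu}.
Local Notation C := R[i].
Local Notation F := (T -> C).
Local Notation L2 := (L2 mu).
Local Notation cls := (@cls d T R mu H).
Local Notation mulf := Defs.mulf.
Implicit Types (f g : F) (h k : T -> R) (u v w : H).

Lemma ip_clsE f : L2 f ->
  ((ip (cls f) (cls f))%:E = \int[mu]_x (cabs2 (f x))%:E)%E.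
Proof. by move=> Lf; rewrite ip_cls// rin_self. Qed.

Lemma hn_cls_le f g (c : R) : 0 <= c -> L2 f -> L2 g ->
  (forall x, cabs2 (f x) <= c ^+ 2 * cabs2 (g x)) ->
  hn (cls f) <= c * hn (cls g).
Proof.
move=> c0 Lf Lg fg; rewrite -(@ler_pXn2r _ 2)// ?nnegrE ?mulr_ge0 ?hn_ge0//.
rewrite exprMn.
rewrite !hn2 -lee_fin EFinM !ip_clsE//.
rewrite -ge0_integralZl_EFin ?sqr_ge0//.
- apply: ge0_le_integral => //.
  + by move=> x _; rewrite lee_fin cabs2_ge0.
  + by apply/measurable_EFinP; apply: cmeasurable_cabs2; exact: L2_cm Lf.
  + apply/measurable_EFinP; apply: measurable_funM => //.
    by apply: cmeasurable_cabs2; exact: L2_cm Lg.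
  + by move=> x _; rewrite -EFinM lee_fin.
- by move=> x _; rewrite lee_fin cabs2_ge0.
- by apply/measurable_EFinP; apply: cmeasurable_cabs2; exact: L2_cm Lg.
Qed.

Definition Mul h : H -> H := fun u => cls (mulf h (rep u)).

Lemma Mul_cls h f : contractive h -> L2 f -> Mul h (cls f) = cls (mulf h f).
Proof.
move=> ch Lf; apply/cls_eqP; [by apply: L2_mulf => //; exact: L2_rep|exact: L2_mulf|].
exact: (ae_map (fun x z => real_complex R (h x) * z) (rep_cls H Lf)).
Qed.

Lemma Mul_adj h : contractive h -> adj (Mul h) (Mul h).
Proof.
move=> ch u v; have [f Lf ->] := l2P u; have [g Lg ->] := l2P v.
rewrite !Mul_cls// !ip_cls//; try exact: L2_mulf.
by apply: eq_Rintegral => x _; rewrite !partsE; ring.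
Qed.

Lemma Mul_lin h : contractive h -> lin (Mul h).
Proof. by move=> ch; exact/adj_lin/Mul_adj. Qed.

Lemma hn_Mul_le h k (c : R) u : contractive h -> contractive k -> 0 <= c ->
  (forall x, `|h x| <= c * `|k x|) -> hn (Mul h u) <= c * hn (Mul k u).
Proof.
move=> ch ck c0 hk; have [f Lf ->] := l2P u.
rewrite !Mul_cls//; apply: hn_cls_le => //; try exact: L2_mulf.
move=> x; rewrite !cabs2M !cabs2C mulrA ler_wpM2r ?cabs2_ge0//.
rewrite -[_ ^+ 2]real_normK ?num_real// -[k x ^+ 2]real_normK ?num_real//.
by rewrite -exprMn ler_pXn2r ?nnegrE ?mulr_ge0.
Qed.

Lemma contractive1 : contractive (cst 1 : T -> R).
Proof. by split => [|x]; [exact: measurable_cst|rewrite normr1]. Qed.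

Lemma Mul1 u : Mul (cst 1) u = u.
Proof.
have [f Lf ->] := l2P u; rewrite Mul_cls//; last exact: contractive1.
by congr cls; apply/funext => x; rewrite /Defs.mulf rmorph1 mul1r.
Qed.

Lemma Mul_bnd h : contractive h -> bnd 1 (Mul h).
Proof.
move=> ch u; rewrite -{2}(Mul1 u).
apply: hn_Mul_le => //; first exact: contractive1.
by move=> x; rewrite mul1r normr1; case: ch.
Qed.

Lemma contractiveM h k : contractive h -> contractive k ->
  contractive (fun x => h x * k x).
Proof.
move=> [mh h1] [mk k1]; split => [|x]; first exact: measurable_funM.
by rewrite normrM mulr_ile1.
Qed.

Lemma MulM h k u : contractive h -> contractive k ->
  Mul h (Mul k u) = Mul (fun x => h x * k x) u.
Proof.
move=> ch ck; have [f Lf ->] := l2P u.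
rewrite !Mul_cls//; [|exact: contractiveM|exact: L2_mulf].
by congr cls; apply/funext => x; rewrite /Defs.mulf rmorphM mulrA.
Qed.

Lemma Mul_comm h k u : contractive h -> contractive k ->
  Mul h (Mul k u) = Mul k (Mul h u).
Proof.
move=> ch ck; rewrite !MulM//; congr (Mul _ u).
by apply/funext => x; rewrite mulrC.
Qed.

(** Dominated convergence, with majorant [4 |f|^2] since [|h n - 1| <= 2]. *)
Lemma Mul_cvg (h : nat -> T -> R) u : (forall n, contractive (h n)) ->
  (forall x, h n x @[n --> \oo] --> (1 : R)) ->
  conv (fun n => Mul (h n) u) u.
Proof.
move=> ch h1; have [f Lf ->] := l2P u.
pose G n x := (cabs2 (mulf (h n) f x - f x))%:E : \bar R.
have Ln n : L2 (fun x => mulf (h n) f x - f x) by apply: L2B => //; exact: L2_mulf.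
have mG n : measurable_fun setT (G n).
  by apply/measurable_EFinP; apply: cmeasurable_cabs2; exact: L2_cm (Ln n).
have GE n x : G n x = ((h n x - 1) ^+ 2 * cabs2 (f x))%:E.
  rewrite /G -cabs2C -cabs2M; congr (cabs2 _)%:E.
  by rewrite /Defs.mulf rmorphB rmorph1 mulrBl mul1r.
have G0 x : (G n x @[n --> \oo] --> 0)%E.
  under eq_fun do rewrite GE.
  apply: cvg_EFin; first by apply: nearW.
  rewrite /=; have -> : (0 : R) = (1 - 1) ^+ 2 * cabs2 (f x).
    by rewrite subrr expr0n mul0r.
  apply: cvgM; last exact: cvg_cst.
  apply: (cvg_comp _ (fun y => y ^+ 2)); last exact: exprn_continuous.
  exact: (cvgB (h1 x) (cvg_cst _)).
have iG : mu.-integrable setT (fun x => (4%:E * (cabs2 (f x))%:E)%E).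
  by apply: integrableZl => //; exact: L2_integrable.
have G4 x n : (`|G n x| <= 4%:E * (cabs2 (f x))%:E)%E.
  have p : 0 <= (h n x - 1) ^+ 2 * cabs2 (f x).
    by apply: mulr_ge0; [exact: sqr_ge0|exact: cabs2_ge0].
  rewrite GE -EFinM lee_fin (ger0_norm p); apply: ler_wpM2r (cabs2_ge0 _) _ _ _.
  have [_ /(_ x)] := ch n; rewrite ler_norml => /andP[ha hb].
  have -> : (4 : R) = 2 ^+ 2 by rewrite -natrX.
  by rewrite -real_normK ?num_real// ler_pXn2r ?nnegrE// ler_norml; lra.
have aeG0 : {ae mu, forall x, setT x -> G ^~ x @ \oo --> (0 : \bar R)}.
  by apply: aeW => x _; exact: G0.
have aeG4 : {ae mu, forall x n, setT x -> (`|G n x| <= 4%:E * (cabs2 (f x))%:E)%E}.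
  by apply: aeW => x n _; exact: G4.
have [_ _] := dominated_convergence measurableT mG (measurable_cst 0%E) aeG0 iG aeG4.
rewrite integral0 => /fine_cvgP[_ cG] e e0.
move/cvgrPdist_lt : cG => /(_ (e ^+ 2)); rewrite exprn_gt0// => /(_ isT).
move=> [n0 _ n0P]; exists n0 => n n0n.
have := n0P n n0n; rewrite /= sub0r normrN -ip_clsE//= => h2.
rewrite Mul_cls// clsB//; last exact: L2_mulf.
rewrite -(@ltr_pXn2r _ 2)// ?nnegrE ?hn_ge0 ?(ltW e0)// hn2.
by apply: le_lt_trans h2; exact: ler_norm.
Qed.

(** Monotone convergence along [X]. It converts bounded norms over the sets [X j] into square
    integrability, and so makes the triviality of the intersection of [V] with L2 applicable. *)
Lemma L2_exhaustion (X : nat -> set T) f (B : R) :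
  (forall j, measurable (X j)) -> nondecreasing_seq X ->
  (forall x, exists j, X j x) -> cmeasurable f ->
  (forall j, L2 (mulf \1_(X j) f)) ->
  (forall j, ip (cls (mulf \1_(X j) f)) (cls (mulf \1_(X j) f)) <= B) -> L2 f.
Proof.
move=> mX ndX Xx mf LX XB; split => //.
pose G j x := (cabs2 (mulf \1_(X j) f x))%:E : \bar R.
have mG j : measurable_fun setT (G j).
  by apply/measurable_EFinP; apply: cmeasurable_cabs2; exact: L2_cm (LX j).
have GE j x : G j x = (\1_(X j) x * cabs2 (f x))%:E.
  rewrite /G cabs2M cabs2C; congr (_ * _)%:E.
  by rewrite indicE; case: (_ \in _); rewrite ?expr1n ?expr0n.
have G0 j x : setT x -> (0 <= G j x)%E by rewrite lee_fin cabs2_ge0.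
have ndG x : setT x -> nondecreasing_seq (G ^~ x).
  move=> _ i j /ndX/subsetPset ij; rewrite !GE lee_fin ler_wpM2r ?cabs2_ge0//.
  rewrite !indicE; case: (boolP (x \in X i)) => //; rewrite inE => /ij Xj.
  by rewrite mem_set.
have := @cvg_monotone_convergence _ _ _ mu _ measurableT _ mG G0 ndG.
have -> : (fun x => limn (G ^~ x)) = (fun x => (cabs2 (f x))%:E).
  apply/funext => x; apply/cvg_lim => //.
  have [j Xj] := Xx x; apply: cvg_near_cst.
  exists j => // i ji /=; rewrite GE indicE mem_set ?mul1r//.
  by have /subsetPset := ndX _ _ ji; exact.
move=> cG; apply: (@le_lt_trans _ _ B%:E); last exact: ltry.
rewrite -(cvg_lim _ cG)//; apply: lime_le; first by apply/cvg_ex; eexists; exact: cG.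
by apply: nearW => j; rewrite -(ip_clsE (LX j)) lee_fin.
Qed.

(** Multiplication by [i]: an isometry of the real space with square [-1]. The complex linear
    operators are the linear ones that commute with it. *)
Definition J u : H := cls (fun x => 'i%C * rep u x).

Lemma J_cls f : L2 f -> J (cls f) = cls (fun x => 'i%C * f x).
Proof.
move=> Lf; apply: cls_ae; [by apply: L2Z; exact: L2_rep|exact: L2Z|].
exact: (ae_map (fun=> *%R 'i%C) (rep_cls H Lf)).
Qed.

Lemma J_adj : adj J (fun u => - J u).
Proof.
move=> u v; have [f Lf ->] := l2P u; have [g Lg ->] := l2P v.
rewrite ipNr !J_cls// !ip_cls//; try exact: L2Z.
rewrite -mulN1r [in RHS]rinC -rinZl//; last exact: L2Z.
by apply: eq_Rintegral => x _; rewrite !partsE; ring.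
Qed.

Lemma J_lin : lin J.
Proof. exact: adj_lin J_adj. Qed.

Lemma JJ u : J (J u) = - u.
Proof.
have [f Lf ->] := l2P u; rewrite !J_cls//; last exact: L2Z.
rewrite clsN//; congr cls; apply/funext => x.
by rewrite mulrA -expr2 sqr_i mulN1r.
Qed.

Lemma ip_JJ u v : ip (J u) (J v) = ip u v.
Proof. by rewrite J_adj JJ opprK. Qed.

Lemma J_bnd : bnd 1 J.
Proof. by move=> u; rewrite mul1r /hn ip_JJ. Qed.

Lemma Mul_J h u : contractive h -> Mul h (J u) = J (Mul h u).
Proof.
move=> ch; have [f Lf ->] := l2P u.
rewrite J_cls// !Mul_cls//; last exact: L2Z.
rewrite J_cls; last exact: L2_mulf.
by congr cls; apply/funext => x; rewrite /Defs.mulf mulrCA.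
Qed.

Lemma innerE f g : L2 f -> L2 g ->
  inner mu f g = Complex (ip (cls f) (cls g)) (ip (cls f) (J (cls g))).
Proof.
by move=> Lf Lg; rewrite inner_rin J_cls// !ip_cls//; exact: L2Z.
Qed.

Lemma clsZc (a : C) f : L2 f -> cls (fun x => a * f x) =
  complex.Re a *: cls f + complex.Im a *: J (cls f).
Proof.
move=> Lf; rewrite J_cls// !clsZ//; last exact: L2Z.
rewrite clsD; [|exact: L2Z|by apply: L2Z; exact: L2Z].
congr cls; apply/funext => x; rewrite mulrA -mulrDl; congr (_ * _).
by apply: complex_ext; rewrite !partsE; ring.
Qed.

Lemma L2normE f : L2 f -> L2norm mu f = hn (cls f).
Proof. by move=> Lf; rewrite /L2norm innerE. Qed.

End L2Operators.

Arguments J {d T R mu H} u.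
Arguments Mul {d T R mu H} h u.
Arguments J_lin {d T R mu H}.
Arguments J_bnd {d T R mu H}.
Arguments J_adj {d T R mu H}.

(** * The trace norm *)

Section Traces.
Context d (T : measurableType d) (R : realType).
Context {mu : {measure set T -> \bar R}} {H : l2_space mu}.
Local Notation C := R[i].
Local Notation F := (T -> C).
Local Notation L2 := (L2 mu).
Local Notation cls := (@cls d T R mu H).
Implicit Types (f g e : F) (u v w : H) (K A : F -> F) (k a : H -> H).
Implicit Types (B : set F).

Lemma ip_J_self u : ip u (J u) = 0.
Proof. by have := J_adj u u; rewrite ipNr ipC; lra. Qed.

Lemma inner_eq0 f g : L2 f -> L2 g ->
  inner mu f g = 0 <-> ip (cls f) (cls g) = 0 /\ ip (cls f) (J (cls g)) = 0.
Proof.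
move=> Lf Lg; rewrite (innerE (H := H))//; split => [[]//|[-> ->]//].
Qed.

Lemma inner_self f : L2 f -> inner mu f f = real_complex R (ip (cls f) (cls f)).
Proof. by move=> Lf; rewrite (innerE (H := H))// ip_J_self. Qed.

Lemma inner_sym0 f g : L2 f -> L2 g -> inner mu f g = 0 -> inner mu g f = 0.
Proof.
move=> Lf Lg /(inner_eq0 Lf Lg)[h1 h2]; apply/inner_eq0 => //; split.
  by rewrite ipC.
by rewrite ipC J_adj ipNr h2 oppr0.
Qed.

(** By Zorn's lemma. Without a basis the supremum in [trace_norm] would range over the empty set,
    and finiteness of the trace norm would carry no information. *)
Lemma onb_exists : exists B, orthonormal_basis mu B.
Proof.
pose P B := [/\ B `<=` L2, forall e, B e -> inner mu e e = 1 &
  forall e e', B e -> B e' -> e <> e' -> inner mu e e' = 0].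
have [|B [[BL B1 B0] Bmax]] := @Zorn_bigcup F P.
  move=> G GP Gtot; split.
  - by move=> e [X GX Xe]; have [XL _ _] := GP X GX; exact: XL.
  - by move=> e [X GX Xe]; have [_ X1 _] := GP X GX; exact: X1.
  - move=> e e' [X GX Xe] [Y GY Ye'].
    have [XY|YX] := Gtot X Y GX GY.
      by have [_ _] := GP Y GY; apply => //; exact: XY.
    by have [_ _] := GP X GX; apply => //; exact: YX.
exists B; split => // f Lf f0; apply: contrapT => nf.
have f0' : cls f <> 0.
  by rewrite -cls0 => /cls_eqP; apply: contra_not nf; apply => //; exact: L2_0.
have nf0 := hn_gt0 f0'.
pose b := (hn (cls f))^-1.
pose g : F := fun x => real_complex R b * f x.
have Lg : L2 g by exact: L2Z.
have cg : cls g = b *: cls f by rewrite clsZ.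
have g1 : inner mu g g = 1.
  rewrite inner_self// cg ipZl ipZr -hn2 expr2 mulKf ?gt_eqF// mulVf ?gt_eqF//.
have g0 e : B e -> inner mu g e = 0.
  move=> Be; have Le := BL e Be; have /(inner_eq0 Lf Le)[h1 h2] := f0 e Be.
  by apply/inner_eq0 => //; rewrite cg !ipZl h1 h2 mulr0.
have gB : ~ B g.
  by move=> Bg; have := g0 g Bg; rewrite g1 => /eqP; rewrite oner_eq0.
apply: (Bmax (B `|` [set g])).
  split; last by move=> /(_ g (or_intror erefl)).
  by move=> e; left.
split.
- by move=> e [/BL//|->].
- by move=> e [/B1//|->].
- move=> e e' [Be|->] [Be'|->] ee'; [exact: B0| |exact: g0|by []].
  by apply: inner_sym0 => //; [exact: BL|exact: g0].
Qed.

(** Over the reals a complex basis spans only half of the space; its multiples by [i] supply the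
    rest. *)
Definition real_basis B : set H := cls @` B `|` J @` (cls @` B).

Lemma real_basisP B : orthonormal_basis mu B -> onb (real_basis B).
Proof.
move=> [BL B1 B0 Bc].
have ip1 e : B e -> ip (cls e) (cls e) = 1.
  move=> Be; have := B1 e Be; rewrite inner_self; last exact: BL.
  by case.
have ip0 e e' : B e -> B e' -> e <> e' ->
    ip (cls e) (cls e') = 0 /\ ip (cls e) (J (cls e')) = 0.
  by move=> Be Be' ee'; apply/inner_eq0; [exact: BL|exact: BL|exact: B0].
split.
- move=> _ [[e Be <-]|[_ [e Be <-] <-]]; first exact: ip1.
  by rewrite ip_JJ ip1.
- have main e e' : B e -> B e' -> ip (cls e) (J (cls e')) = 0.
    move=> Be Be'; have [->|/eqP ee'] := pselect (e = e'); first exact: ip_J_self.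
    by have [] := ip0 e e' Be Be' (elimN eqP ee').
  move=> _ _ [[e Be <-]|[_ [e Be <-] <-]] [[e' Be' <-]|[_ [e' Be' <-] <-]] xy.
  + by have [] := ip0 e e' Be Be' _ => // ee'; apply: xy; rewrite ee'.
  + exact: main.
  + by rewrite ipC main.
  + rewrite ip_JJ.
    by have [] := ip0 e e' Be Be' _ => // ee'; apply: xy; rewrite ee'.
- move=> y yB; have [f Lf yE] := l2P y; rewrite yE -cls0; apply: cls_ae => //.
    exact: L2_0.
  apply: Bc => // e Be; apply/inner_eq0; [exact: Lf|exact: BL|].
  rewrite -yE; split; apply: yB; first by left; exists e.
  by right; exists (cls e) => //; exists e.
Qed.

(** The bridge between maps on functions and operators on classes; nothing is asked of [K] outside
    L2. *)
Definition acts K k := forall f, L2 f -> L2 (K f) /\ cls (K f) = k (cls f).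

Definition complex_operator k :=
  [/\ lin k, exists M, bnd M k & forall u, k (J u) = J (k u)].

Lemma bounded_operator_acts K : bounded_operator mu K ->
  exists2 k, acts K k & complex_operator k.
Proof.
move=> [KL Kae Klin [M KM]].
pose k u := cls (K (rep u)).
have Kk : acts K k.
  move=> f Lf; split; first exact: KL.
  apply: cls_ae; [exact: KL|by apply: KL; exact: L2_rep|].
  apply: Kae => //; first exact: L2_rep.
  exact: ae_sym (rep_cls H Lf).
exists k => //; split.
- move=> a u v; have [f Lf ->] := l2P u; have [g Lg ->] := l2P v.
  rewrite clsZ// clsD//; last exact: L2Z.
  have Lfg : L2 (fun x => real_complex R a * f x + g x).
    by apply: L2D => //; exact: L2Z.
  have [[Lk1 <-] [Lk2 <-] [Lk3 <-]] := And3 (Kk _ Lfg) (Kk _ Lf) (Kk _ Lg).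
  rewrite clsZ// clsD//; last exact: L2Z.
  apply: cls_ae => //; first by apply: L2D => //; exact: L2Z.
  exact: Klin.
- exists M => u; have [f Lf ->] := l2P u.
  have [LK <-] := Kk f Lf; rewrite -!(L2normE (H := H))//; exact: KM.
- move=> u; have [f Lf ->] := l2P u; have [LK kE] := Kk f Lf.
  rewrite J_cls// -kE J_cls//.
  have Lif : L2 (fun x => 'i%C * f x) by exact: L2Z.
  have [LK' <-] := Kk _ Lif.
  apply: cls_ae => //; first exact: L2Z.
  have := Klin 'i%C f (cst 0) Lf (L2_0 mu).
  (* With [a = -1] and zero functions, linearity gives [K 0 = 0], which removes the last term of the
     preceding instance. *)
  have := Klin (-1) (cst 0) (cst 0) (L2_0 mu) (L2_0 mu).
  have -> : (fun x : T => -1 * cst 0 x + cst 0 x) = cst 0 :> F.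
    by apply/funext => x; rewrite mulr0 addr0.
  have -> : (fun x : T => 'i%C * f x + cst 0 x) = (fun x => 'i%C * f x).
    by apply/funext => x; rewrite addr0.
  apply: filterS2 => x /= /(_ I) K0 /(_ I) Ki _; rewrite Ki K0.
  by rewrite mulN1r addNr addr0.
Qed.

Lemma acts_bounded_operator K k : acts K k -> complex_operator k ->
  bounded_operator mu K.
Proof.
move=> Kk [lk [M bk] kJ]; split.
- by move=> f /Kk[].
- move=> f g Lf Lg fg; have [[LKf Ef] [LKg Eg]] := (Kk f Lf, Kk g Lg).
  by apply/(cls_eqP (H := H)) => //; rewrite Ef Eg; congr k; exact: cls_ae.
- move=> a f g Lf Lg.
  have Laf : L2 (fun x => a * f x) by exact: L2Z.
  have [LKf Ef] := Kk f Lf; have [LKg Eg] := Kk g Lg.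
  have [LK E] := Kk _ (L2D Laf Lg).
  have LaKf : L2 (fun x => a * K f x) by exact: L2Z.
  apply/(cls_eqP (H := H)) => //; first exact: L2D.
  rewrite E -!clsD// !clsZc// Ef Eg (linD _ _ lk) (linD _ _ lk) !(linZ _ _ lk).
  by rewrite kJ.
- exists M => f Lf; have [LKf Ef] := Kk f Lf.
  by rewrite !(L2normE (H := H))// Ef.
Qed.

Lemma acts_sandwich h K k : contractive h -> acts K k ->
  acts (sandwich h K) (Mul h \o k \o Mul h).
Proof.
move=> ch Kk f Lf; have Lhf : L2 (Defs.mulf h f) by exact: L2_mulf.
have [LK E] := Kk _ Lhf; split; first exact: L2_mulf.
by rewrite /sandwich -(Mul_cls ch LK) E /= (Mul_cls ch Lf).
Qed.

Lemma acts_sub K k K' k' : acts K k -> acts K' k' ->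
  acts (fun f x => K f x - K' f x) (fun u => k u - k' u).
Proof.
move=> Kk Kk' f Lf; have [[LK E] [LK' E']] := (Kk f Lf, Kk' f Lf).
by split; [exact: L2B|rewrite -E -E' clsB].
Qed.

Lemma complex_operator_Mul h : contractive h -> complex_operator (Mul h : H -> H).
Proof.
move=> ch; split; [exact: Mul_lin|by exists 1; exact: Mul_bnd|].
by move=> u; exact: Mul_J.
Qed.

Lemma complex_operator_comp k k' : complex_operator k -> complex_operator k' ->
  complex_operator (k \o k').
Proof.
move=> [lk [M bk] kJ] [lk' [M' bk'] kJ']; split; first exact: lin_comp.
  exists (`|M| * M'); apply: bnd_comp => //.
  by move=> x; apply: le_trans (bk x) _; rewrite ler_wpM2r ?hn_ge0// ler_norm.
by move=> u /=; rewrite kJ' kJ.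
Qed.

Lemma is_absolute_value_acts K A k : acts K k -> is_absolute_value mu K A ->
  exists a, [/\ acts A a, adj a a, exists M, bnd M a, forall u, 0 <= ip (a u) u &
    forall u v, ip (a (a u)) v = ip (k u) (k v)].
Proof.
move=> Kk [bA A0 A2]; have [a Aa [la ba aJ]] := bounded_operator_acts bA.
have pos u : 0 <= ip (a u) u /\ ip (a u) (J u) = 0.
  have [f Lf ->] := l2P u; have [LA <-] := Aa f Lf.
  have := A0 f Lf; rewrite (innerE (H := H))// lecE /= => /andP[/eqP h1 h2].
  by split.
exists a; split => //.
(* Polarization: positivity includes that [ip (a z) (J z) = 0], and at [z = u + J v] this yields the
   symmetry of [a]. *)
- move=> u v; have h := (pos (u + J v)).2.
  rewrite (linD _ _ la) (linD _ _ J_lin) ipDl !ipDr (pos u).2 (pos (J v)).2 in h.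
  rewrite JJ ipNr aJ ip_JJ add0r addr0 in h.
  by rewrite [RHS]ipC; lra.
- by move=> u; exact: (pos u).1.
- move=> u v; have [f Lf ->] := l2P u; have [g Lg ->] := l2P v.
  have [LA <-] := Aa f Lf; have [LAA <-] := Aa _ LA.
  have [LKf <-] := Kk f Lf; have [LKg <-] := Kk g Lg.
  by have := A2 f g Lf Lg; rewrite !(innerE (H := H))// => -[].
Qed.

(** The classes of finitely many elements of a complex basis form a real orthonormal family, so
    [trace_le] bounds each partial sum of the trace of [|K|]. *)
Lemma trace_norm_le K k (t : R) : acts K k -> lin k ->
  (forall (s : seq H) (U : H -> H), onf s -> lin U -> bnd 1 U ->
     \sum_(x <- s) ip (k x) (U x) <= t) ->
  (trace_norm mu K <= t%:E)%E.
Proof.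
move=> Kk lk kt; apply: ge_ereal_sup => _ [A [B [KA oB ->]]].
have [a [Aa aa [M ba] a0 a2]] := is_absolute_value_acts Kk KA.
have oR := real_basisP oB.
have [BL B1 B0 _] := oB.
apply: ge_ereal_sup => _ [X [finX XB] <-].
rewrite fsbig_finite//= sumEFin lee_fin.
pose s := [seq cls e | e <- fset_set X].
have cls_inj : {in fset_set X &, injective cls}.
  move=> e e'; rewrite !in_fset_set// !inE => Xe Xe' ee'.
  apply: contrapT => ne; have [Be Be'] := (XB _ Xe, XB _ Xe').
  have /(inner_eq0 (BL _ Be) (BL _ Be'))[h _] := B0 _ _ Be Be' ne.
  have := B1 _ Be; rewrite inner_self; last exact: BL.
  by rewrite {2}ee' h => /eqP; rewrite eq_sym oner_eq0.
have Ws : within (real_basis B) s.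
  split; first by rewrite map_inj_in_uniq// fset_uniq.
  move=> _ /mapP[e eX ->]; left; exists e => //; apply: XB.
  by move: eX; rewrite in_fset_set// inE.
have os := onb_onf oR Ws.
apply: le_trans (trace_le lk aa ba a0 a2 os (fun U lU bU => kt s U os lU bU)).
rewrite big_map big_seq [leRHS]big_seq le_eqVlt; apply/orP; left; apply/eqP.
apply: eq_bigr => e eX.
have Le : L2 e by apply: BL; apply: XB; move: eX; rewrite in_fset_set// inE.
have [LA <-] := Aa e Le; exact: (congr1 (@complex.Re R) (innerE (H := H) LA Le)).
Qed.

(** As a supremum in the extended reals, the trace norm is [-oo] unless some absolute value and some
    basis exist. Both are produced here, and the trace they give is nonnegative. *)
Lemma trace_norm_ge0 K k : acts K k -> complex_operator k -> adj k k ->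
  (0 <= trace_norm mu K)%E.
Proof.
move=> Kk [lk [M bk] kJ] kk.
have [a [aa [M' ba] a0 a2 aJ]] := absolute_value kk bk.
have [B oB] := onb_exists.
pose A : F -> F := fun f => rep (a (cls f)).
have Aa : acts A a.
  by move=> f Lf; split; [exact: L2_rep|rewrite /A clsK].
have ca : complex_operator a.
  split; [exact: adj_lin aa|by exists M'|].
  move=> u; apply: (aJ _ 1) => //; [exact: J_lin|exact: J_bnd|].
  by move=> v; rewrite !kJ.
have aJ0 u : ip (a u) (J u) = 0.
  case: ca => _ _ aJ'; have : ip (a u) (J u) = - ip (a u) (J u); last lra.
  by rewrite {1}aa aJ' ipC J_adj ipNr.
have absA : is_absolute_value mu K A.
  split; first exact: acts_bounded_operator Aa ca.
    move=> f Lf; have [LA E] := Aa f Lf.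
    by rewrite (innerE (H := H))// E aJ0 lecE /= eqxx a0.
  move=> f g Lf Lg; have [LA E] := Aa f Lf; have [LAA E'] := Aa _ LA.
  have [LKf EKf] := Kk f Lf; have [LKg EKg] := Kk g Lg.
  rewrite !(innerE (H := H))// E' E EKf EKg a2 -kJ.
  by rewrite (kk (k (cls f)) (cls g)) (kk (k (cls f)) (J (cls g))).
apply: (@le_trans _ _ (\esum_(e in B) (complex.Re (inner mu (A e) e))%:E)%E).
  apply: esum_ge0 => e Be; rewrite lee_fin.
  have [BL _ _ _] := oB; have [LA E] := Aa e (BL _ Be).
  by rewrite (innerE (H := H)) ?E//=; exact: BL.
by apply: ereal_sup_ubound; exists A, B.
Qed.

(* [K = S^* S] is its own absolute value. *)
Lemma trace_class_HS K k S S' : trace_class mu K -> acts K k -> adj S S' ->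
  (forall u, k u = S' (S u)) -> (forall u, S (J u) = J (S u)) ->
  exists c, HS S' c.
Proof.
move=> [bK tK] Kk SS' kE SJ.
have [B oB] := onb_exists; have [BL B1 B0 _] := oB.
have kk u v : ip (k u) v = ip (S u) (S v) by rewrite kE ipC -SS' ipC.
have kself : adj k k by move=> u v; rewrite kk [RHS]ipC kk ipC.
have absK : is_absolute_value mu K K.
  split => //.
  - move=> f Lf; have [LK E] := Kk f Lf.
    by rewrite (innerE (H := H))// E !kk SJ ip_J_self lecE /= eqxx ip_ge0.
  - move=> f g Lf Lg; have [LK E] := Kk f Lf; have [LKg Eg] := Kk g Lg.
    have [LKK E'] := Kk _ LK.
    rewrite !(innerE (H := H))// E' E Eg.
    have [_ _ kJ] : complex_operator k.
      have [k' Kk' [lk' bk' kJ']] := bounded_operator_acts bK.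
      have -> : k = k'; last by [].
      apply/funext => u; have [h Lh ->] := l2P u.
      by have [_ <-] := Kk h Lh; have [_ <-] := Kk' h Lh.
    by rewrite -kJ !(kself (k (cls f))).
have [t tE] : exists t : R, (\esum_(e in B) (complex.Re (inner mu (K e) e))%:E <= t%:E)%E.
  exists (fine (trace_norm mu K)).
  have le : (\esum_(e in B) (complex.Re (inner mu (K e) e))%:E <= trace_norm mu K)%E.
    by apply: ereal_sup_ubound; exists K, B.
  rewrite fineK//; rewrite ge0_fin_numE//; apply: le_trans le.
  apply: esum_ge0 => e Be; rewrite lee_fin.
  have Le := BL _ Be; have [LK E] := Kk e Le.
  by rewrite (innerE (H := H))// E kk ip_ge0.
pose P b := exists2 e, B e & cls e = b.
have sumB (s : seq H) : uniq s -> (forall b, b \in s -> P b) ->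
    \sum_(b <- s) ip (S b) (S b) <= t.
  move=> us sB; pose pre b := xget (cst 0) [set e | B e /\ cls e = b].
  have preP b : b \in s -> B (pre b) /\ cls (pre b) = b.
    by move=> /sB[e Be eb]; apply: (@xgetPex _ (cst 0) [set e | B e /\ cls e = b]); exists e.
  pose r := [seq pre b | b <- s].
  have ur : uniq r.
    rewrite map_inj_in_uniq// => b b' bs b's bb'.
    by rewrite -(preP b bs).2 bb' (preP b' b's).2.
  have rB e : e \in r -> B e by move=> /mapP[b /preP[? _] ->].
  rewrite -lee_fin; apply: le_trans tE.
  apply: (@le_trans _ _ (\sum_(e \in [set` r]) (complex.Re (inner mu (K e) e))%:E)%E); last first.
    by apply: ereal_sup_ubound; exists [set` r] => //; split => //; exact: finite_seq.
  rewrite -fsbig_seq// sumEFin lee_fin big_map big_seq [leRHS]big_seq.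
  rewrite le_eqVlt; apply/orP; left; apply/eqP; apply: eq_bigr => b bs.
  have [Be be] := preP b bs; have Le := BL _ Be; have [LK E] := Kk _ Le.
  transitivity (ip (cls (K (pre b))) (cls (pre b))); first by rewrite E be kk.
  exact: (esym (congr1 (@complex.Re R) (innerE (H := H) LK Le))).
(* One [t] accounts for the elements of the complex basis, the other for their multiples by [i]. *)
exists (t + t); apply: (HS_of_basis (real_basisP oB) (adjC SS')) => s [us sB].
rewrite (bigID (fun b => `[< P b >])) /= -big_filter -[X in _ + X]big_filter.
apply: lerD.
  apply: sumB; first exact: filter_uniq.
  by move=> b; rewrite mem_filter => /andP[/asboolP].
(* Here [b = J c] with [c] the class of an element of [B]. As [- J b = c] and [S] commutes with the
   isometry [J], the sum is one over classes of elements of [B]. *)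
set r := [seq b <- s | ~~ `[< P b >]].
have -> : \sum_(b <- r) ip (S b) (S b) =
    \sum_(c <- [seq - J b | b <- r]) ip (S c) (S c).
  rewrite big_map; apply: eq_bigr => b _.
  by rewrite (linN _ (adj_lin SS')) ipNl ipNr opprK SJ ip_JJ.
apply: sumB.
  rewrite map_inj_uniq; first exact: filter_uniq.
  by move=> b b' /oppr_inj/(congr1 (@J _ _ _ _ H)); rewrite !JJ => /oppr_inj.
move=> _ /mapP[b br ->]; move: br; rewrite mem_filter => /andP[/asboolP nP bs].
have [[e Be eb]|[_ [e Be <-] <-]] := sB b bs; first by case: nP; exists e.
by exists e => //; rewrite JJ opprK.
Qed.

End Traces.

(** * Projections onto weighted subspaces *)

Section Subspaces.
Context d (T : measurableType d) (R : realType).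
Context {mu : {measure set T -> \bar R}} {H : l2_space mu}.
Local Notation C := R[i].
Local Notation F := (T -> C).
Local Notation L2 := (L2 mu).
Local Notation cls := (@cls d T R mu H).
Local Notation mulf := Defs.mulf.
Implicit Types (f g e : F) (u : H) (K A : F -> F) (k a : H -> H) (V L : set F).

Definition classes V : set H := [set u | V (rep u)].

Lemma classesP V f : is_subspace mu V -> L2 f -> classes V (cls f) <-> V f.
Proof.
move=> [Vm _ _ Vae] Lf; split => Vf.
  by apply: (Vae _ _ Vf (L2_cm Lf)); exact: rep_cls.
by apply: (Vae _ _ Vf (L2_cm (L2_rep _))); apply: ae_sym; exact: rep_cls.
Qed.

Lemma subspaceZ V (a : C) f : is_subspace mu V -> V f -> V (fun x => a * f x).
Proof.
move=> [_ V0 VD _] Vf; have := VD a _ _ Vf V0.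
by congr V; apply/funext => x; rewrite addr0.
Qed.

Lemma subspaceD V f g : is_subspace mu V -> V f -> V g -> V (fun x => f x + g x).
Proof.
move=> [_ V0 VD _] Vf Vg; have := VD 1 _ _ Vf Vg.
by congr V; apply/funext => x; rewrite mul1r.
Qed.

Lemma subspace_sum V I (r : seq I) (P : pred I) (v : I -> F) :
  is_subspace mu V -> (forall i, P i -> V (v i)) ->
  V (fun x => \sum_(i <- r | P i) v i x).
Proof.
move=> sV Vv; elim: r => [|i r IH].
  by under eq_fun do rewrite big_nil; case: sV.
have [Pi|nPi] := boolP (P i); last first.
  by under eq_fun do rewrite big_cons (negbTE nPi).
under eq_fun do rewrite big_cons Pi.
by apply: subspaceD => //; exact: Vv.
Qed.

Section Projection.
Variables (V : set F) (K : F -> F).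
Hypotheses (sV : is_subspace mu V) (VL2 : V `<=` L2).
Hypothesis VK : orthogonal_projection mu V K.

Lemma classes_submod : submod (classes V).
Proof.
split.
  by have := (classesP sV (L2_0 mu)).2; rewrite cls0; apply; case: sV.
move=> a u v Vu Vv; rewrite -(clsK u) -(clsK v).
have Lu := L2_rep u; have Lv := L2_rep v.
rewrite clsZ// clsD//; last exact: L2Z.
apply/classesP => //; first by apply: L2D => //; exact: L2Z.
by case: sV => _ _ + _; apply.
Qed.

Lemma classes_J u : classes V u -> classes V (J u).
Proof.
move=> Vu; rewrite -(clsK u) J_cls; last exact: L2_rep.
apply/classesP => //; first by apply: L2Z; exact: L2_rep.
exact: subspaceZ.
Qed.

(** [orthogonal_projection] asks for neither linearity nor boundedness of [K]: both follow from the
    orthogonality relations. Complex linearity follows because [V] is stable under [i]. *)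
Lemma projection_acts :
  exists k, [/\ acts K k, projector (classes V) k & complex_operator k].
Proof.
pose k u := cls (K (rep u)).
have orth f y : L2 f -> classes V y -> ip (cls f - cls (K f)) y = 0.
  move=> Lf Vy; have [VKf KfV] := VK Lf.
  have LKf := VL2 VKf; rewrite clsB// -(clsK y) ip_cls; last 2 first.
  - exact: L2B.
  - exact: L2_rep.
  have := KfV _ Vy; rewrite (innerE (H := H)); [|exact: L2B|exact: L2_rep].
  by move=> [+ _]; rewrite ip_cls//; [exact: L2B|exact: L2_rep].
have kV : projector (classes V) k.
  split => [u|u y Vy].
    have [VKu _] := VK (L2_rep u); by apply/classesP => //; exact: VL2.
  by rewrite -{1}(clsK u); apply: orth => //; exact: L2_rep.
have sub := classes_submod.
exists k; split => //.
- move=> f Lf; have [VKf _] := VK Lf; have LKf := VL2 VKf; split => //.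
  apply: esym; apply: (projector_unique sub kV).
    exact/classesP.
  by move=> y; exact: orth.
- have kk := projector_adj kV; split; first exact: adj_lin kk.
    by exists 1; exact: projector_bnd kV.
  apply: (projector_commute sub kV J_adj); first exact: classes_J.
  by move=> u /classes_J Vu; rewrite -scaleN1r; exact: submodZ.
Qed.

End Projection.

Lemma classes_closed V : closed_subspace mu V -> hclosed (classes V).
Proof.
move=> [sV VL2 cV]; split; first exact: classes_submod.
move=> u uV; apply: cV; first exact: L2_rep.
move=> e /uV[v Vv uv]; exists (rep v) => //.
rewrite (L2normE (H := H)) -?clsB ?clsK//; try exact: L2_rep.
by apply: L2B; exact: L2_rep.
Qed.

(* If [h ^ 2 + s ^ 2 = 1] then [|h u| ^ 2 = |u| ^ 2 - |s u| ^ 2], and [s Q] is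
   Hilbert-Schmidt when [s Q s] is trace class. *)
Lemma bounded_below_sandwich L Q (h s : T -> R) :
  closed_subspace mu L -> orthogonal_projection mu L Q ->
  contractive h -> contractive s -> (forall x, h x ^+ 2 + s x ^+ 2 = 1) ->
  trace_class mu (sandwich s Q) ->
  (forall f, L f -> mulf h f = cst 0 %[ae mu] -> f = cst 0 %[ae mu]) ->
  bounded_below (classes L) (Mul h).
Proof.
move=> cL LQ ch cs hs tQ inj.
have [sL LL2 _] := cL.
have [q [Qq pq [lq [M bq] qJ]]] := projection_acts sL LL2 LQ.
have qq := projector_adj pq.
have [c HSc] : exists c, HS (Mul s \o q) c.
  apply: (trace_class_HS (S := q \o Mul s) tQ (acts_sandwich cs Qq)).
  - exact: adj_comp qq (Mul_adj cs).
  - by move=> u /=; rewrite (projector_idem (classes_submod sL) pq).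
  - by move=> u /=; rewrite Mul_J.
apply: (bounded_below_HS (classes_closed cL) (Mul_lin ch) (Mul_bnd ch) _ HSc).
- exact: lin_comp (Mul_lin cs) lq.
- move=> u Lu /=; rewrite (projector_id (classes_submod sL) pq Lu).
  have [f Lf ->] := l2P u; rewrite !Mul_cls//.
  have [Lsf Lhf] := (L2_mulf cs Lf, L2_mulf ch Lf).
  rewrite !ip_cls// /rin -RintegralD//; try exact: integrable_rin.
  apply: eq_Rintegral => x _; rewrite !partsE -[LHS]mul1r -(hs x); ring.
- move=> u; have [f Lf ->] := l2P u => /(classesP sL Lf) Vf.
  rewrite Mul_cls// -cls0 => /(cls_eqP (L2_mulf ch Lf) (L2_0 mu)) hf0.
  by apply: cls_ae => //; [exact: L2_0|exact: inj].
Qed.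

Section FiniteExtension.
Variables (L V : set F) (h : T -> R).
Hypotheses (sL : is_subspace mu L) (LL2 : L `<=` L2).
Hypotheses (sV : is_subspace mu V) (ch : contractive h).
Hypothesis hV : mulS mu h V `<=` L2.
Variables (k : nat) (v : nat -> F).
Hypothesis vV : forall i, V (v i).
Hypothesis Vv : forall f, V f -> exists c : nat -> R,
  f = (fun x => \sum_(i < k) real_complex R (c i) * v i x) %[ae mu].

Lemma L2_mulf_subspace f : V f -> L2 (mulf h f).
Proof.
move=> Vf; apply: hV; have [Vm _ _ _] := sV; split.
  by apply: cmeasurable_mulf; [case: ch|exact: Vm].
by exists f => //; exact: ae_refl.
Qed.

Lemma cls_mulf_sum (c : nat -> R) :
  \sum_(i < k) c i *: cls (mulf h (v i)) =
  cls (mulf h (fun x => \sum_(i < k) real_complex R (c i) * v i x)).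
Proof.
under eq_bigr do rewrite (clsZ _ _ (L2_mulf_subspace (vV _))).
rewrite (@cls_sum _ _ _ _ H _ _ (fun (i : 'I_k) x => real_complex R (c i) * mulf h (v i) x)).
  congr cls; apply/funext => x; rewrite /Defs.mulf mulr_sumr.
  by apply: eq_bigr => i _; rewrite mulrCA.
by move=> i; apply: L2Z; exact: L2_mulf_subspace.
Qed.

Lemma mulS_addS_classes u : classes (mulS mu h (addS mu L V)) u <->
  exists l (c : nat -> R), [/\ classes L l &
    u = Mul h l + \sum_(i < k) c i *: cls (mulf h (v i))].
Proof.
have [[Lm _ _ _] [Vm _ _ _]] := (sL, sV); split.
  move=> [mu_ [f [mf [l [w [Ll Vw fE]]] uE]]].
  have [c wE] := Vv Vw; exists (cls l), c.
  split; first by apply/classesP => //; exact: LL2.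
  rewrite Mul_cls//; last exact: LL2.
  have Vs : V (fun x => \sum_(i < k) real_complex R (c i) * v i x).
    by apply: subspace_sum => // i _; exact: subspaceZ.
  have Lhl := L2_mulf ch (LL2 Ll); have Lhw := L2_mulf_subspace Vs.
  rewrite cls_mulf_sum clsD// -{1}(clsK u).
  apply: cls_ae; [exact: L2_rep|exact: L2D|].
  apply: ae_trans uE _; rewrite /Defs.mulf.
  apply: ae_trans (ae_map (fun x z => real_complex R (h x) * z) fE) _.
  apply: ae_trans (ae_map (fun x z => real_complex R (h x) * (l x + z)) wE) _.
  by apply: aeW => x _; rewrite mulrDr.
move=> [l [c [Ll ->]]].
have Vs : V (fun x => \sum_(i < k) real_complex R (c i) * v i x).
  by apply: subspace_sum => // i _; exact: subspaceZ.
have Lhl := L2_mulf ch (L2_rep l); have Lhw := L2_mulf_subspace Vs.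
rewrite -(clsK l) Mul_cls ?cls_mulf_sum ?clsD//; last exact: L2_rep.
split; first exact: L2_cm (L2_rep _).
exists (fun x => rep l x + \sum_(i < k) real_complex R (c i) * v i x).
  split; first by apply: cmeasurableD; [exact: L2_cm (L2_rep _)|exact: Vm].
  exists (rep l), (fun x => \sum_(i < k) real_complex R (c i) * v i x).
  by split => //; exact: ae_refl.
apply: ae_trans (rep_cls H (L2D Lhl Lhw)) _.
by apply: aeW => x _; rewrite /Defs.mulf mulrDr.
Qed.

Lemma mulS_addS_subspace : is_subspace mu (mulS mu h (addS mu L V)).
Proof.
have [[Lm L0 LD _] [Vm V0 VD _]] := (sL, sV); split.
- by move=> f [].
- split; first exact: cmeasurable_cst.
  exists (cst 0); last by apply: aeW => x _; rewrite /Defs.mulf mulr0.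
  split; first exact: cmeasurable_cst.
  by exists (cst 0), (cst 0); split => //; apply: aeW => x _; rewrite addr0.
- move=> a f g [mf [f' [mf' [l [w [Ll Vw f'E]]] fE]]]
    [mg [g' [mg' [l' [w' [Ll' Vw' g'E]]] gE]]].
  split; first by apply: cmeasurableD => //; exact: cmeasurableZ.
  exists (fun x => a * f' x + g' x).
    split; first by apply: cmeasurableD => //; exact: cmeasurableZ.
    exists (fun x => a * l x + l' x), (fun x => a * w x + w' x).
    split; [exact: LD|exact: VD|].
    apply: ae_trans (ae_map2 (fun=> fun z z' => a * z + z') f'E g'E) _.
    by apply: aeW => x _; rewrite mulrDr addrACA.
  apply: ae_trans (ae_map2 (fun=> fun z z' => a * z + z') fE gE) _.
  by apply: aeW => x _; rewrite /Defs.mulf mulrDr mulrCA.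
- move=> f g [mf [f' Ff' fE]] mg fg; split => //; exists f' => //.
  exact: ae_trans (ae_sym fg) fE.
Qed.

Lemma mulS_addS_L2 : mulS mu h (addS mu L V) `<=` L2.
Proof.
have [[Lm _ _ _] [Vm _ _ _]] := (sL, sV).
move=> f [mf [f' [mf' [l [w [Ll Vw f'E]]] fE]]].
have Lhl := L2_mulf ch (LL2 Ll); have Lhw := L2_mulf_subspace Vw.
apply: (L2_ae mf (L2D Lhl Lhw)); apply: ae_sym; apply: ae_trans fE _.
apply: ae_trans (ae_map (fun x z => real_complex R (h x) * z) f'E) _.
by apply: aeW => x _; rewrite /Defs.mulf mulrDr.
Qed.

(** The image [h L] admits projections because [h] is bounded below on [L]. This survives the
    addition of the finitely many vectors [h v_i], and it implies closedness. *)
Lemma mulS_addS_closed : hclosed (classes L) -> bounded_below (classes L) (Mul h) ->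
  closed_subspace mu (mulS mu h (addS mu L V)).
Proof.
move=> cL bL; have sub := mulS_addS_subspace.
split => //; first exact: mulS_addS_L2.
move=> f Lf fa; apply/(classesP sub Lf).
have pr := projable_extends (fun i => cls (mulf h (v i))) k
  (projable_image cL (Mul_lin ch) (Mul_bnd ch) bL).
have [_ +] := projable_closed pr; set N := [set x | _] => cN.
have NE u : classes (mulS mu h (addS mu L V)) u <-> N u.
  split.
    by move=> /mulS_addS_classes[l [c [Ll ->]]]; exists (Mul h l), c; split => //; exists l.
  move=> [_ [c [[l Ll <-] ->]]]; apply/mulS_addS_classes; by exists l, c.
apply/NE; apply: cN => e /fa[g hVg fg].
have Lg := mulS_addS_L2 hVg.
exists (cls g); first by apply/NE/classesP.
by rewrite clsB// -(L2normE (H := H))//; exact: L2B.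
Qed.

End FiniteExtension.

End Subspaces.

(** * Real bases of a finite-dimensional space of functions *)

Section RealBasis.
Context d (T : measurableType d) (R : realType).
Variable mu : {measure set T -> \bar R}.
Local Notation C := R[i].
Local Notation F := (T -> C).
Implicit Types (V : set F) (v : nat -> F).

Definition real_span V k v := (forall i, V (v i)) /\
  forall f, V f -> exists c : nat -> R,
    f = (fun x => \sum_(i < k) real_complex R (c i) * v i x) %[ae mu].

Lemma real_span_exists V : is_subspace mu V -> finite_dimensional mu V ->
  exists k v, real_span V k v.
Proof.
move=> sV [m [v0 [Vv0 v0P]]].
(* The indices below [m] give the generators, the next [m] their multiples by [i]; beyond these the
   value is 0, which also lies in [V]. *)
pose v (j : nat) : F := if insub j is Some i then v0 (i : 'I_m)
  else if insub (j - m)%N is Some i then (fun x => 'i%C * v0 (i : 'I_m) x)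
  else cst 0.
exists (m + m)%N, v; split.
  move=> j; rewrite /v; case: insubP => [i _ _|_]; first exact: Vv0.
  by case: insubP => [i _ _|_]; [exact: subspaceZ sV (Vv0 i)|case: sV].
move=> f Vf; have [c fE] := v0P f Vf.
pose a (j : nat) : R := if insub j is Some i then complex.Re (c (i : 'I_m))
  else if insub (j - m)%N is Some i then complex.Im (c (i : 'I_m)) else 0.
exists a; apply: ae_trans fE _; apply: aeW => x _.
rewrite big_split_ord /= -big_split /=; apply: eq_bigr => i _.
rewrite /a /v valK insubN /=; last by rewrite -leqNgt leq_addr.
rewrite addKn valK mulrA -mulrDl; congr (_ * _).
by apply: complex_ext; rewrite !partsE; ring.
Qed.

(** A real spanning family of least length is free: a relation with [c i0] nonzero would express
    [v i0] through the others and shorten the family. *)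
Lemma real_basis_exists V : is_subspace mu V -> finite_dimensional mu V ->
  exists k v, real_span V k v /\ forall c : nat -> R,
    (fun x => \sum_(i < k) real_complex R (c i) * v i x) = cst 0 %[ae mu] ->
    forall i : 'I_k, c i = 0.
Proof.
move=> sV fV.
have ex : exists k, `[< exists v, real_span V k v >].
  by have [k [v vP]] := real_span_exists sV fV; exists k; apply/asboolP; exists v.
have [k /asboolP[v [Vv vP]] kmin] := ex_minnP ex.
exists k, v; split => // c c0 i0; apply: contrapT => /eqP ci0.
case: k => [|k] in vP kmin c0 i0 ci0 *; first by case: i0 {ci0}.
suff : (k.+1 <= k)%N by rewrite ltnn.
apply: kmin; apply/asboolP; exists (fun i => v (bump i0 i)).
split => // f Vf; have [a fE] := vP f Vf.
exists (fun i => a (bump i0 i) - a i0 / c i0 * c (bump i0 i)).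
apply: ae_trans fE _.
apply: filterS c0 => x /= /(_ I) cx _.
have -> : \sum_(i < k.+1) real_complex R (a i) * v i x =
    \sum_(i < k.+1) real_complex R (a i - a i0 / c i0 * c i) * v i x.
  transitivity (\sum_(i < k.+1) real_complex R (a i) * v i x -
      real_complex R (a i0 / c i0) * \sum_(i < k.+1) real_complex R (c i) * v i x).
    by rewrite cx mulr0 subr0.
  rewrite mulr_sumr -sumrB; apply: eq_bigr => i _.
  by rewrite mulrA -rmorphM -mulrBl -rmorphB.
rewrite (bigD1_ord i0)//= divfK// subrr mul0r add0r.
by apply: eq_bigr => i _.
Qed.

End RealBasis.

(** * The angle condition as a Cauchy-Schwarz inequality with constant below 1 *)

Section AngleBound.
Context d (T : measurableType d) (R : realType).
Context {mu : {measure set T -> \bar R}} {H : l2_space mu}.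
Local Notation C := R[i].
Local Notation F := (T -> C).
Local Notation L2 := (L2 mu).
Local Notation cls := (@cls d T R mu H).
Implicit Types (V W : set F).

(** A lower bound for the norm of [f + g] needs an upper bound for [- ip f g], so the angle
    condition is applied to [- f] and [g]. The constant depends on [alpha] alone and therefore
    serves all weights at once. *)
Lemma angle_bound (alpha : R) : 0 < alpha -> exists2 kappa : R, 0 <= kappa < 1 &
  forall V W, V `<=` L2 -> W `<=` L2 -> (forall f, V f -> V (fun x => - f x)) ->
  (alpha%:E <= angle mu V W)%E -> forall f g, V f -> W g ->
  - ip (cls f) (cls g) <= kappa * (hn (cls f) * hn (cls g)).
Proof.
move=> a0.
(* The maximum with 0 covers an obtuse [alpha]. For [alpha > pi] no pair of nonzero vectors
   satisfies the condition, since [acos] is at most [pi]. *)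
exists (if alpha <= pi then Num.max 0 (cos alpha) else 0).
  case: ifPn => [api|_]; last by rewrite lexx ltr01.
  rewrite le_max lexx /= gt_max ltr01 /=.
  rewrite -(cos0 R) ltr_cos// in_itv /=; first by rewrite pi_ge0 lexx.
  by rewrite (ltW a0) api.
move=> V W VL WL VN aVW f g Vf Wg.
have Lf := VL _ Vf; have Lg := WL _ Wg.
have [f0|f0] := eqVneq (cls f) 0.
  by rewrite f0 ip0l hn0 mul0r mulr0 oppr0.
have [g0|g0] := eqVneq (cls g) 0.
  by rewrite g0 ip0r hn0 !mulr0 oppr0.
have hf := hn_gt0 (elimN eqP f0); have hg := hn_gt0 (elimN eqP g0).
pose r := - ip (cls f) (cls g) / (hn (cls f) * hn (cls g)).
have fg0 : 0 < hn (cls f) * hn (cls g) by rewrite mulr_gt0.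
rewrite -ler_pdivrMr// -/r.
have r1 : -1 <= r <= 1.
  rewrite -ler_norml normrM normrN (ger0_norm (_ : 0 <= _^-1)) ?invr_ge0 ?(ltW fg0)//.
  by rewrite ler_pdivrMr// mul1r ip_le.
have LNf := L2N Lf.
have clsNf : cls (fun x => - f x) = - cls f by rewrite clsN.
have ar : alpha <= acos r.
  rewrite -lee_fin; apply: le_trans aVW _; apply: ereal_inf_lbound.
  exists (fun x => - f x), g; split.
  - split; first exact: VN.
    move=> /(cls_eqP (H := H) LNf (L2_0 mu)); rewrite clsNf cls0 => /eqP.
    by rewrite oppr_eq0; exact/negP.
  - split => // /(cls_eqP (H := H) Lg (L2_0 mu)); rewrite cls0 => /eqP.
    exact/negP.
  - rewrite /vector_angle !(L2normE (H := H))// (innerE (H := H))//= clsNf.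
    by rewrite ipNl hnN.
have acr : acos r \in `[0, pi] by rewrite in_itv /= acos_ge0//= acos_lepi.
have api : alpha <= pi by apply: le_trans ar _; exact: acos_lepi.
rewrite api le_max; apply/orP; right.
have {}r1 : r \in `[-1, 1] by rewrite in_itv.
rewrite -[leLHS](acosK r1) leNgt ltr_cos//; last by rewrite in_itv /= (ltW a0).
by rewrite -leNgt.
Qed.

End AngleBound.

Section Indicator.
Context d (T : measurableType d) (R : realType).

Lemma contractive_indic (B : set T) : measurable B ->
  contractive (\1_B : T -> R).
Proof.
move=> mB; split => [|x]; first exact: measurable_indic.
by rewrite indicE; case: (_ \in _); rewrite ?normr1 ?normr0.
Qed.

End Indicator.

(** * Local convergence of the weighted projections *)

Section Convergence.
Context d (T : measurableType d) (R : realType).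
Context {mu : {measure set T -> \bar R}} {H : l2_space mu}.
Local Notation C := R[i].
Local Notation F := (T -> C).
Local Notation L2 := (L2 mu).
Local Notation cls := (@cls d T R mu H).
Local Notation mulf := Defs.mulf.
Local Notation classes := (@classes d T R mu H).
Implicit Types (u : H).

Variables (L V : set F) (Q : F -> F) (q : H -> H).
Hypotheses (cL : closed_subspace mu L) (Qq : acts Q q).
Hypotheses (pq : projector (classes L) q) (cq : complex_operator q).
Hypotheses (sV : is_subspace mu V).
Hypothesis V_cap_L2 : forall f, (V `&` L2) f -> f = cst 0 %[ae mu].
Variables (k : nat) (v : nat -> F).
Hypothesis vP : real_span mu V k v.
Hypothesis v_free : forall c : nat -> R,
  (fun x => \sum_(i < k) real_complex R (c i) * v i x) = cst 0 %[ae mu] ->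
  forall i : 'I_k, c i = 0.
Variable X : nat -> set T.
Hypotheses (mX : forall j, measurable (X j)) (ndX : nondecreasing_seq X).
Hypotheses (Xx : forall x, exists j, X j x).
Hypothesis VX : forall f, V f -> forall j, L2 (mulf \1_(X j) f).
Variable h : nat -> T -> R.
Hypotheses (ch : forall n, contractive (h n)) (h_gt0 : forall n x, 0 < h n x).
Hypothesis h_cvg : forall j (e : R), 0 < e -> exists n0, forall n, (n0 <= n)%N ->
  forall x, X j x -> `|h n x - 1| <= e.
Hypothesis hV : forall n, mulS mu (h n) V `<=` L2.
Variables (c1 : R) (kappa : R).
Hypotheses (c1_gt0 : 0 < c1) (kappa01 : 0 <= kappa < 1).
Hypothesis h_below : forall n u, classes L u -> c1 * hn u <= hn (Mul (h n) u).
Hypothesis h_angle : forall n u f, classes L u -> V f ->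
  - ip (Mul (h n) u) (cls (mulf (h n) f)) <=
    kappa * (hn (Mul (h n) u) * hn (cls (mulf (h n) f))).
Variable pin : nat -> H -> H.
Hypothesis pinP : forall n, projector (classes (mulS mu (h n) (addS mu L V))) (pin n).

Let sL : is_subspace mu L. Proof. by case: cL. Qed.
Let LL2 : L `<=` L2. Proof. by case: cL. Qed.
Let vV : forall i, V (v i). Proof. by case: vP. Qed.
Let Vv : forall f, V f -> exists c : nat -> R,
  f = (fun x => \sum_(i < k) real_complex R (c i) * v i x) %[ae mu].
Proof. by case: vP. Qed.
Let sLc : submod (classes L) := classes_submod sL.
Let cX j : contractive (\1_(X j) : T -> R) := contractive_indic R (mX j).

Definition wn n i : H := cls (mulf (h n) (v i)).

Lemma comb_subspace (c : nat -> R) :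
  V (fun x => \sum_(i < k) real_complex R (c i) * v i x).
Proof. by apply: (subspace_sum _ sV) => i _; exact: subspaceZ sV (vV i). Qed.

Lemma classes_sum_wn n (c : nat -> R) : \sum_(i < k) c i *: wn n i =
  cls (mulf (h n) (fun x => \sum_(i < k) real_complex R (c i) * v i x)).
Proof. exact: (cls_mulf_sum sV (ch n) (@hV n) _ vV). Qed.

(** The angle condition contributes [(1 - kappa)^(-1/2)] for each of the two pieces, and [c1^-1] is
    the cost of undoing the weight on [L]. *)
Definition bound : R := Num.max c1^-1 1 / Num.sqrt (1 - kappa).

Lemma bound_ge0 : 0 <= bound.
Proof. by rewrite divr_ge0 ?sqrtr_ge0// le_max ler01 orbT. Qed.

(** With [a = h u], the angle bound and [2 |a| |w| <= |a|^2 + |w|^2] give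
    [(1 - kappa) (|a|^2 + |w|^2) <= |a + w|^2]. *)
Lemma pieces_bound n u (c : nat -> R) : classes L u ->
  let y := Mul (h n) u + \sum_(i < k) c i *: wn n i in
  hn u <= bound * hn y /\ hn (\sum_(i < k) c i *: wn n i) <= bound * hn y.
Proof.
move=> Lu y; have [k0 k1] := andP kappa01.
set w := \sum_(i < k) _ in y *; set a := Mul (h n) u in y *.
have aw : - ip a w <= kappa * (hn a * hn w).
  by rewrite /w classes_sum_wn; apply: h_angle => //; exact: comb_subspace.
have k1' : 0 < 1 - kappa by rewrite subr_gt0.
have yy : (1 - kappa) * (hn a ^+ 2 + hn w ^+ 2) <= hn y ^+ 2.
  rewrite [leRHS]hn2 /y ip_hnD -!hn2.
  have := sqr_ge0 (hn a - hn w).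
  have -> : (hn a - hn w) ^+ 2 = hn a ^+ 2 - 2 * (hn a * hn w) + hn w ^+ 2 by ring.
  move=> h1.
  have h2 : kappa * (2 * (hn a * hn w)) <= kappa * (hn a ^+ 2 + hn w ^+ 2).
    by apply: ler_wpM2l => //; lra.
  rewrite mulrBl mul1r; lra.
have sk : 0 < Num.sqrt (1 - kappa) by rewrite sqrtr_gt0.
have base z : hn z ^+ 2 <= hn a ^+ 2 + hn w ^+ 2 ->
    hn z <= (Num.sqrt (1 - kappa))^-1 * hn y.
  move=> hz; rewrite mulrC ler_pdivlMr//.
  rewrite -(@ler_pXn2r _ 2)// ?nnegrE ?mulr_ge0 ?hn_ge0 ?sqrtr_ge0//.
  rewrite exprMn [Num.sqrt (1 - kappa) ^+ 2]sqr_sqrtr ?(ltW k1')// mulrC; apply: le_trans yy.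
  by rewrite ler_pM2l.
have B1 : (Num.sqrt (1 - kappa))^-1 <= bound.
  by rewrite /bound -[leLHS]mul1r ler_wpM2r ?invr_ge0 ?sqrtr_ge0// le_max lexx orbT.
split; last first.
  apply: (@le_trans _ _ ((Num.sqrt (1 - kappa))^-1 * hn y)).
    by apply: base; rewrite lerDr sqr_ge0.
  by rewrite ler_wpM2r ?hn_ge0.
have ha : hn a <= (Num.sqrt (1 - kappa))^-1 * hn y.
  by apply: base; rewrite lerDl sqr_ge0.
apply: (@le_trans _ _ (c1^-1 * hn a)).
  by rewrite ler_pdivlMl//; exact: h_below.
apply: (@le_trans _ _ (c1^-1 * ((Num.sqrt (1 - kappa))^-1 * hn y))).
  by rewrite ler_wpM2l ?invr_ge0 ?(ltW c1_gt0).
rewrite mulrA ler_wpM2r ?hn_ge0// /bound ler_wpM2r ?invr_ge0 ?sqrtr_ge0//.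
by rewrite le_max lexx.
Qed.

(** The two pieces of [pin n x] are picked by choice. [pieces_bound], applied to a combination whose
    total is 0, shows that they are unique, and hence linear in [x]. *)
Lemma decomposition n : exists l w : H -> H,
  [/\ lin l /\ bnd bound l, lin w /\ bnd bound w,
      forall x, pin n x = Mul (h n) (l x) + w x,
      forall x, classes L (l x) &
      forall x, exists c : nat -> R, w x = \sum_(i < k) c i *: wn n i].
Proof.
have chn := ch n; have hVn := @hV n.
have mem u := mulS_addS_classes sL LL2 sV chn hVn vV Vv u.
have dec x : exists lc : H * (nat -> R), classes L lc.1 /\
    pin n x = Mul (h n) lc.1 + \sum_(i < k) lc.2 i *: wn n i.
  by have /mem[l [c [Ll E]]] := (pinP n).1 x; exists (l, c).
have [lc lcP] := choice dec.
pose l x := (lc x).1; pose w x := \sum_(i < k) (lc x).2 i *: wn n i.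
have sub := classes_submod (mulS_addS_subspace (h n) sL sV).
have lpin : lin (pin n) := adj_lin (projector_adj (pinP n)).
have bpin := projector_bnd (pinP n).
have both a x y : l (a *: x + y) = a *: l x + l y /\ w (a *: x + y) = a *: w x + w y.
  pose u := l (a *: x + y) - (a *: l x + l y).
  pose c i := (lc (a *: x + y)).2 i - (a * (lc x).2 i + (lc y).2 i).
  have Lu : classes L u.
    apply: submodB => //; first exact: (lcP _).1.
    by case: sLc => _; apply; exact: (lcP _).1.
  have cE : \sum_(i < k) c i *: wn n i = w (a *: x + y) - (a *: w x + w y).
    rewrite /w scaler_sumr -big_split -sumrB; apply: eq_bigr => i _.
    by rewrite /c /= scalerBl scalerDl scalerA.
  have lM := Mul_lin (H := H) chn.
  have E0 : Mul (h n) u + \sum_(i < k) c i *: wn n i = 0.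
    rewrite cE /u (linB _ _ lM) lM addrACA -opprD -(lcP _).2 addrACA -scalerDr.
    by rewrite -(lcP x).2 -(lcP y).2 lpin subrr.
  have [] := pieces_bound n c Lu; rewrite E0 hn0 mulr0 => h1 h2.
  have zero z : hn z <= 0 -> z = 0 :> H.
    by move=> hz; apply: hn_eq0; apply/le_anti; rewrite hz hn_ge0.
  split; apply/eqP; rewrite -subr_eq0; apply/eqP; first exact: zero.
  by rewrite -cE; exact: zero.
exists l, w; split.
- split; first by move=> a x y; exact: (both a x y).1.
  move=> x; have [+ _] := pieces_bound n (lc x).2 (lcP x).1.
  rewrite -(lcP x).2 => h1; apply: le_trans h1 _.
  by apply: ler_wpM2l bound_ge0 _ _ _; have := bpin x; rewrite mul1r.
- split; first by move=> a x y; exact: (both a x y).2.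
  move=> x; have [_] := pieces_bound n (lc x).2 (lcP x).1.
  rewrite -(lcP x).2 => h1; apply: le_trans h1 _.
  by apply: ler_wpM2l bound_ge0 _ _ _; have := bpin x; rewrite mul1r.
- by move=> x; exact: (lcP x).2.
- by move=> x; exact: (lcP x).1.
- by move=> x; exists (lc x).2.
Qed.

Definition zj j i : H := cls (mulf \1_(X j) (v i)).

Lemma classes_sum_zj j (c : nat -> R) : \sum_(i < k) c i *: zj j i =
  cls (mulf \1_(X j) (fun x => \sum_(i < k) real_complex R (c i) * v i x)).
Proof.
have hVj : mulS mu \1_(X j) V `<=` L2.
  move=> f [mf [f' Vf' fE]]; apply: (L2_ae mf (VX Vf' j)); exact: ae_sym.
exact: (cls_mulf_sum sV (cX j) hVj _ vV).
Qed.

(** If the norms over the sets [X j] of a fixed combination stayed bounded, it would be square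
    integrable by [L2_exhaustion], hence zero because [V] meets L2 trivially, and its coefficients
    would vanish by freeness. *)
Lemma zj_unbounded M : exists j, forall (c : nat -> R) (i : 'I_k),
  M * `|c i| <= hn (\sum_(i < k) c i *: zj j i).
Proof.
apply: unbounded_finite_dim.
  move=> c i j /ndX/subsetPset ij; rewrite !classes_sum_zj.
  have Vc := comb_subspace c.
  rewrite -[leRHS]mul1r; apply: hn_cls_le => //; try exact: VX.
  move=> x; rewrite expr1n mul1r !cabs2M !cabs2C ler_wpM2r ?cabs2_ge0//.
  rewrite !indicE; have [xi|xi] := boolP (x \in X i).
    by rewrite mem_set//; apply: ij; rewrite inE in xi.
  by rewrite expr0n sqr_ge0.
move=> c [i ci] B; apply: contrapT => nB.
have Vc := comb_subspace c; set f := (fun x => _) in Vc.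
have fL2 : L2 f.
  have B0 : 0 <= B.
    rewrite leNgt; apply/negP => B0; apply: nB; exists 0%N.
    by apply: lt_le_trans B0 (hn_ge0 _).
  apply: (@L2_exhaustion _ _ _ _ H X f (B ^+ 2)) => //.
  - by case: sV => Vm _ _ _; exact: Vm.
  - exact: VX.
  - move=> j; rewrite -hn2 ler_pXn2r ?nnegrE ?hn_ge0//.
    rewrite -classes_sum_zj leNgt; apply/negP => Bj; apply: nB; exists j.
    exact: Bj.
by have := v_free (V_cap_L2 (conj Vc fL2)) i => c0; rewrite c0 eqxx in ci.
Qed.

(* As V meets L2 trivially, the norm of a vector of V on [X j'] tends to infinity
   with [j'], uniformly on the unit sphere of the coefficients. *)
Lemma wn_local j (e : R) : 0 < e -> exists n0, forall n, (n0 <= n)%N ->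
  forall c : nat -> R, hn (Mul \1_(X j) (\sum_(i < k) c i *: wn n i)) <=
    e * hn (\sum_(i < k) c i *: wn n i).
Proof.
move=> e0; pose D := \sum_(i < k) hn (zj j i).
have D0 : 0 <= D by apply: sumr_ge0 => i _; exact: hn_ge0.
(* On [X j'] the weight [h n] is at least 1/2 for large [n], so each coefficient is at most
   [2 |w| / M]. The part of [w] on [X j] is at most [D] times the largest coefficient, which this
   [M] brings below [e * |w|]. *)
pose M := 2 * (D + 1) / e.
have M0 : 0 < M by rewrite divr_gt0// mulr_gt0// ltr_wpDl.
have [j' j'P] := zj_unbounded M.
have [|n0 n0P] := @h_cvg j' 2^-1; first by rewrite invr_gt0.
exists n0 => n n0n c; set w := \sum_(i < k) c i *: wn n i.
have Vc := comb_subspace c; have chn := ch n.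
have Lhf f : V f -> L2 (mulf (h n) f).
  exact: (L2_mulf_subspace sV chn (@hV n)).
have zw : hn (\sum_(i < k) c i *: zj j' i) <= 2 * hn w.
  rewrite classes_sum_zj /w classes_sum_wn; apply: hn_cls_le => //; [exact: VX|exact: Lhf|].
  move=> x; rewrite !cabs2M !cabs2C mulrA ler_wpM2r ?cabs2_ge0//.
  rewrite -exprMn ler_pXn2r ?nnegrE ?mulr_ge0 ?(ltW (h_gt0 _ _))//.
  rewrite indicE; have [xi|xi] := boolP (x \in X j'); last first.
    by rewrite mulr_ge0// ltW.
  rewrite inE in xi; have := n0P n n0n x xi; rewrite ler_norml -[true%:R]/(1 : R); lra.
have cw (i : 'I_k) : `|c i| <= M^-1 * (2 * hn w).
  by rewrite ler_pdivlMl//; apply: le_trans (j'P c i) zw.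
have small : hn (Mul \1_(X j) w) <= \sum_(i < k) `|c i| * hn (zj j i).
  rewrite /w (lin_sum _ _ (Mul_lin (cX j))).
  apply: le_trans (hn_sum _ _ _) _; apply: ler_sum => i _.
  rewrite (linZ _ _ (Mul_lin (cX j))) hnZ ler_wpM2l//.
  rewrite /wn Mul_cls//; last exact: Lhf.
  rewrite -[leRHS]mul1r; apply: hn_cls_le => //.
  - by apply: L2_mulf => //; exact: Lhf.
  - exact: VX.
  - move=> x; rewrite expr1n mul1r !cabs2M !cabs2C ler_wpM2l ?sqr_ge0//.
    rewrite ler_piMl ?cabs2_ge0// -real_normK ?num_real// expr_le1//.
    by case: chn.
apply: le_trans small _.
apply: (@le_trans _ _ (\sum_(i < k) M^-1 * (2 * hn w) * hn (zj j i))).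
  by apply: ler_sum => i _; rewrite ler_wpM2r ?hn_ge0.
rewrite -mulr_sumr -/D.
have -> : M^-1 * (2 * hn w) * D = D / (D + 1) * (e * hn w).
  by rewrite /M; field; rewrite ?gt_eqF// ltr_wpDl.
rewrite ler_piMl ?mulr_ge0 ?(ltW e0) ?hn_ge0//.
by rewrite ler_pdivrMr ?ltr_wpDl// mul1r lerDl.
Qed.

Section Bounded.
Variables (B : set T) (j0 : nat).
Hypotheses (mB : measurable B) (BX : B `<=` X j0).
Hypothesis tQ : trace_class mu (sandwich \1_B Q).

Let cB : contractive (\1_B : T -> R) := contractive_indic R mB.
Let qq : adj q q := projector_adj pq.
Let q2 x : q (q x) = q x := projector_idem sLc pq x.
Let bq : bnd 1 q := projector_bnd pq.

Lemma HS_qB : exists c, HS (fun x => q (Mul \1_B x)) c.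
Proof.
have SS : adj (q \o Mul \1_B) (Mul \1_B \o q) := adj_comp qq (Mul_adj cB).
have [c Sc] : exists c, HS (Mul \1_B \o q) c.
  apply: (trace_class_HS tQ (acts_sandwich cB Qq) SS).
    by move=> u /=; rewrite q2.
  by move=> u /=; case: cq => _ _ qJ; rewrite Mul_J.
by exists c; exact: HS_adj SS Sc.
Qed.

(** Used for each [n] separately, to see that the projections are locally trace class:
    [P Pi_n = h P Q l + P w], where the first term contains the Hilbert-Schmidt operator [P Q] and
    the second has finite rank. *)
Lemma HS_pinB n : exists c, HS (fun x => pin n (Mul \1_B x)) c.
Proof.
have [l [w [[ll bl] [lw bw] pE Ll wE]]] := decomposition n.
have [c Sc] := HS_qB.
have SS : adj (fun x => q (Mul \1_B x)) (fun x => Mul \1_B (q x)) :=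
  adj_comp qq (Mul_adj cB).
have h1 := HS_comp ll bl (adjC SS) Sc.
have h2 := HS_finite_rank lw bw wE.
have {}h1 : HS (fun x => Mul (h n) (Mul \1_B (l x))) (bound ^+ 2 * c).
  have := HSon_dom (C := 1) (S := fun x => Mul (h n) (Mul \1_B (l x))) ler01 h1.
  rewrite expr1n mul1r; apply => x _ /=; rewrite (projector_id sLc pq (Ll x)).
  exact: (Mul_bnd (ch n)).
have {}h2 : HS (fun x => Mul \1_B (w x)) (k%:R * bound ^+ 2).
  have := HSon_dom (C := 1) (S := fun x => Mul \1_B (w x)) ler01 h2.
  by rewrite expr1n mul1r; apply => x _; exact: (Mul_bnd cB).
exists (2 * (bound ^+ 2 * c) + 2 * (k%:R * bound ^+ 2)).
have SP : adj (fun x => pin n (Mul \1_B x)) (fun x => Mul \1_B (pin n x)) :=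
  adj_comp (projector_adj (pinP n)) (Mul_adj cB).
apply: (HS_adj SP); apply: eq_HSon (HSonD h1 h2) => x.
by rewrite pE (linD _ _ (Mul_lin cB)) (Mul_comm _ cB (ch n)).
Qed.

Lemma HS_pin_cvg : HS0 (fun n x => Mul \1_B (pin n x - q x)).
Proof.
have [c Sc] := HS_qB.
have [l lP] := choice decomposition; have [w wP] := choice lP.
apply: (@HS_projection_cvg _ _ q (Mul \1_B) (fun n => Mul (h n))
  (fun j => Mul \1_(X j)) pin l w wn c bound k 0 j0) => //.
- exact: Mul_adj.
- exact: Mul_bnd.
- by move=> n; exact: Mul_adj.
- by move=> n; exact: Mul_bnd.
- by move=> n; exact: Mul_adj.
- by move=> n; exact: Mul_bnd.
- by move=> n x; exact: Mul_comm.
- by move=> n j x; exact: Mul_comm.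
- move=> x; rewrite -[leRHS]mul1r; apply: hn_Mul_le => // t; rewrite mul1r !indicE.
  have [tB|_] := boolP (t \in B); last by rewrite normr0.
  by rewrite mem_set//; apply: BX; rewrite inE in tB.
- move=> x; apply: Mul_cvg => // t; have [j Xj] := Xx t.
  apply/cvgrPdist_le => e /(@h_cvg j)[n0 n0P]; exists n0 => // n /n0P/(_ t Xj).
  by rewrite distrC.
- move=> x; apply: Mul_cvg => // t; have [j Xj] := Xx t.
  apply: cvg_near_cst; exists j => // i ji /=; rewrite indicE mem_set//.
  by have /subsetPset := ndX ji; exact.
- move=> e e0; have [n0 n0P] := @h_cvg j0 e e0; exists n0 => n /n0P hn1 x.
  have [f Lf ->] := l2P x; have LB := L2_mulf cB Lf.
  have LhB := L2_mulf (ch n) LB.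
  rewrite (Mul_cls cB Lf) (Mul_cls (ch n) LB) clsB//.
  apply: hn_cls_le => //; [exact: ltW|exact: L2B|].
  move=> t; have -> : mulf \1_B f t - mulf (h n) (mulf \1_B f) t =
      mulf (fun t => 1 - h n t) (mulf \1_B f) t.
    by rewrite /Defs.mulf rmorphB rmorph1 mulrBl mul1r.
  rewrite !cabs2M !cabs2C indicE.
  have [tB|_] := boolP (t \in B); last by rewrite expr0n !(mul0r, mulr0).
  rewrite ler_wpM2r// ?mulr_ge0 ?sqr_ge0 ?cabs2_ge0//.
  rewrite -real_normK ?num_real// ler_pXn2r ?nnegrE ?(ltW e0)// distrC.
  by apply: hn1; apply: BX; rewrite inE in tB.
- exact: bound_ge0.
- move=> n _; have [a1 a2 a3 a4 a5] := wP n; split => //.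
    by move=> x; apply: (projector_id sLc pq).
  move=> x y; apply: (pinP n).2.
  apply/(mulS_addS_classes sL LL2 sV (ch n) (@hV n) vV Vv).
  exists (q y), (fun=> 0); split; first exact: pq.1.
  by rewrite big1 ?addr0// => i _; rewrite scale0r.
- by move=> n x; have [_ _ _ _] := wP n; apply.
- move=> j e /(wn_local j)[n0 n0P]; exists n0 => n /n0P hw x.
  by have [_ _ _ _ /(_ x)[a ->]] := wP n; exact: hw.
Qed.

(** [P Pi_n P = (P Pi_n) (Pi_n P)] is a product of two Hilbert-Schmidt operators. *)
Lemma trace_class_pinB n Pin : acts Pin (pin n) -> complex_operator (pin n) ->
  trace_class mu (sandwich \1_B Pin).
Proof.
move=> Pp cp; have aP := acts_sandwich cB Pp.
have cP : complex_operator (Mul \1_B \o pin n \o Mul \1_B).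
  have cM := complex_operator_Mul (H := H) cB.
  by apply: complex_operator_comp => //; exact: complex_operator_comp.
split; first exact: acts_bounded_operator aP cP.
have [c Sc] := HS_pinB n.
have lP : lin (Mul \1_B \o pin n \o Mul \1_B) by case: cP.
have pp := projector_adj (pinP n).
have p2 := projector_idem (classes_submod (mulS_addS_subspace (h n) sL sV)) (pinP n).
have SP : adj (fun x => pin n (Mul \1_B x)) (fun x => Mul \1_B (pin n x)) :=
  adj_comp pp (Mul_adj cB).
apply: le_lt_trans (ltry ((1 * c + 1^-1 * c) / 2)).
apply: (trace_norm_le aP lP) => s U os lU bU.
have := HS_pairing_contraction ltr01 os Sc SP (HS_adj (adjC SP) Sc) lU bU.
congr (_ <= _); apply: eq_bigr => x _ /=.
by rewrite -(adjC SP) /= p2.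
Qed.

Lemma trace_norm_pin_cvg (Pin : nat -> F -> F) :
  (forall n, acts (Pin n) (pin n)) -> (forall n, complex_operator (pin n)) ->
  trace_norm mu (sandwich \1_B (fun f x => Pin n f x - Q f x))
    @[n --> \oo] --> 0%E.
Proof.
move=> Pp cp; have [c Sc] := HS_qB; have c0 := HSon_ge0 Sc.
have act n : acts (sandwich \1_B (fun f x => Pin n f x - Q f x))
    (Mul \1_B \o (fun u => pin n u - q u) \o Mul \1_B).
  exact: acts_sandwich (acts_sub (Pp n) Qq).
have adjd n : adj (fun u => pin n u - q u) (fun u => pin n u - q u).
  exact: adj_sub (projector_adj (pinP n)) qq.
have selfadj n : adj (Mul \1_B \o (fun u => pin n u - q u) \o Mul \1_B)
    (Mul \1_B \o (fun u => pin n u - q u) \o Mul \1_B).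
  exact: adj_comp (adj_comp (Mul_adj cB) (adjd n)) (Mul_adj cB).
have cop n : complex_operator (Mul \1_B \o (fun u => pin n u - q u) \o Mul \1_B).
  have cM := complex_operator_Mul (H := H) cB.
  apply: complex_operator_comp => //; apply: complex_operator_comp => //.
  split; first exact: adj_lin (adjd n).
    exists 2 => u; apply: le_trans (hnB _ _) _.
    have := projector_bnd (pinP n) u; have := bq u; lra.
  move=> u; have [[_ _ pJ] [_ _ qJ]] := (cp n, cq).
  by rewrite pJ qJ (linB _ _ J_lin).
have ge0 n : (0 <= trace_norm mu (sandwich \1_B (fun f x => (Pin n f x - Q f x)%R)))%E.
  exact: trace_norm_ge0 (act n) (cop n) (selfadj n).
have le (e : R) : 0 < e -> exists n0, forall n, (n0 <= n)%N ->
    (trace_norm mu (sandwich \1_B (fun f x => (Pin n f x - Q f x)%R)) <= e%:E)%E.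
  move=> e0; pose M := 2 + 3 * c / 2.
  have M0 : 0 < M by rewrite /M; lra.
  (* [trace_diff_le] gives the bound [t * (t ^ 2 + 3 * c / 2 + 1)], which for [t <= 1] is at most
     [t * M]. *)
  pose t := Num.min 1 (e / M).
  have t0 : 0 < t by rewrite lt_min ltr01 divr_gt0.
  have [n0 n0P] := HS_pin_cvg (exprn_gt0 2 t0).
  exists n0 => n /n0P hD.
  apply: (trace_norm_le (act n) (adj_lin (selfadj n))) => s U os lU bU.
  have p2 := projector_idem (classes_submod (mulS_addS_subspace (h n) sL sV)) (pinP n).
  have := trace_diff_le (Mul_adj cB) qq (projector_adj (pinP n)) p2 q2 Sc t0 hD os lU bU.
  move=> /le_trans; apply.
  have t1 : t <= 1 by rewrite /t ge_min lexx.
  have te : t <= e / M by rewrite /t ge_min lexx orbT.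
  apply: (@le_trans _ _ (t * M)); last by rewrite -ler_pdivlMr.
  rewrite ler_wpM2l ?(ltW t0)// /M.
  have : t ^+ 2 <= 1 by rewrite expr_le1// ltW.
  lra.
apply/fine_cvgP; split.
  have [n0 n0P] := le 1 ltr01; exists n0 => // n /= /n0P h1.
  by rewrite ge0_fin_numE//; apply: le_lt_trans h1 (ltry _).
apply/cvgrPdist_le => e /le[n0 n0P]; exists n0 => // n /= /n0P h1.
rewrite sub0r normrN ger0_norm; last exact: fine_ge0.
by rewrite -lee_fin fineK// ge0_fin_numE//; apply: le_lt_trans h1 (ltry _).
Qed.

End Bounded.

End Convergence.

(** * The multipliers [sqrt g] and [sqrt (1 - g)] *)

Section Weights.
Context {d} {T : measurableType d} {R : realType}.
Variable g : T -> R.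
Hypotheses (mg : measurable_fun setT g) (g01 : forall x, 0 < g x <= 1).

Lemma contractive_sqrt (f : T -> R) : measurable_fun setT f ->
  (forall x, f x <= 1) -> contractive (fun x => Num.sqrt (f x)).
Proof.
move=> mf f1; split => [|x].
  apply: measurableT_comp => //; apply: continuous_measurable_fun.
  exact: sqrt_continuous.
rewrite ger0_norm ?sqrtr_ge0// -(sqrtr1 R); exact: ler_wsqrtr.
Qed.

Lemma contractive_sqrtg : contractive (fun x => Num.sqrt (g x)).
Proof. by apply: contractive_sqrt => // x; case/andP: (g01 x). Qed.

Lemma contractive_sqrt1g : contractive (fun x => Num.sqrt (1 - g x)).
Proof.
apply: contractive_sqrt => [|x]; first exact: measurable_funB.
by case/andP: (g01 x) => /ltW ? _; rewrite gerBl.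
Qed.

Lemma sqrtg_sum x : Num.sqrt (g x) ^+ 2 + Num.sqrt (1 - g x) ^+ 2 = 1.
Proof.
have /andP[/ltW g0 g1] := g01 x.
by rewrite !sqr_sqrtr ?subr_ge0// addrC subrK.
Qed.

Lemma sqrtg_dist x : `|Num.sqrt (g x) - 1| <= `|g x - 1|.
Proof.
have /andP[g0 g1] := g01 x.
have s1 : Num.sqrt (g x) <= 1 by rewrite -(sqrtr1 R); exact: ler_wsqrtr.
have s0 : 0 <= Num.sqrt (g x) by exact: sqrtr_ge0.
rewrite ler0_norm ?subr_le0// ler0_norm ?subr_le0// lerN2 lerD2r.
by rewrite -{1}(sqr_sqrtr (ltW g0)) expr2 ler_piMl.
Qed.

Lemma mulf_sqrt_eq0 (mu : {measure set T -> \bar R}) (f : T -> R[i]) :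
  Defs.mulf (fun x => Num.sqrt (g x)) f = cst 0 %[ae mu] -> f = cst 0 %[ae mu].
Proof.
apply: filterS => x /= /(_ I) /eqP; rewrite /Defs.mulf mulf_eq0 => /orP[|/eqP//].
rewrite (inj_eq (@complexI R)) sqrtr_eq0 leNgt.
by case/andP: (g01 x) => ->.
Qed.

End Weights.

(** * Exhaustion of the metric space by bounded open sets *)

Section BallExhaustion.
Context {R : realType} {E : completeMetricType R} (x0 : E).

(** Taking interiors makes the sets open, hence generators of the Borel sigma-algebra. *)
Definition open_balls (j : nat) : set E := interior (ball x0 j%:R).

Lemma measurable_open_balls j : measurable (open_balls j : set (borel E)).
Proof. by apply: sub_sigma_algebra; exact: open_interior. Qed.

Lemma bounded_open_balls j : metric_bounded (open_balls j).
Proof. by exists x0, j%:R; exact: interior_subset. Qed.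

Lemma open_balls_nondecreasing : nondecreasing_seq open_balls.
Proof.
move=> i j ij; apply/subsetPset; apply: interiorS; apply: le_ball.
by rewrite ler_nat.
Qed.

Lemma ball_open_balls (r : R) : exists j, ball x0 r `<=` open_balls j.
Proof.
exists (Num.truncn (r + 1)).+1 => y yr; apply/nbhs_ballP; exists 1 => //= z yz.
apply: (@le_ball _ _ _ (r + 1)); first by apply/ltW; exact: truncnS_gt.
exact: ball_triangle yr yz.
Qed.

Lemma bounded_subset_open_balls (B : set E) : metric_bounded B ->
  exists j, B `<=` open_balls j.
Proof.
move=> [y [r By]].
have [j jP] := ball_open_balls (mdist x0 y + 1 + r).
exists j => z /By yz; apply: jP; apply: ball_triangle yz.
by rewrite ballEmdist /= ltrDl.
Qed.

Lemma open_balls_cover (x : E) : exists j, open_balls j x.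
Proof.
have [j jP] := ball_open_balls (mdist x0 x + 1).
by exists j; apply: jP; rewrite ballEmdist /= ltrDl.
Qed.

End BallExhaustion.

Theorem proposition2p8 (R : realType) (E : completeMetricType R)
  (E_locally_compact : locally_compact [set: E])
  (E_separable : separable E)
  (E_proper : forall B : set E, metric_bounded B -> compact (closure B))
  (mu : {sigma_finite_measure set (borel E) -> \bar R})
  (L : set (borel E -> R[i])) (Q : (borel E -> R[i]) -> (borel E -> R[i]))
  (V : set (borel E -> R[i])) (E0 : set (borel E))
  (L_closed : closed_subspace mu L)
  (Q_proj : orthogonal_projection mu L Q)
  (Q_loc : trace_class_loc mu Q)
  (V_subspace : is_subspace mu V)
  (V_findim : finite_dimensional mu V)
  (V_L2loc : V `<=` L2_loc mu)
  (E0_borel : measurable E0)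
  (hA : assumptionA mu L V Q E0)
  (V_cap_L2 : forall f, (V `&` L2 mu) f -> f = cst 0 %[ae mu])
  (g : nat -> borel E -> R)
  (g_measurable : forall n, measurable_fun setT (g n))
  (g_range : forall n x, 0 < g n x <= 1)
  (h1 : forall n, trace_class mu (sandwich (fun x => Num.sqrt (1 - g n x)) Q))
  (h2 : forall n, mulS mu (fun x => Num.sqrt (g n x)) V `<=` L2 mu)
  (h3 : exists2 alpha0 : R, 0 < alpha0 &
    forall n, (alpha0%:E <= angle mu (mulS mu (fun x => Num.sqrt (g n x)) L)
                                     (mulS mu (fun x => Num.sqrt (g n x)) V))%E)
  (h4 : forall B : set E, metric_bounded B ->
    (0 < ereal_inf [set (g n x)%:E | n in [set: nat] & x in E0 `|` B])%E /\
    sup [set `|g n x - 1| | x in E0 `|` B] @[n --> \oo] --> (0 : R)) :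
  let sqrtgH n := mulS mu (fun x => Num.sqrt (g n x)) (addS mu L V) in
  (forall n, closed_subspace mu (sqrtgH n)) /\
  forall Pi : nat -> (borel E -> R[i]) -> (borel E -> R[i]),
    (forall n, orthogonal_projection mu (sqrtgH n) (Pi n)) ->
    cvg_trace_class_loc mu Pi Q.
Proof.
move=> sqrtgH; pose H := l2_model mu.
pose h n x := Num.sqrt (g n x).
have ch n : contractive (h n) by exact: contractive_sqrtg.
have [sL LL2 _] := L_closed.
have [k [v [vP v_free]]] := real_basis_exists V_subspace V_findim.
have [vV Vv] := vP.
have closed n : closed_subspace mu (sqrtgH n).
  apply: (mulS_addS_closed (H := H) sL LL2 V_subspace (ch n) (h2 n) vV Vv).
    exact: classes_closed.
  apply: (bounded_below_sandwich L_closed Q_proj (ch n) _ _ (h1 n)).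
  - exact: contractive_sqrt1g.
  - exact: sqrtg_sum.
  - by move=> f _; exact: mulf_sqrt_eq0.
split=> [//|Pi PiP].
have [q [Qq pq cq]] := projection_acts (H := H) sL LL2 Q_proj.
have sqrtgH_sub n : is_subspace mu (sqrtgH n) by case: (closed n).
have sqrtgH_L2 n : sqrtgH n `<=` L2 mu by case: (closed n).
have [pin pinP] := choice (fun n => projection_acts (H := H) (sqrtgH_sub n) (sqrtgH_L2 n) (PiP n)).
have Pp n : acts (Pi n) (pin n) by case: (pinP n).
have pp n : projector (classes (sqrtgH n)) (pin n) by case: (pinP n).
have cp n : complex_operator (pin n) by case: (pinP n).
have bPi n : bounded_operator mu (Pi n) := acts_bounded_operator (Pp n) (cp n).
have [A1 _ _ A4] := hA.
have inf_g (B : set E) : metric_bounded B -> exists2 delta : R, 0 < delta &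
    forall n x, E0 x -> delta <= g n x.
  move=> /h4[+ _]; set I := ereal_inf _ => I0.
  (* The infimum is [+oo] when its index set is empty, so the witness is capped at 1. *)
  have [le1|gt1] := leP I 1%E.
    have IE : I = (fine I)%:E.
      by rewrite fineK// ge0_fin_numE ?(ltW I0)//; exact: le_lt_trans le1 (ltry _).
    exists (fine I); first by rewrite -lte_fin -IE.
    move=> n x E0x; rewrite -lee_fin -IE; apply: ereal_inf_lbound.
    by exists n => //; exists x => //; left.
  exists 1 => // n x E0x; rewrite -lee_fin; apply: (le_trans (ltW gt1)).
  apply: ereal_inf_lbound.
  by exists n => //; exists x => //; left.
have sup_g (B : set E) (e : R) : metric_bounded B -> 0 < e ->
    exists n0, forall n, (n0 <= n)%N -> forall x, B x -> `|g n x - 1| <= e.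
  move=> /h4[_ /cvgrPdist_le] cvg e0; have [n0 _ n0P] := cvg e e0.
  exists n0 => n n0n x Bx; have := n0P n n0n.
  rewrite /= sub0r normrN => /(le_trans (ler_norm _)); apply: le_trans.
  apply: ub_le_sup; last by exists x => //; right.
  exists 1 => _ [y _ <-]; have /andP[y0 y1] := g_range n y.
  by rewrite ler0_norm ?subr_le0//; lra.
(* The exhaustion needs a centre and [E] may be empty; the witness of the boundedness of [B]
   supplies the point [x0] below. *)
have inhab_cvg (x0 : E) (B : set (borel E)) : measurable B -> metric_bounded B ->
    trace_class mu (sandwich \1_B Q) ->
    (forall n, trace_class mu (sandwich \1_B (Pi n))) /\
    trace_norm mu (sandwich \1_B (fun f x => Pi n f x - Q f x))
      @[n --> \oo] --> 0%E.
  move=> mB bB tQ.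
  pose X : nat -> set (borel E) := open_balls x0.
  have [j0 BX] := bounded_subset_open_balls x0 bB.
  have c0E0 : contractive (\1_E0 : borel E -> R) by exact: contractive_indic.
  have [c0 c0_gt0 c0P] : bounded_below (classes (H := H) L) (Mul \1_E0).
    apply: (bounded_below_sandwich L_closed Q_proj c0E0 _ _ A1).
    - by apply: contractive_indic; exact: measurableC.
    - move=> x; rewrite !indicE in_setC.
      by case: (_ \in _); rewrite /= ?expr1n ?expr0n /= ?addr0 ?add0r.
    - by [].
  have [delta delta0 deltaP] := inf_g B bB.
  have sd : 0 < Num.sqrt delta by rewrite sqrtr_gt0.
  (* The lower bound obtained directly for [h n] would depend on [n]. Here [h n >= sqrt delta] on
     [E0], so it is at least [sqrt delta] times the indicator of [E0], whose lower bound [c0] on [L]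
     does not involve [n]. *)
  have h_below n (u : H) : classes L u -> (c0 * Num.sqrt delta) * hn u <= hn (Mul (h n) u).
    move=> /c0P c0u; rewrite mulrAC -ler_pdivlMr// [leRHS]mulrC; apply: le_trans c0u _.
    apply: hn_Mul_le => //.
    move=> x; rewrite indicE; have [xE|_] := boolP (x \in E0); last first.
      by rewrite normr0 mulr_ge0// invr_ge0 ltW.
    rewrite normr1 ler_pdivlMl// mulr1 ger0_norm ?sqrtr_ge0//.
    by apply: ler_wsqrtr; apply: deltaP; rewrite inE in xE.
  have [alpha a0 aP] := h3.
  have [kappa k01 kP] := angle_bound (H := H) a0.
  have mulSm n W f : is_subspace mu W -> W f -> mulS mu (h n) W (Defs.mulf (h n) f).
    move=> [Wm _ _ _] Wf; split; last by exists f => //; exact: ae_refl.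
    by apply: cmeasurable_mulf; [case: (ch n)|exact: Wm].
  have mulSL n : mulS mu (h n) L `<=` L2 mu.
    move=> f [mf [l Ll fE]]; apply: (L2_ae mf (L2_mulf (ch n) (LL2 _ Ll))).
    exact: ae_sym.
  have mulSN n f : mulS mu (h n) L f -> mulS mu (h n) L (fun x => - f x).
    move=> [mf [l Ll fE]]; split.
      have := cmeasurableZ (-1) mf.
      by congr cmeasurable; apply/funext => x; rewrite mulN1r.
    exists (fun x => -1 * l x); first exact: subspaceZ sL Ll.
    apply: ae_trans (ae_map (fun=> -%R) fE) _.
    by apply: aeW => x _; rewrite /Defs.mulf mulrCA mulN1r.
  have h_angle n (u : H) f : classes L u -> V f ->
    - ip (Mul (h n) u) (cls H (Defs.mulf (h n) f)) <=
    kappa * (hn (Mul (h n) u) * hn (cls H (Defs.mulf (h n) f))).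
    move=> Lu Vf.
    apply: (kP _ _ (mulSL n) (h2 n) (mulSN n) (aP n)); exact: mulSm.
  have mX := measurable_open_balls x0.
  have VX f : V f -> forall j, L2 mu (Defs.mulf \1_(X j) f).
    move=> Vf j; have [mf /(_ _ (mX j) (bounded_open_balls x0 j))[_ fi]] := V_L2loc _ Vf.
    split; first by apply: cmeasurable_mulf => //; exact: measurable_indic.
    apply: le_lt_trans fi; rewrite [leRHS]integral_mkcond.
    rewrite le_eqVlt; apply/orP; left; apply/eqP; apply: eq_integral => x _.
    rewrite patchE cabs2M cabs2C indicE.
    by case: ifP => _; rewrite ?expr1n ?mul1r// expr0n mul0r.
  have h_cvg j (e : R) : 0 < e -> exists n0, forall n, (n0 <= n)%N ->
      forall x, X j x -> `|h n x - 1| <= e.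
    move=> /(sup_g (X j) e (bounded_open_balls x0 j))[n0 n0P].
    exists n0 => n n0n x Xx; apply: le_trans (n0P n n0n x Xx).
    exact: (sqrtg_dist (g_range n)).
  have h_gt0 n x : 0 < h n x by rewrite sqrtr_gt0; case/andP: (g_range n x).
  have c1_gt0 : 0 < c0 * Num.sqrt delta by rewrite mulr_gt0.
  split.
    move=> n; exact: (trace_class_pinB L_closed Qq pq cq V_subspace vP ch h2 c1_gt0 k01
      h_below h_angle pp mB tQ (Pp n) (cp n)).
  exact: (trace_norm_pin_cvg L_closed Qq pq cq V_subspace V_cap_L2 vP v_free
      mX (open_balls_nondecreasing x0) (open_balls_cover x0) VX ch h_gt0 h_cvg h2
      c1_gt0 k01 h_below h_angle pp mB BX tQ Pp cp).
have [_ Q_tc] := Q_loc.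
split; [|exact: Q_loc|].
- move=> n; split; first exact: bPi.
  move=> B mB bB; have [x0 _] := bB.
  exact: (inhab_cvg x0 B mB bB (Q_tc B mB bB)).1.
- move=> B mB bB; have [x0 _] := bB.
  exact: (inhab_cvg x0 B mB bB (Q_tc B mB bB)).2.
Qed.
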